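(* Let $N\ge 2$, $1^\ast=\frac{N}{N-1}$ and $1<q\le 1^\ast$. The imbedding $\dot{BV}(\mathbb{R}^N)\hookrightarrow L^{1^\ast,q}(\mathbb{R}^N)$ is cocompact with respect to the group $\mathcal{D}=\{g[j,y] : j\in\mathbb{Z},\,y\in\mathbb{R}^N\}$, where $g[j,y]u=2^{(N-1)j}u(2^j(\cdot-y))$. That is, if $\{u_k\}\subset\dot{BV}(\mathbb{R}^N)$ is a sequence such that for every sequence $\{(j_k,y_k)\}\subset\mathbb{Z}\times\mathbb{R}^N$ one has $g[j_k,y_k]u_k\rightharpoonup 0$ in $\dot{BV}(\mathbb{R}^N)$ as $k\to\infty$, then $u_k\to 0$ in $L^{1^\ast,q}(\mathbb{R}^N)$.
   Context: $\dot{BV}(\mathbb{R}^N)$ is the space of all measurable functions $u$ on $\mathbb{R}^N$ (locally integrable, identified when equal a.e.) that vanish at infinity, i.e. $|\{x\in\mathbb{R}^N : |u(x)|>M\}|<\infty$ for every $M>0$ (where $|A|$ is Lebesgue measure), and satisfy $$\|u\|_{\dot{BV}}=\|Du\|=\sup\Big\{\int_{\mathbb{R}^N}u\,\mathrm{div}\,v\,dx : v\in C_0^\infty(\mathbb{R}^N;\mathbb{R}^N),\ \|v\|_\infty\le 1\Big\}<\infty,$$ with $\|v\|_\infty=\sup_x\big(\sum_{i=1}^N v_i(x)^2\big)^{1/2}$; $C_0^\infty$ means smooth with compact support. Weak convergence $u_n\rightharpoonup u$ in $\dot{BV}(\mathbb{R}^N)$ means: $u_n\to u$ in $L^1_{loc}(\mathbb{R}^N)$,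 and for each $1\le i\le N$ the distributional derivatives satisfy $\partial_i u_n\rightharpoonup\partial_i u$ weakly as finite measures on $\mathbb{R}^N$, i.e. weak-* in $(C_0(\mathbb{R}^N))^\ast$, where $C_0(\mathbb{R}^N)$ denotes continuous functions tending to $0$ at infinity. Lorentz space: for measurable $u$ let $\mu(\lambda)=|\{x : |u(x)|>\lambda\}|$ and $u^\ast(t)=\sup\{\lambda>0 : \mu(\lambda)>t\}$ (with $\sup\emptyset=0$). For $q<\infty$, $L^{p,q}(\mathbb{R}^N)$ is the set of measurable $u$ with finite quasinorm $\|u\|_{L^{p,q}}=\big(\int_0^\infty (u^\ast(t)t^{1/p})^q\frac{dt}{t}\big)^{1/q}$. Convergence in $L^{p,q}$ is with respect to this quasinorm. *)

(* Defs.v *)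
From HB Require Import structures.
From mathcomp Require Import all_boot all_order all_algebra.
From mathcomp Require Import all_classical all_reals all_analysis.

Set Implicit Arguments.
Unset Strict Implicit.
Unset Printing Implicit Defensive.

Import Order.TTheory GRing.Theory Num.Theory.
Import numFieldNormedType.Exports.

Local Open Scope classical_set_scope.
Local Open Scope ring_scope.

(* R^N is ['rV[R]_N].  Its default sigma-algebra is generated by the
   coordinate maps; it coincides with the Borel sigma-algebra. *)

Definition rV_display : measure_display.
Proof. exact: default_measure_display. Qed.

Section measurable_rV.
Context (R : realType) (n : nat).

Definition rV_coord (i : 'I_n) (v : 'rV[R]_n) : measurableTypeR R := v ord0 i.

Let rV_set0 : g_sigma_preimage rV_coord set0.
Proof. exact: sigma_algebra0. Qed.

Let rV_setC A : g_sigma_preimage rV_coord A -> g_sigma_preimage rV_coord (~` A).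
Proof. exact: sigma_algebraC. Qed.

Let rV_bigcup (F : (set 'rV[R]_n)^nat) :
  (forall i, g_sigma_preimage rV_coord (F i)) ->
  g_sigma_preimage rV_coord (\bigcup_i (F i)).
Proof. exact: sigma_algebra_bigcup. Qed.

HB.instance Definition _ :=
  @isMeasurable.Build rV_display 'rV[R]_n
    (g_sigma_preimage rV_coord) rV_set0 rV_setC rV_bigcup.

End measurable_rV.

Lemma measurable_rVP d (T : measurableType d) (R : realType) n
    (f : T -> 'rV[R]_n) :
  (forall i, measurable_fun [set: T] (rV_coord i \o f)) ->
  measurable_fun [set: T] f.
Proof.
move=> mf _ A mA; rewrite setTI.
suff : g_sigma_preimage (@rV_coord R n) `<=` [set B | measurable (f @^-1` B)].
  exact.
apply: smallest_sub.
  split => /=.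
  - by rewrite preimage_set0; exact: measurable0.
  - by move=> B mB; rewrite setTD preimage_setC; exact: measurableC.
  - by move=> F mF; rewrite preimage_bigcup; exact: bigcup_measurable.
case: n f mf A mA => [|n] f mf A mA; first by rewrite big_ord0.
rewrite -bigcup_mkord_ord; apply: bigcup_sub => i Ii.
move=> B [C mC <-] /=; rewrite setTI -comp_preimage.
by rewrite -[X in measurable X]setTI; exact: mf.
Qed.

Lemma measurable_rV_coord (R : realType) n (i : 'I_n) :
  measurable_fun [set: 'rV[R]_n] (rV_coord i).
Proof.
move=> _ Y mY; apply: sub_sigma_algebra => /=.
rewrite -bigcup_seq/=; exists i => /=; first by rewrite mem_index_enum.
by exists Y.
Qed.

(* lambda^(n+1) is the image of (lambda \x lambda^n) under the identification
   of R x R^n with R^(n+1). *)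
Section rV_lebesgueS.
Context (R : realType) (n : nat) (mu : {sigma_finite_measure set 'rV[R]_n -> \bar R}).
Local Open Scope ereal_scope.

Definition rV_cons (p : measurableTypeR R * 'rV[R]_n) : 'rV[R]_n.+1 :=
  row_mx (p.1 : R)%:M p.2.

Lemma rV_cons0 p : rV_cons p ord0 ord0 = p.1.
Proof.
case: p => x v; transitivity (rV_cons (x, v) ord0 (@lshift 1 n ord0)).
  by congr (rV_cons _ _ _); exact: val_inj.
by apply: etrans (row_mxEl _ _ _ _) _; rewrite mxE eqxx.
Qed.

Lemma rV_consS p (j : 'I_n) : rV_cons p ord0 (lift ord0 j) = p.2 ord0 j.
Proof.
transitivity (rV_cons p ord0 (@rshift 1 n j)); last exact: row_mxEr.
by congr (rV_cons _ _ _); exact: val_inj.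
Qed.

Lemma measurable_rV_cons : measurable_fun setT rV_cons.
Proof.
apply: measurable_rVP => i.
case: (unliftP ord0 i) => [j|] ->.
  rewrite (_ : _ \o _ = rV_coord (j : 'I_n) \o snd).
    by apply: measurableT_comp => //; exact: measurable_rV_coord.
  by apply/funext => p; rewrite /rV_coord /comp rV_consS.
rewrite (_ : _ \o _ = fst) //.
by apply/funext => p; rewrite /rV_coord /comp rV_cons0.
Qed.

Definition rV_lebesgueS : set 'rV[R]_n.+1 -> \bar R :=
  pushforward (@lebesgue_measure R \x mu) rV_cons.

Let rV_lebesgueS0 : rV_lebesgueS set0 = 0.
Proof. by rewrite /rV_lebesgueS /pushforward preimage_set0 measure0. Qed.

Let rV_lebesgueS_ge0 A : 0 <= rV_lebesgueS A.
Proof. exact: (measure_ge0 (@lebesgue_measure R \x mu)). Qed.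

Let rV_lebesgueS_sigma_additive : semi_sigma_additive rV_lebesgueS.
Proof.
move=> F mF tF mUF; rewrite /rV_lebesgueS /pushforward preimage_bigcup.
have mpre A : measurable A -> measurable (rV_cons @^-1` A).
  by move=> mA; rewrite -[X in measurable X]setTI; exact: measurable_rV_cons.
apply: measure_semi_sigma_additive.
- by move=> k; exact: mpre.
- apply/trivIsetP => /= i j _ _ ij; rewrite -preimage_setI.
  by move/trivIsetP : tF => /(_ _ _ _ _ ij) ->//; rewrite preimage_set0.
- by rewrite -preimage_bigcup; exact: mpre.
Qed.

HB.instance Definition _ := isMeasure.Build _ _ _ rV_lebesgueS
  rV_lebesgueS0 rV_lebesgueS_ge0 rV_lebesgueS_sigma_additive.

Let rV_uncons (v : 'rV[R]_n.+1) : measurableTypeR R * 'rV[R]_n :=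
  (rV_coord ord0 v, \row_j v ord0 (lift ord0 j)).

Let rV_consK : cancel rV_cons rV_uncons.
Proof.
move=> [x v]; rewrite /rV_uncons /rV_coord rV_cons0; congr pair.
by apply/rowP => j; rewrite mxE rV_consS.
Qed.

Let measurable_rV_uncons : measurable_fun setT rV_uncons.
Proof.
apply: measurable_fun_pair; first exact: measurable_rV_coord.
apply: measurable_rVP => i.
rewrite (_ : _ \o _ = rV_coord (lift ord0 i)); first exact: measurable_rV_coord.
by apply/funext => v; rewrite /rV_coord /= mxE.
Qed.

Let rV_lebesgueS_sigma_finite : sigma_finite setT rV_lebesgueS.
Proof.
have /sigma_finiteP[F [TF ndF Foo]] := sigma_finiteT (@lebesgue_measure R).
have /sigma_finiteP[G [TG ndG Goo]] := sigma_finiteT mu.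
exists (fun k => rV_uncons @^-1` (F k `*` G k)).
  rewrite -preimage_bigcup -(preimage_setT rV_uncons); congr (_ @^-1` _).
  rewrite -setXTT TF TG predeqE => -[x y]; split.
    move=> [/= [k _ Fkx] [l _ Gly]]; exists (maxn k l) => //; split.
    - by move: x Fkx; exact/subsetPset/ndF/leq_maxl.
    - by move: y Gly; exact/subsetPset/ndG/leq_maxr.
  by move=> [k _ []/= ? ?]; split; exists k.
move=> k; have [mF Fk] := Foo k; have [mG Gk] := Goo k.
have mFG : measurable (F k `*` G k) by exact: measurableX.
split.
  by rewrite -[X in measurable X]setTI; exact: measurable_rV_uncons.
rewrite /rV_lebesgueS /pushforward -comp_preimage.
rewrite (_ : rV_uncons \o rV_cons = id); last exact/funext/rV_consK.
by rewrite preimage_id product_measure1E// lte_mul_pinfty// ge0_fin_numE.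
Qed.

HB.instance Definition _ := Measure_isSigmaFinite.Build _ _ _ rV_lebesgueS
  rV_lebesgueS_sigma_finite.

End rV_lebesgueS.

Fixpoint rV_lebesgue (R : realType) (n : nat) :
    {sigma_finite_measure set 'rV[R]_n -> \bar R} :=
  if n is m.+1 then rV_lebesgueS (rV_lebesgue R m)
  else \d_(0 : 'rV[R]_0).

(* R^N with the sigma-algebra of Lebesgue measurable sets. *)
Definition lebRN (R : realType) (N : nat) :=
  caratheodory_type (rV_lebesgue R N)^*%mu.

Definition leb (R : realType) (N : nat) : {measure set (lebRN R N) -> \bar R} :=
  @completed_measure_extension _ _ _ (rV_lebesgue R N).

Section spaces.
Context {R : realType} {N : nat}.
Implicit Types (u f phi : 'rV[R]_N -> R) (v : 'rV[R]_N -> 'rV[R]_N).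

Local Notation mu := (leb R N).

Definition pderive (i : 'I_N) f : 'rV[R]_N -> R :=
  fun x => 'D_(delta_mx ord0 i) f x.

Definition pderivable (i : 'I_N) f : Prop :=
  forall x, derivable f x (delta_mx ord0 i).

Fixpoint iter_pderive (s : seq 'I_N) f : 'rV[R]_N -> R :=
  if s is i :: s' then pderive i (iter_pderive s' f) else f.

(* C^oo: all iterated partial derivatives exist and are continuous. *)
Definition smooth f : Prop := forall s : seq 'I_N,
  continuous (iter_pderive s f) /\ forall i, pderivable i (iter_pderive s f).

Definition compactly_supported f : Prop := compact (closure [set x | f x != 0]).

Definition test_function phi : Prop := smooth phi /\ compactly_supported phi.

Definition test_field v : Prop :=
  forall i : 'I_N, test_function (fun x => v x ord0 i).

Definition enorm (x : 'rV[R]_N) : R := Num.sqrt (\sum_i x ord0 i ^+ 2).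

Definition divergence v : 'rV[R]_N -> R :=
  fun x => \sum_i pderive i (fun y => v y ord0 i) x.

Definition BVnorm u : \bar R :=
  ereal_sup [set (\int[mu]_x (u x * divergence v x)%:E)%E | v in
    [set v | test_field v /\ forall x, enorm (v x) <= 1]].

Definition loc_integrable u : Prop := forall K : set 'rV[R]_N,
  compact K -> mu.-integrable (K : set (lebRN R N)) (EFin \o u).

Definition distr u (l : R) : \bar R := mu [set x : lebRN R N | l < `|u x|].

Definition vanishes_at_infinity u : Prop :=
  forall M : R, 0 < M -> (distr u M < +oo)%E.

Definition BVdot : set ('rV[R]_N -> R) := [set u |
  [/\ measurable_fun [set: lebRN R N] (u : lebRN R N -> R), loc_integrable u,
      vanishes_at_infinity u & (BVnorm u < +oo)%E]].

Definition C0 phi : Prop := continuous phi /\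
  forall e : R, 0 < e -> exists M : R, forall x, M <= `|x| -> `|phi x| < e.

(* Integral against a finite signed Borel measure, through its Jordan
   decomposition (which does not depend on the Hahn decomposition chosen). *)
Definition charge_integral (nu : {charge set 'rV[R]_N -> \bar R}) phi : R :=
  let PN := cid (Hahn_decomposition nu) in
  let nuPN := svalP (cid (svalP PN)) in
  \int[jordan_pos nuPN]_x phi x - \int[jordan_neg nuPN]_x phi x.

(* The finite signed measure nu is the distributional derivative d_i u. *)
Definition is_deriv_measure (i : 'I_N) u
    (nu : {charge set 'rV[R]_N -> \bar R}) : Prop :=
  forall phi, test_function phi ->
    charge_integral nu phi = - \int[mu]_x (u x * pderive i phi x).

Definition cvg_L1loc (u_ : nat -> 'rV[R]_N -> R) u : Prop :=
  forall K : set 'rV[R]_N, compact K ->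
    (\int[mu]_(x in (K : set (lebRN R N))) `|u_ n x - u x|%:E)%E @[n --> \oo]
      --> 0%E.

(* The measures nu_ n and nu below are unique, as test functions are dense
   in C_0, and exist as soon as u_ n and u are in BVdot. *)
Definition weak_cvg (u_ : nat -> 'rV[R]_N -> R) u : Prop :=
  cvg_L1loc u_ u /\
  forall i : 'I_N, exists (nu_ : nat -> {charge set 'rV[R]_N -> \bar R})
      (nu : {charge set 'rV[R]_N -> \bar R}),
    [/\ forall n, is_deriv_measure i (u_ n) (nu_ n), is_deriv_measure i u nu &
      forall phi, C0 phi ->
        charge_integral (nu_ n) phi @[n --> \oo] --> charge_integral nu phi].

Definition dilation (j : int) (y : 'rV[R]_N) u : 'rV[R]_N -> R :=
  fun x => (2 : R) ^ (N.-1%:Z * j) * u ((2 : R) ^ j *: (x - y)).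

(* [maxe 0] only accounts for the convention sup set0 = 0. *)
Definition rearrangement u (t : R) : \bar R :=
  maxe 0%E (ereal_sup [set l%:E | l in [set l : R | 0 < l /\ (t%:E < distr u l)%E]]).

Definition lorentz_norm (p q : R) u : \bar R :=
  ((\int[lebesgue_measure]_(t in `]0%R, +oo[)
     ((rearrangement u t * (t `^ p^-1)%:E) `^ q * (t^-1)%:E)) `^ q^-1)%E.

Definition lorentz (p q : R) : set ('rV[R]_N -> R) := [set u |
  measurable_fun [set: lebRN R N] (u : lebRN R N -> R) /\
  (lorentz_norm p q u < +oo)%E].

Definition cvg_lorentz (p q : R) (u_ : nat -> 'rV[R]_N -> R) u : Prop :=
  [/\ forall n, lorentz p q (u_ n), lorentz p q u &
      lorentz_norm p q (fun x => u_ n x - u x) @[n --> \oo] --> 0%E].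

End spaces.

(* Main.v *)
Require Import Defs.
From HB Require Import structures.
From mathcomp Require Import all_boot all_order all_algebra.
From mathcomp Require Import all_classical all_reals all_analysis.
From mathcomp Require Import measurable_realfun.
From mathcomp Require Import ring lra zify.

Set Implicit Arguments.
Unset Strict Implicit.
Unset Printing Implicit Defensive.

Import Order.TTheory GRing.Theory Num.Theory.
Import numFieldNormedType.Exports.

Local Open Scope classical_set_scope.
Local Open Scope ring_scope.

(* The argument has four steps.  Weak convergence with j = 0, y = 0 bounds the
   derivative measures pointwise on C_0, hence, by uniform boundedness, their
   total variations by some V; dually, |u_k(. + h e_i) - u_k| has integral at
   most h V.  Writing a Borel representative u of u_k as a sum of slices
   min(|u|, b) - min(|u|, a) over consecutive dyadic levels, the variations of
   the slices add up to at most V; comparing each slice with its averages over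
   cubes of volume comparable to |{|u| > a}| gives the strong form
     sum_j 2^j |{|u| > 2^(j+1)}|^((N-1)/N) <= 64 N V
   of the Sobolev inequality.  Vanishing of all dilated sequences in L^1 of the
   unit cube says that r^(-1) times the integral of |u_k| over a cube of dyadic
   side r is uniformly small; choosing the cube side in terms of the level
   instead makes every term of the above sum small, uniformly in j.  Since
   q > 1, the q-th powers of the terms, which control the L^(1*,q) norm, then
   have a small sum. *)

(** * Lebesgue measure on R^N *)

(** Finiteness of [BVnorm] holds for each [u_k] separately; a bound common to all k has to be
    extracted from weak convergence, which is why functionals on C_0 enter. Variation is encoded by
    bounds on the L^1 modulus of translation [L1diff]. Truncation acts on it pointwise, so the
    additivity over slices comes from a telescoping sum of real numbers, in place of the coarea
    formula. Vanishing at infinity makes superlevel sets finite, without any rate as the level tends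
    to 0. A recursion over the levels c 2^k would start from a term that is not controlled as c
    tends to 0; with the levels d + c 2^k, d fixed, this term does tend to 0. The functions of the
    statement are measurable for the completed sigma-algebra, whereas Tonelli's theorem is applied
    to [f (x + z)], whose joint measurability is immediate for Borel [f]. Hence the passage to Borel
    representatives, and the comparison of some integrals without measurability. *)

Section image_measure.
Context d1 d2 (T1 : measurableType d1) (T2 : measurableType d2) (R : realType).
Variables (m1 : {measure set T1 -> \bar R}) (m2 : {measure set T2 -> \bar R}).
Variable phi : T1 -> T2.
Hypothesis mphi : measurable_fun [set: T1] phi.
Hypothesis m12 : forall A, measurable A -> m1 (phi @^-1` A) = m2 A.
Local Open Scope ereal_scope.

Lemma ge0_integral_image (D : set T2) (f : T2 -> \bar R) : measurable D ->
  measurable_fun D f -> (forall x, D x -> 0 <= f x) ->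
  \int[m1]_(x in phi @^-1` D) f (phi x) = \int[m2]_(x in D) f x.
Proof.
move=> mD mf f0.
rewrite -(ge0_integral_pushforward mphi m1 mD)//; last first.
  by move=> y /set_mem; exact: f0.
by apply: eq_measure_integral => A mA _; exact: m12.
Qed.

Lemma integral_image (D : set T2) (f : T2 -> \bar R) : measurable D ->
  measurable_fun D f ->
  \int[m1]_(x in phi @^-1` D) f (phi x) = \int[m2]_(x in D) f x.
Proof.
move=> mD mf; rewrite integralE [RHS]integralE; congr (_ - _).
  rewrite -(ge0_integral_image mD (measurable_funepos mf)) => [|x _ //].
  by apply: eq_integral => x _; rewrite -[fun x0 => f _]/(f \o phi) funepos_comp.
rewrite -(ge0_integral_image mD (measurable_funeneg mf)) => [|x _ //].
  by apply: eq_integral => x _; rewrite -[fun x0 => f _]/(f \o phi) funeneg_comp.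
Qed.

End image_measure.

Lemma measure_bigcup0 d (T : measurableType d) (R : realType)
    (m : {measure set T -> \bar R}) (F : nat -> set T) :
  (forall n, measurable (F n)) -> (forall n, m (F n) = 0%E) ->
  m (\bigcup_n F n) = 0%E.
Proof.
move=> mF F0; apply: measure_negligible; first exact: bigcupT_measurable.
apply: negligible_bigcup => k.
by exists (F k); split; [exact: mF|exact: F0|].
Qed.

(** * Borel hulls and Borel representatives *)

Section completion.
Context {R : realType} {N : nat}.
Local Notation E := 'rV[R]_N.
Local Notation L := (lebRN R N).
Local Notation lam := (rV_lebesgue R N).
Local Open Scope ereal_scope.

Lemma measurable_lebRN (A : set E) : measurable A -> measurable (A : set L).
Proof. by move=> mA; apply: caratheodory_measurable_mu_ext. Qed.

Lemma lebE (A : set E) : measurable A -> leb R N A = lam A.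
Proof. by move=> mA; exact: measurable_mu_extE. Qed.

Lemma measurable_id_leb : measurable_fun [set: L] (id : L -> E).
Proof. by move=> _ A mA; rewrite setTI; exact: measurable_lebRN. Qed.

Lemma measurable_funT_lebRN d (T : measurableType d) (f : E -> T) :
  measurable_fun [set: E] f -> measurable_fun [set: L] (f : L -> T).
Proof. by move=> mf _ A mA; apply: measurable_lebRN; exact: mf. Qed.

Lemma ge0_integral_lebE (D : set E) (f : E -> \bar R) : measurable D ->
  measurable_fun D f -> (forall x, D x -> 0 <= f x) ->
  \int[leb R N]_(x in (D : set L)) f x = \int[lam]_(x in D) f x.
Proof. by move=> *; exact: (ge0_integral_image measurable_id_leb lebE). Qed.

Lemma integral_lebE (D : set E) (f : E -> \bar R) : measurable D ->
  measurable_fun D f ->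
  \int[leb R N]_(x in (D : set L)) f x = \int[lam]_(x in D) f x.
Proof. by move=> *; exact: (integral_image measurable_id_leb lebE). Qed.

(** The outer measure is an infimum over countable measurable covers; intersecting covers within
    1/(n+1) of it attains the infimum. The whole space serves when it is infinite. *)
Lemma outer_cover (A : set E) :
  exists B : set E, [/\ measurable B, A `<=` B & lam B = (lam^*)%mu A].
Proof.
have [Aoo|Aoo] := eqVneq ((lam^*)%mu A) +oo.
  exists setT; split => //; rewrite Aoo; apply/eqP; rewrite -leye_eq -Aoo.
  by rewrite -(measurable_mu_extE lam) //; apply: le_outer_measure.
have Afin : (lam^*)%mu A \is a fin_num.
  by rewrite ge0_fin_numE ?outer_measure_ge0// ltey.
have cov n : exists B : set E, [/\ measurable B, A `<=` B &
    lam B <= (lam^*)%mu A + n.+1%:R^-1%:E].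
  have n0 : (0 < n.+1%:R^-1 :> R)%R by rewrite invr_gt0.
  have [_ [F [mF AF] <-] FA] := lb_ereal_inf_adherent n0 Afin.
  exists (\bigcup_k F k); split => //; first exact: bigcupT_measurable.
  apply: le_trans (ltW FA).
  rewrite -(measurable_mu_extE lam) //; last exact: bigcupT_measurable.
  apply: (le_trans (outer_measure_sigma_subadditive (lam^*)%mu F)).
  by apply: lee_nneseries => k *; [exact: outer_measure_ge0|rewrite [leLHS](measurable_mu_extE lam)].
have [B /all_and3[mB AB BA]] := choice cov.
exists (\bigcap_n B n); split; [exact: bigcapT_measurable| exact: sub_bigcap|].
apply/eqP; rewrite eq_le; apply/andP; split.
  apply/lee_addgt0Pr => e e0.
  near \oo => n.
  apply: (@le_trans _ _ (lam (B n))).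
    by apply: le_measure; rewrite ?inE//; [exact: bigcapT_measurable|exact: bigcap_inf].
  apply: (le_trans (BA n)); rewrite leeD// lee_fin ltW//.
  by near: n; apply: near_infty_natSinv_lt (PosNum e0).
rewrite -(measurable_mu_extE lam); last exact: bigcapT_measurable.
by apply: le_outer_measure; exact: sub_bigcap.
Unshelve. all: by end_near. Qed.

(** Subtracting measures requires finite mass, so [A] is cut along a sigma-finite exhaustion [F]. On
    each piece the excess of the hull over [A] is Lebesgue null, hence enclosed in a Borel null set
    by [outer_cover] again. *)
Lemma borel_hull (A : set L) : measurable A ->
  exists B Z : set E, [/\ measurable B, measurable Z, lam Z = 0 & A `\` Z = B `\` Z].
Proof.
move=> mA.
have /sigma_finiteP[F [TF _ Foo]] := sigma_finiteT lam.
have hull n : exists BZ : set E * set E, [/\ measurable BZ.1, measurable BZ.2,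
    lam BZ.2 = 0, A `&` F n `<=` BZ.1 & BZ.1 `\` (A `&` F n) `<=` BZ.2].
  have [B [mB AB BA]] := outer_cover (A `&` F n).
  have [Z [mZ DZ Z0]] := outer_cover (B `\` (A `&` F n)).
  exists (B, Z); split => //=; rewrite Z0.
  have mAF : measurable (A `&` F n : set L).
    by apply: measurableI => //; apply: measurable_lebRN; have [] := Foo n.
  change (leb R N (B `\` (A `&` F n)) = 0).
  have AFoo : (leb R N (A `&` F n) < +oo).
    apply: (@le_lt_trans _ _ (leb R N (F n))).
      apply: le_outer_measure; exact: subIsetr.
    by rewrite lebE; have [] := Foo n.
  rewrite measureD//.
  - rewrite setIidr// [X in X - _](lebE mB).
    change (lam B - (lam^*)%mu (A `&` F n) = 0).
    by rewrite -BA subee// ge0_fin_numE// BA.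
  - exact: measurable_lebRN.
  - by apply: le_lt_trans AFoo; rewrite [leLHS](lebE mB) BA.
have [BZ /all_and5[mB mZ Z0 AB BAZ]] := choice hull.
exists (\bigcup_n (BZ n).1), (\bigcup_n (BZ n).2); split.
- exact: bigcupT_measurable.
- exact: bigcupT_measurable.
- exact: measure_bigcup0.
- apply/seteqP; split => x [Ax nZ]; split => //.
    have [n _ Fn] : (\bigcup_n F n) x by rewrite -TF.
    by exists n => //; apply: AB.
  case: Ax => n _ Bn; apply: contrapT => nA; apply: nZ; exists n => //.
  by apply: BAZ; split => // -[].
Qed.

(** Superlevel sets at rational levels determine a function, so there are countably many exceptional
    null sets; resetting the function to 0 on their union makes it Borel. *)
Lemma borel_version (u : L -> R) : measurable_fun [set: L] u ->
  exists (v : E -> R) (Z : set E), [/\ measurable_fun [set: E] v, measurable Z,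
    lam Z = 0 & forall x, ~ Z x -> u x = v x].
Proof.
move=> mf.
pose q_ n : R := ratr (odflt 0%R (unpickle n : option rat)).
have hull n : exists BZ : set E * set E, [/\ measurable BZ.1, measurable BZ.2,
    lam BZ.2 = 0 & (u @^-1` `]q_ n, +oo[%classic) `\` BZ.2 = BZ.1 `\` BZ.2].
  have : measurable (u @^-1` `]q_ n, +oo[%classic : set L).
    by rewrite -[X in measurable X]setTI; exact: mf.
  by move=> /borel_hull[B [Z [mB mZ Z0 BZ]]]; exists (B, Z).
have [BZ /all_and4[mB mZ Z0 uB]] := choice hull.
pose Z := \bigcup_n (BZ n).2.
have mZZ : measurable Z by exact: bigcupT_measurable.
pose v x := if x \in Z then 0%R else u x.
exists v, Z; split => //; [|exact: measure_bigcup0|]; last first.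
  by move=> x Zx; rewrite /v memNset.
apply: (measurability _ (RGenOInfty.measurableE R)).
move=> _ [_ [a ->] <-]; rewrite setTI.
(* The new function is 0 on [Z], so [Z] belongs to the superlevel set of [a] exactly when [a < 0],
   that is, when some rational lies strictly between [a] and 0. *)
rewrite (_ : _ @^-1` _ = \bigcup_n
   (if (a < q_ n)%R then ((BZ n).1 `\` Z) `|` (if (q_ n < 0)%R then Z else set0)
    else set0)).
  apply: bigcupT_measurable => n; case: ifP => // _.
  by apply: measurableU; [exact: measurableD|case: ifP].
apply/seteqP; split => x /=; rewrite in_itv/= andbT.
  move=> /rat_in_itvoo[q]; rewrite in_itv/= => /andP[aq qv].
  exists (pickle q) => //; rewrite /q_ pickleK/= aq.
  move: qv; rewrite /v; case: ifPn => [/set_mem Zx q0|/negP]; first by right; rewrite q0.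
  rewrite inE => Zx qu; left; split => //.
  have nZ : ~ (BZ (pickle q)).2 x by move=> ?; apply: Zx; exists (pickle q).
  suff : ((BZ (pickle q)).1 `\` (BZ (pickle q)).2) x by case.
  by rewrite -uB; split => //=; rewrite in_itv/= andbT /q_ pickleK.
move=> [n _]; case: ifPn => // an [[Bx Zx]|].
  have nZ : ~ (BZ n).2 x by move=> ?; apply: Zx; exists n.
  have : ((BZ n).1 `\` (BZ n).2) x by [].
  rewrite -uB => -[/=]; rewrite in_itv/= andbT => qu _.
  by rewrite /v memNset//; exact: lt_trans qu.
by case: ifPn => // q0 Zx; rewrite /v (mem_set Zx); exact: lt_trans q0.
Qed.

End completion.

(** * Affine changes of variables *)

Section affine.
Context {R : realType}.

Lemma measurable_rV_affine N (a : R) (v : 'rV[R]_N) :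
  measurable_fun [set: 'rV[R]_N] (fun x : 'rV[R]_N => a *: x + v).
Proof.
apply: measurable_rVP => i.
rewrite (_ : _ \o _ = (fun t : R => a * t + v ord0 i) \o (rV_coord i)).
  apply: measurableT_comp; last exact: measurable_rV_coord.
  by apply: measurable_funD => //; exact: measurable_funM.
by apply/funext => x; rewrite /rV_coord /= !mxE.
Qed.

Lemma lebesgue_affine (a b : R) (A : set R) : 0 < a -> measurable A ->
  lebesgue_measure A = (a%:E * lebesgue_measure ((fun t : R => a * t + b)%R @^-1` A))%E.
Proof.
move=> a0 mA.
have mf : measurable_fun [set: measurableTypeR R]
    ((fun t : R => a * t + b)%R : measurableTypeR R -> measurableTypeR R).
  by apply: measurable_funD => //; exact: measurable_funM.
pose m : {measure set (measurableTypeR R) -> \bar R} :=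
  mscale (NngNum (ltW a0)) (pushforward (@lebesgue_measure R)
    ((fun t : R => a * t + b)%R : measurableTypeR R -> measurableTypeR R)).
apply: (@lebesgue_measure_unique R (m mf)) => // _ [[c d] _ <-].
change (lebesgue_measure (`]c, d]%classic : set R) = a%:E *
  lebesgue_measure ((fun t : R => (a * t + b)%R) @^-1` `]c, d]))%E.
rewrite (_ : _ @^-1` _ = `]((c - b) / a), ((d - b) / a)]%classic); last first.
  apply/seteqP; split => t /=; rewrite !in_itv/= ltr_pdivrMr// ler_pdivlMr//.
    by rewrite ltrBlDr lerBrDr mulrC.
  by rewrite ltrBlDr lerBrDr mulrC.
rewrite !lebesgue_measure_itv/= !lte_fin ltr_pM2r ?invr_gt0// ltrD2r.
case: ifPn => _; last by rewrite mule0.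
rewrite -!EFinB -EFinM; congr (_%:E).
by field; exact: lt0r_neq0.
Qed.

Lemma rV_cons_affine N (a : R) (v : 'rV[R]_N.+1) (p : measurableTypeR R * 'rV[R]_N) :
  a *: rV_cons p + v =
  rV_cons (a * p.1 + v ord0 ord0, a *: p.2 + \row_j v ord0 (lift ord0 j)).
Proof.
apply/rowP => i; case: (unliftP ord0 i) => [j|] ->.
  rewrite [LHS]mxE [X in X + _]mxE (rV_consS p j).
  by rewrite [RHS](rV_consS (_, _) j)/= !mxE.
rewrite [LHS]mxE [X in X + _]mxE (rV_cons0 p).
by rewrite [RHS](rV_cons0 (_, _)).
Qed.

(** Induction on [N]: the rescaled image of the product measure has the right value on measurable
    rectangles, by the one-dimensional case and the induction hypothesis, and rectangles determine a
    product measure. *)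
Lemma rV_lebesgue_affine N (a : R) (v : 'rV[R]_N) (A : set 'rV[R]_N) :
  0 < a -> measurable A ->
  rV_lebesgue R N A =
  ((a ^+ N)%:E * rV_lebesgue R N ((fun x : 'rV[R]_N => (a *: x + v)%R) @^-1` A))%E.
Proof.
move=> a0; elim: N v A => [|N IH] v A mA.
  rewrite expr0 mul1e (_ : _ @^-1` A = A)//.
  by apply/seteqP; split => x /=; rewrite (_ : a *: x + v = x)//; apply/rowP => -[].
have mA1 : measurable (rV_cons (n:=N) @^-1` A).
  by rewrite -[X in measurable X]setTI; exact: measurable_rV_cons.
pose f (p : measurableTypeR R * 'rV[R]_N) : measurableTypeR R * 'rV[R]_N :=
  (a * p.1 + v ord0 ord0, a *: p.2 + \row_j v ord0 (lift ord0 j)).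
have mf : measurable_fun setT f.
  apply: measurable_fun_pair.
    by apply: measurable_funD => //; apply: measurable_funM.
  exact: (measurableT_comp (measurable_rV_affine _ _)).
pose m : {measure set (measurableTypeR R * 'rV[R]_N) -> \bar R} :=
  mscale (NngNum (exprn_ge0 N.+1 (ltW a0)))
   (pushforward (@lebesgue_measure R \x rV_lebesgue R N)%E f).
transitivity ((@lebesgue_measure R \x rV_lebesgue R N)%E (rV_cons (n:=N) @^-1` A)) => //.
rewrite (@product_measure_unique _ _ _ _ _ _ _ (m mf))//.
  rewrite /m /mscale/= /pushforward/=; congr (_ * _)%E.
  rewrite /rV_lebesgueS /pushforward.
  congr (product_measure1 _ _ _); apply/seteqP.
  by split => p /=; rewrite rV_cons_affine.
move=> B C mB mC.
change ((a ^+ N.+1)%:E * (@lebesgue_measure R \x rV_lebesgue R N)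
  (((fun t : R => a * t + v ord0 ord0)%R @^-1` B) `*`
   ((fun x : 'rV[R]_N => a *: x + \row_j v ord0 (lift ord0 j))%R @^-1` C)) =
   lebesgue_measure B * rV_lebesgue R N C)%E.
rewrite product_measure1E.
- rewrite (@lebesgue_affine _ (v ord0 ord0) B a0)//.
  rewrite (IH (\row_j v ord0 (lift ord0 j)) C)// exprS EFinM.
  by rewrite -!muleA; congr (_ * _)%E; rewrite muleCA.
- rewrite -[X in measurable X]setTI.
  have : measurable_fun [set: measurableTypeR R] (fun t : R => a * t + v ord0 ord0).
    by apply: measurable_funD => //; exact: measurable_funM.
  exact.
- by rewrite -[X in measurable X]setTI; exact: measurable_rV_affine.
Qed.

End affine.

Section affine_integral.
Context {R : realType} {N : nat}.
Local Notation E := 'rV[R]_N.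
Local Notation lam := (rV_lebesgue R N).
Local Open Scope ereal_scope.

Lemma ge0_integral_rV_affine (a : R) (v : E) (f : E -> \bar R) : (0 < a)%R ->
  measurable_fun [set: E] f -> (forall x, 0 <= f x) ->
  \int[lam]_x f x = (a ^+ N)%:E * \int[lam]_x f (a *: x + v)%R.
Proof.
move=> a0 mf f0.
pose m := mscale (NngNum (exprn_ge0 N (ltW a0))) lam.
have mphi : measurable_fun [set: E] (fun x : E => (a *: x + v)%R).
  exact: measurable_rV_affine.
have mm (A : set E) : measurable A -> m ((fun x : E => (a *: x + v)%R) @^-1` A) = lam A.
  by move=> mA; rewrite [RHS](rV_lebesgue_affine v a0).
rewrite -(ge0_integral_image (m1 := m) mphi mm measurableT mf)//.
rewrite preimage_setT ge0_integral_mscale//.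
exact: (measurableT_comp mf mphi).
Qed.

Lemma rV_lebesgue_translate (v : E) (A : set E) : measurable A ->
  lam ((fun x => (x + v)%R) @^-1` A) = lam A.
Proof.
move=> mA; rewrite [RHS](rV_lebesgue_affine v ltr01)// expr1n mul1e.
by congr (lam _); apply/seteqP; split => x /=; rewrite scale1r.
Qed.

Lemma measurable_rV_translate (v : E) : measurable_fun [set: E] (fun x : E => (x + v)%R).
Proof.
have := @measurable_rV_affine R N 1 v.
by under eq_fun do rewrite scale1r.
Qed.

Lemma integral_rV_translate (v : E) (f : E -> \bar R) :
  measurable_fun [set: E] f ->
  \int[lam]_x f (x + v)%R = \int[lam]_x f x.
Proof.
move=> mf.
have := integral_image (measurable_rV_translate v) (@rV_lebesgue_translate v)
  measurableT mf.
by rewrite preimage_setT.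
Qed.

End affine_integral.

(** * Cubes, and the coordinate sigma-algebra against the topology *)

Section cubes.
Context {R : realType}.

Definition cube {N} (c : 'rV[R]_N) (r : R) : set 'rV[R]_N :=
  [set x | forall i, c ord0 i <= x ord0 i <= c ord0 i + r].

Lemma measurable_rV_box N (B : 'I_N -> set R) : (forall i, measurable (B i)) ->
  measurable [set x : 'rV[R]_N | forall i, B i (x ord0 i)].
Proof.
move=> mB.
rewrite (_ : [set x | _] = \bigcap_(i in [set: 'I_N]) (@rV_coord R N i @^-1` B i)).
  apply: fin_bigcap_measurable => // i _.
  by rewrite -[X in measurable X]setTI; apply: measurable_rV_coord => //; exact: mB.
by apply/seteqP; split => x /= h i; [move=> _|]; exact: h.
Qed.

Lemma measurable_cube N (c : 'rV[R]_N) r : measurable (cube c r).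
Proof.
rewrite (_ : cube c r = [set x | forall i, (`[c ord0 i, c ord0 i + r]%classic : set R) (x ord0 i)]).
  apply: (measurable_rV_box (B := fun i => `[c ord0 i, c ord0 i + r]%classic)) => i.
  exact: measurable_itv.
by apply/seteqP; split => x /= h i; have := h i; rewrite /= in_itv/=.
Qed.

Lemma compact_cube N (c : 'rV[R]_N) r : compact (cube c r).
Proof.
rewrite (_ : cube c r = [set x | forall i, (`[c ord0 i, c ord0 i + r]%classic : set R) (x ord0 i)]).
  apply: (@rV_compact _ _ (fun i => `[c ord0 i, c ord0 i + r]%classic)) => i.
  exact: segment_compact.
by apply/seteqP; split => x /= h i; have := h i; rewrite /= in_itv/=.
Qed.

Lemma rV_lebesgue_cube0 N (r : R) : 0 <= r ->
  rV_lebesgue R N (cube 0 r) = (r ^+ N)%:E.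
Proof.
move=> r0; elim: N => [|N IH].
  rewrite /= diracE (_ : cube 0 r = setT) ?in_setT ?expr0//.
  by apply/seteqP; split => // x _ [].
change ((@lebesgue_measure R \x rV_lebesgue R N)%E (rV_cons (n:=N) @^-1` cube 0 r)
  = (r ^+ N.+1)%:E).
rewrite (_ : _ @^-1` _ = `[0, r] `*` cube 0 r).
  rewrite product_measure1E//; last exact: measurable_cube.
  rewrite IH exprS EFinM; congr (_ * _)%E.
  apply: (etrans (lebesgue_measure_itv `[0, r])); rewrite /= lte_fin.
  have [r1|r1] := ltP 0 r; first by rewrite oppr0 adde0.
  by congr (_%:E); apply/eqP; rewrite eq_le r0 r1.
apply/seteqP; split => -[t x] /=; rewrite in_itv/=.
  move=> h; split.
    by have := h ord0; rewrite rV_cons0 mxE add0r.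
  by move=> i; have := h (lift ord0 i); rewrite rV_consS !mxE.
move=> [tr xr] i; case: (unliftP ord0 i) => [j|] ->.
  by rewrite rV_consS mxE; have := xr j; rewrite mxE.
by rewrite rV_cons0 mxE add0r.
Qed.

Lemma rV_lebesgue_cube N (c : 'rV[R]_N) (r : R) : 0 <= r ->
  rV_lebesgue R N (cube c r) = (r ^+ N)%:E.
Proof.
move=> r0; rewrite -(rV_lebesgue_cube0 N r0).
rewrite -[LHS](rV_lebesgue_translate c (measurable_cube _ _)).
congr (rV_lebesgue R N _); apply/seteqP.
by split => x h i; have := h i; rewrite !mxE; lra.
Qed.

(** Balls of the sup norm are boxes, hence measurable, and an open set is the union of the countably
    many balls inside it with rational centre and radius 1/(n+1). *)
Lemma open_rV_measurable N (U : set 'rV[R]_N) : open U -> measurable U.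
Proof.
move=> oU.
pose P (p : 'rV[rat]_N * nat) := (map_mx ratr p.1 : 'rV[R]_N, p.2.+1%:R^-1 : R).
pose B n := if unpickle n is Some p then
  (if pselect (ball (P p).1 (P p).2 `<=` U) then ball (P p).1 (P p).2 else set0)
  else set0.
rewrite (_ : U = \bigcup_n B n).
  apply: bigcupT_measurable => n; rewrite /B; case: unpickle => // p.
  case: pselect => sub /=; last exact: measurable0.
  rewrite (_ : ball _ _ = [set x : 'rV[R]_N | forall i, ball ((P p).1 ord0 i) (P p).2 (x ord0 i)]).
    apply: (measurable_rV_box (B := fun i => ball ((P p).1 ord0 i) (P p).2)) => i.
    by apply: open_measurable; exact: ball_open.
  apply/seteqP; split => x /=.
    by move=> [_ h] i; exact: h.
  move=> h; split; first by rewrite /P/= invr_gt0.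
  by move=> i j; rewrite ord1; exact: h.
apply/seteqP; split => [x Ux|x [n _]]; last first.
  rewrite /B; case: unpickle => // p; by case: pselect => // h; exact: h.
have /nbhs_ballP[e /= e0 xeU] : nbhs x U by apply: open_nbhs_nbhs; split.
(* Radius below [e / 2]: a ball of this radius whose centre is this close to [x] stays in the ball
   of radius [e] around [x]. *)
have [n _ ne] := near_infty_natSinv_lt (PosNum (divr_gt0 e0 (ltr0n R 2))).
have {}ne := ne n (leqnn n); rewrite /= in ne.
have n0 : 0 < n.+1%:R^-1 :> R by rewrite invr_gt0.
have [d dE] : exists d : R, d = n.+1%:R^-1 by exists n.+1%:R^-1.
rewrite -dE in ne n0.
have qex i : exists q : rat, `|x ord0 i - ratr q| < d.
  have [|q] := @rat_in_itvoo _ (x ord0 i - d) (x ord0 i + d); first by lra.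
  by rewrite in_itv/= => ?; exists q; rewrite ltr_norml; lra.
have [q hq] := choice qex.
exists (pickle (\row_i q i, n)) => //; rewrite /B pickleK /P/= -dE.
case: pselect => sub /=; last first.
  case: sub => y [_ h]; apply: xeU; split => // i j; rewrite ord1.
  have := h ord0 j; have := hq j; rewrite /ball/= !mxE !ltr_norml => ? ?; lra.
by split => // i j; rewrite ord1 /ball/= !mxE distrC; exact: hq.
Qed.

Lemma continuous_rV_measurable N (f : 'rV[R]_N -> R) : continuous f ->
  measurable_fun [set: 'rV[R]_N] f.
Proof.
move=> /continuousP cf.
apply: (measurability _ (RGenOInfty.measurableE R)).
move=> _ [_ [a ->] <-]; rewrite setTI; apply: open_rV_measurable.
by apply: cf; exact: interval_open.
Qed.

End cubes.

(** * Smooth functions and cutoffs *)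

Section flat.
Context {R : realType}.

(* [flat m x = x^-m exp(-1/x)] for [0 < x]; the derivative of [flat m] is a
   combination of [flat m.+1] and [flat m.+2], hence all of them are smooth. *)
Definition flat (m : nat) (x : R) : R :=
  if 0 < x then x^-1 ^+ m * expR (- x^-1) else 0.

Lemma flat_ge0 m x : 0 <= flat m x.
Proof.
rewrite /flat; case: ifPn => // x0.
by rewrite mulr_ge0 ?expR_ge0// exprn_ge0// invr_ge0 ltW.
Qed.

Lemma flat0_le1 x : flat 0 x <= 1.
Proof.
rewrite /flat; case: ifPn => // x0.
by rewrite expr0 mul1r -[leRHS]expR0 ler_expR oppr_le0 invr_ge0 ltW.
Qed.

(** One term of the exponential series at [x^-1] gives the bound. Its linearity in [x] yields
    differentiability at 0, because for [h > 0] the difference quotient of [flat m] at 0 is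
    [flat m.+1 h]. *)
Lemma flat_le m x : 0 < x -> flat m x <= (m.+1)`!%:R * x.
Proof.
move=> x0; rewrite /flat x0.
have y0 : 0 < x^-1 by rewrite invr_gt0.
have := @expR_ge1Dxn R x^-1 m (ltW y0) => h.
have {}h : x^-1 ^+ m.+1 / (m.+1)`!%:R <= expR x^-1.
  by apply: le_trans h; rewrite lerDr.
rewrite expRN ler_pdivrMr ?expR_gt0// -[leLHS]mulr1.
rewrite -[X in _ * X <= _](mulVf (lt0r_neq0 x0)) mulrA -exprSr [leRHS]mulrAC ler_wpM2r ?(ltW x0)//.
by rewrite mulrC -ler_pdivrMr// ltr0n fact_gt0.
Qed.

Lemma is_derive_flat m (x : R) :
  is_derive x 1 (flat m) (flat m.+2 x - m%:R * flat m.+1 x).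
Proof.
have [x0|x0|->] := ltgtP x 0.
- rewrite [X in is_derive _ _ _ X](_ : _ = 0); last first.
    by rewrite /flat ltNge (ltW x0)/= mulr0 subrr.
  apply: (@near_eq_is_derive _ _ _ (cst 0)); rewrite ?scaler0//.
  near=> y; rewrite /flat ifF//; apply/negbTE; rewrite -leNgt ltW//.
  by near: y; exact: lt_nbhsl.
- have xn0 : x != 0 by rewrite gt_eqF.
  have d1 := is_deriveV xn0 (is_derive_id x 1).
  have d2 := is_deriveX m d1.
  have d3 := is_derive1_comp (is_derive_expR _) (is_deriveN d1).
  have := is_deriveM d2 d3.
  rewrite (_ : _ + _ = flat m.+2 x - m%:R * flat m.+1 x); last first.
    rewrite /flat x0 !fctE/= /GRing.scale/= -exprVn.
    by case: (m) => [|k]; rewrite ?expr0 ?exprS/=; ring.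
  apply: near_eq_is_derive; near=> y; rewrite /flat ifT ?fctE//.
  by near: y; exact: lt_nbhsr.
- have h : h^-1 *: ((flat m \o shift 0) (h *: 1) - flat m 0) @[h --> 0^'] --> (0 : R).
    apply/cvgr0Pnorm_le => e e0; near=> h.
    have f0 : flat m 0 = 0 by rewrite /flat ltxx.
    rewrite f0 subr0/= addr0 /GRing.scale/= mulr1.
    have [h0|h0] := ltP 0 h; last by rewrite /flat ltNge h0/= mulr0 normr0 ltW.
    have -> : h^-1 * flat m h = flat m.+1 h by rewrite /flat h0 exprS mulrA.
    rewrite ger0_norm ?flat_ge0// (le_trans (flat_le _ h0))//.
    rewrite mulrC -ler_pdivlMr ?ltr0n ?fact_gt0//.
    rewrite -[h]ger0_norm ?ltW//; near: h.
    by apply: dnbhs0_lt; rewrite divr_gt0 ?ltr0n ?fact_gt0.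
  rewrite (_ : _ - _ = 0); last by rewrite /flat ltxx mulr0 subrr.
  by apply: DeriveDef; [apply/cvg_ex; exists 0|exact/cvg_lim].
Unshelve. all: by end_near. Qed.
End flat.

Section smooth.
Context {R : realType} {N : nat}.
Local Notation E := 'rV[R]_N.
Implicit Types (f g phi : E -> R) (v x : E).

Lemma is_derive_line f x v (t : R) : derivable f (x + t *: v) v ->
  is_derive t 1 (fun s => f (x + s *: v)) ('D_v f (x + t *: v)).
Proof.
move=> df.
have e : (fun h : R => h^-1 *: (((fun s => f (x + s *: v)) \o shift t) (h *: 1) -
    f (x + t *: v))) =
  (fun h : R => h^-1 *: ((f \o shift (x + t *: v)) (h *: v) - f (x + t *: v))).
  apply/funext => h; congr (_ *: (f _ - _)); rewrite /=.
  by rewrite (_ : h%:A = h); [rewrite scalerDl addrCA|exact: mulr1].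
by apply: DeriveDef; rewrite /derivable /derive e.
Qed.

Lemma derive_of_line f x v (d : R) :
  is_derive (0 : R) 1 (fun s => f (x + s *: v)) d -> is_derive x v f d.
Proof.
move=> df.
have e : (fun h : R => h^-1 *: ((f \o shift x) (h *: v) - f x)) =
  (fun h : R => h^-1 *: (((fun s => f (x + s *: v)) \o shift 0) (h *: 1) -
    f (x + 0 *: v))).
  apply/funext => h; rewrite scale0r addr0; congr (_ *: (f _ - _)); rewrite /=.
  by rewrite (_ : h%:A = h) ?addr0 1?addrC//; exact: mulr1.
apply: DeriveDef; rewrite /derivable /derive e.
  by case: df.
by case: df.
Qed.

Lemma iter_pderive_rcons s i f : iter_pderive (rcons s i) f = iter_pderive s (pderive i f).
Proof. by elim: s => //= j s ->. Qed.

Lemma smooth_pderive i f : smooth f -> smooth (pderive i f).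
Proof. by move=> sf s; have := sf (rcons s i); rewrite iter_pderive_rcons. Qed.

Lemma smooth_continuous f : smooth f -> continuous f.
Proof. by move=> /(_ [::])[]. Qed.

Lemma smooth_pderivable f i : smooth f -> pderivable i f.
Proof. by move=> /(_ [::])[_]; apply. Qed.

(** Coinduction for [smooth]: a class stable under partial derivatives is examined at first order
    only, so no formula for iterated derivatives of products appears. *)
Lemma smooth_coind (C : set (E -> R)) :
  (forall f, C f -> continuous f) ->
  (forall f i, C f -> pderivable i f) ->
  (forall f i, C f -> C (pderive i f)) ->
  forall f, C f -> smooth f.
Proof.
move=> cC dC pC f Cf s.
have Cs : C (iter_pderive s f) by elim: s => //= i s; exact: pC.
by split; [exact: cC|move=> i; exact: dC].
Qed.

Lemma smooth_shift v f : smooth f -> smooth (fun x => f (x + v)).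
Proof.
pose C := [set g | exists2 f, smooth f & g = (fun x => f (x + v))].
have D i g x : pderivable i g ->
    is_derive x (delta_mx ord0 i) (fun x => g (x + v)) (pderive i g (x + v)).
  move=> dg; apply: derive_of_line.
  have := @is_derive_line g (x + v) (delta_mx ord0 i) 0 (dg _).
  by rewrite scale0r addr0; under eq_fun do rewrite addrAC.
move=> sf; apply: (@smooth_coind C); last by exists f.
- move=> _ [{sf}f sf ->] x.
  have cs : {for x, continuous (fun x : E => x + v)}.
    by apply: continuousD; [exact: cvg_id|exact: cst_continuous].
  by apply: (continuous_comp cs); exact: smooth_continuous.
- move=> _ i [{sf}f sf ->] x.
  by case: (D i f x (smooth_pderivable sf)).
- move=> _ i [{sf}f sf ->]; exists (pderive i f); first exact: smooth_pderive.
  apply/funext => x.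
  by case: (D i f x (smooth_pderivable sf)).
Qed.

Lemma pderive_shift i v f x : pderivable i f ->
  pderive i (fun x => f (x + v)) x = pderive i f (x + v).
Proof.
move=> df; apply: derive_val; apply: derive_of_line.
have := @is_derive_line f (x + v) (delta_mx ord0 i) 0 (df _).
by rewrite scale0r addr0; under eq_fun do rewrite addrAC.
Qed.

(** Built to be stable under partial derivatives: Leibniz' rule stays inside, constants supply the
    coefficients, and every index [m] is included because differentiating [flat m] produces
    [flat m.+1] and [flat m.+2]. *)
Inductive smooth_alg : set (E -> R) :=
| smooth_alg_smooth f : smooth f -> smooth_alg f
| smooth_alg_cst c : smooth_alg (cst c)
| smooth_alg_flat m l a b : smooth_alg (fun x => flat m (a * x ord0 l + b))
| smooth_alg_add f g : smooth_alg f -> smooth_alg g -> smooth_alg (f + g)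
| smooth_alg_mul f g : smooth_alg f -> smooth_alg g -> smooth_alg (f * g).

Lemma is_derive_flat_coord m l a b i x :
  is_derive x (delta_mx ord0 i) (fun x => flat m (a * x ord0 l + b))
    ((a *+ (l == i)) * (flat m.+2 (a * x ord0 l + b)
       - m%:R * flat m.+1 (a * x ord0 l + b))).
Proof.
apply: derive_of_line.
have e : (fun s : R => flat m (a * (x + s *: delta_mx ord0 i) ord0 l + b)) =
  flat m \o ((a *+ (l == i)) \*o id + cst (a * x ord0 l + b)).
  apply/funext => s /=; congr flat; rewrite !fctE !mxE eqxx/=.
  by case: (l == i); rewrite /= ?mulr1n ?mulr0n; ring.
have d0 : is_derive (0 : R) 1 ((a *+ (l == i)) \*o id + cst (a * x ord0 l + b)) (a *+ (l == i)).
  have := is_deriveD (is_deriveZ (a *+ (l == i)) (is_derive_id (0 : R) 1)) (is_derive_cst (a * x ord0 l + b) (0 : R) 1).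
  by rewrite addr0 /GRing.scale/= mulr1.
rewrite e [X in is_derive _ _ _ X]mulrC; apply: is_derive1_comp => //.
by rewrite !fctE /= mulr0 add0r; exact: is_derive_flat.
Qed.

Lemma smooth_alg_pderivable f i : smooth_alg f -> pderivable i f.
Proof.
elim=> {f} [f sf|c|m l a b|f g _ df _ dg|f g _ df _ dg] x.
- exact: smooth_pderivable.
- exact: derivable_cst.
- by case: (is_derive_flat_coord m l a b i x).
- exact: derivableD.
- exact: derivableM.
Qed.

Lemma smooth_alg_smooth_fun f : smooth_alg f -> smooth f.
Proof.
apply: smooth_coind => {f} [f|f i|f i].
- elim=> {f} [f sf|c|m l a b|f g _ df _ dg|f g _ df _ dg] x.
  + exact: smooth_continuous.
  + exact: cst_continuous.
  + have cc : {for x, continuous (fun x : E => a * x ord0 l + b)}.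
      apply: continuousD; last exact: cst_continuous.
      by apply: continuousM; [exact: cst_continuous|exact: coord_continuous].
    apply: (continuous_comp cc).
    apply: differentiable_continuous; apply/derivable1_diffP.
    by case: (is_derive_flat m (a * x ord0 l + b)).
  + by apply: continuousD; [exact: df|exact: dg].
  + by apply: continuousM; [exact: df|exact: dg].
- exact: smooth_alg_pderivable.
- elim=> {f} [f sf|c|m l a b|f g sf df sg dg|f g sf df sg dg].
  + exact/smooth_alg_smooth/smooth_pderive.
  + rewrite (_ : pderive i _ = cst 0); first exact: smooth_alg_cst.
    by apply/funext => x; exact: derive_cst.
  + rewrite (_ : pderive i _ = cst (a *+ (l == i)) *
       ((fun x : E => flat m.+2 (a * x ord0 l + b)) +
        cst (- m%:R) * (fun x : E => flat m.+1 (a * x ord0 l + b)))).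
      apply: smooth_alg_mul; first exact: smooth_alg_cst.
      apply: smooth_alg_add; first exact: smooth_alg_flat.
      by apply: smooth_alg_mul; [exact: smooth_alg_cst|exact: smooth_alg_flat].
    apply/funext => x; rewrite /pderive.
    have [_ ->] := is_derive_flat_coord m l a b i x.
    by rewrite !fctE mulNr.
  + rewrite (_ : pderive i _ = pderive i f + pderive i g); first exact: smooth_alg_add.
    by apply/funext => x; apply: deriveD; exact: smooth_alg_pderivable.
  + rewrite (_ : pderive i _ = f * pderive i g + g * pderive i f).
      by apply: smooth_alg_add; exact: smooth_alg_mul.
    by apply/funext => x; apply: deriveM; exact: smooth_alg_pderivable.
Qed.

Lemma smooth_cst c : smooth (cst c : E -> R).
Proof. exact/smooth_alg_smooth_fun/smooth_alg_cst. Qed.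

Lemma smoothD f g : smooth f -> smooth g -> smooth (f + g).
Proof.
by move=> sf sg; apply/smooth_alg_smooth_fun/smooth_alg_add; exact: smooth_alg_smooth.
Qed.

Lemma smoothM f g : smooth f -> smooth g -> smooth (f * g).
Proof.
by move=> sf sg; apply/smooth_alg_smooth_fun/smooth_alg_mul; exact: smooth_alg_smooth.
Qed.

Lemma smooth_flat m l a b : smooth (fun x : E => flat m (a * x ord0 l + b)).
Proof. exact/smooth_alg_smooth_fun/smooth_alg_flat. Qed.

End smooth.

Section test_functions.
Context {R : realType} {N : nat}.
Local Notation E := 'rV[R]_N.
Implicit Types (f g phi : E -> R) (v x : E).

Lemma rV_norm_le x (M : R) : 0 <= M -> (`|x| <= M) <-> (forall i, `|x ord0 i| <= M).
Proof.
move=> M0; rewrite /Num.norm/= mx_normrE; split.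
  move=> h i; apply: le_trans h.
  exact: (le_bigmax _ (fun ij : 'I_1 * 'I_N => `|x ij.1 ij.2|) (ord0, i)).
by move=> h; apply/bigmax_leP; split => // -[i j] _; rewrite ord1; exact: h.
Qed.

Lemma rV_norm_coord x i : `|x ord0 i| <= `|x|.
Proof. by apply: (rV_norm_le x (normr_ge0 x)).1. Qed.

Lemma compactly_supportedP f : compactly_supported f <->
  exists M : R, forall x, M < `|x| -> f x = 0.
Proof.
split.
  move=> /compact_bounded[M0 [_ /(_ (M0 + 1))]].
  rewrite ltrDl ltr01 => /(_ isT); move: (M0 + 1) => M h.
  exists M => x Mx; apply/eqP; apply: contraTT Mx => fx.
  by rewrite -leNgt; apply: h; exact: subset_closure.
move=> [M h].
have sub : closure [set x | f x != 0] `<=` [set x | `|x| <= M].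
  have : closed [set x : E | `|x| <= M].
    apply: (@preimage_closed _ _ (@Num.norm R E) [set y | y <= M]).
      by move=> x _; exact: norm_continuous.
    exact: closed_le.
  rewrite closureE => cl x; apply; split => // y /= fy.
  by rewrite leNgt; apply: contra fy => /h ->.
apply: bounded_closed_compact; last exact: closed_closure.
by exists M; split; [exact: num_real|move=> K MK x /sub/= /le_trans->//; exact: ltW].
Qed.

Lemma test_functionP phi : test_function phi <->
  smooth phi /\ exists M : R, forall x, M < `|x| -> phi x = 0.
Proof. by split=> -[sphi]; move=> /compactly_supportedP. Qed.

Lemma test_functionM f g : test_function f -> smooth g ->
  test_function (fun x => g x * f x).
Proof.
move=> /test_functionP[sf [M fM]] sg.
apply/test_functionP; split; first exact: (smoothM sg sf).
by exists M => x /fM ->; rewrite mulr0.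
Qed.

Lemma test_function_shift v f : test_function f -> test_function (fun x => f (x + v)).
Proof.
move=> /test_functionP[sf [M fM]].
apply/test_functionP; split; first exact: smooth_shift.
exists (M + `|v|) => x; rewrite -ltrBrDr => h; apply: fM; apply: (lt_le_trans h).
by rewrite lerBlDr (le_trans _ (ler_normB _ _))// addrK.
Qed.

Lemma test_function_pderive i f : test_function f -> test_function (pderive i f).
Proof.
move=> /test_functionP[sf [M fM]].
apply/test_functionP; split; first exact: smooth_pderive.
exists M => x Mx.
have e0 : \forall y \near x, cst 0 y = f y.
  have := @norm_continuous R E x => /cvgrPdist_lt /(_ (`|x| - M)).
  rewrite subr_gt0 => /(_ Mx); apply: filterS => y /=.
  move=> xy; rewrite fM//.
  by have := ler_norm (`|x| - `|y|); lra.
have := near_eq_is_derive e0 (is_derive_cst 0 x (delta_mx ord0 i)).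
by case.
Qed.

Lemma test_function_continuous f : test_function f -> continuous f.
Proof. by move=> [/smooth_continuous]. Qed.

Lemma test_function_bounded f : test_function f -> exists2 B : R, 0 <= B & forall x, `|f x| <= B.
Proof.
move=> tf; have cf := test_function_continuous tf.
have [_ cK] := tf.
have : compact (f @` closure [set x | f x != 0]).
  by apply: continuous_compact => //; exact: continuous_subspaceT.
move=> /compact_bounded[M0 [_ /(_ (M0 + 1))]].
rewrite ltrDl ltr01 => /(_ isT); move: (M0 + 1) => B h.
exists (Num.max B 0); first by rewrite le_max lexx orbT.
move=> x; have [->|fx] := eqVneq (f x) 0; first by rewrite normr0 le_max lexx orbT.
by rewrite le_max; apply/orP; left; apply: h; exists x => //; exact: subset_closure.
Qed.

Lemma test_function_C0 f : test_function f -> C0 f.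
Proof.
move=> tf; split; first exact: test_function_continuous.
move=> e e0; have /test_functionP[_ [M fM]] := tf.
by exists (M + 1) => x Mx; rewrite fM ?normr0//; lra.
Qed.

Lemma smooth_prod (I : Type) (s : seq I) (F : I -> E -> R) :
  (forall i, smooth (F i)) -> smooth (fun x => \prod_(i <- s) F i x).
Proof.
move=> sF; elim: s => [|i s IH].
  by under eq_fun do rewrite big_nil; exact: smooth_cst.
by under eq_fun do rewrite big_cons; exact: (smoothM (sF i) IH).
Qed.

(** The arguments are [k (k + x_l)] and [k (k - x_l)]. For [k > 0] both are positive exactly when
    [|x_l| < k], which bounds the support; for fixed [x] both tend to infinity with [k], where
    [flat 0] tends to 1. *)
Definition cutoff (k : nat) x : R :=
  \prod_(l < N) (flat 0 (k%:R * x ord0 l + k%:R ^+ 2) *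
                 flat 0 (- k%:R * x ord0 l + k%:R ^+ 2)).

Lemma cutoff_ge0 k x : 0 <= cutoff k x.
Proof. by apply: prodr_ge0 => i _; rewrite mulr_ge0// flat_ge0. Qed.

Lemma cutoff_le1 k x : cutoff k x <= 1.
Proof.
apply: prodr_ile1 => i _; rewrite mulr_ge0 ?flat_ge0//=.
by rewrite -[leRHS]mulr1 ler_pM ?flat_ge0// flat0_le1.
Qed.

Lemma cutoff_test k : test_function (cutoff k).
Proof.
apply/test_functionP; split.
  by apply: smooth_prod => l; apply: smoothM; exact: smooth_flat.
exists k%:R => x kx.
have [l kl] : exists l, k%:R < `|x ord0 l|.
  apply/not_existsP => h; move: kx; rewrite ltNge => /negP; apply.
  by apply/rV_norm_le => // l; rewrite leNgt; apply/negP/h.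
rewrite /cutoff (bigD1 l)//= (_ : flat _ _ * _ = 0) ?mul0r//.
have k0 : 0 <= k%:R :> R by [].
have [xl|xl] := leP 0 (x ord0 l).
  rewrite ger0_norm// in kl.
  rewrite [X in _ * X]/flat ifF ?mulr0//; apply/negbTE; rewrite -leNgt; nra.
rewrite ltr0_norm// in kl.
rewrite [X in X * _]/flat ifF ?mul0r//; apply/negbTE; rewrite -leNgt; nra.
Qed.

Lemma flat0_cvg (t : nat -> R) (c : R) : 0 < c ->
  (\forall k \near \oo, c * k%:R <= t k) -> flat 0 (t k) @[k --> \oo] --> (1 : R).
Proof.
move=> c0 ct; apply/cvgrPdist_le => e e0.
have /cvgryPge/(_ (c^-1 * e^-1)) ne := @cvgr_idn R.
near=> k.
have tk : e^-1 <= t k.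
  apply: (@le_trans _ _ (c * k%:R)); last by near: k.
  by rewrite -ler_pdivrMl//; near: k.
have t0 : 0 < t k by apply: lt_le_trans tk; rewrite invr_gt0.
rewrite ger0_norm ?subr_ge0 ?flat0_le1// /flat t0 expr0 mul1r.
have := @expR_ge1Dx R (- (t k)^-1).
have : (t k)^-1 <= e by rewrite -[leRHS]invrK lef_pV2// posrE invr_gt0.
lra.
Unshelve. all: by end_near. Qed.

Lemma cutoff_cvg x : cutoff k x @[k --> \oo] --> (1 : R).
Proof.
rewrite /cutoff; elim: (index_enum _) => [|l s IH].
  by under eq_fun do rewrite big_nil; exact: cvg_cst.
under eq_fun do rewrite big_cons.
have h1 : flat 0 (k%:R * x ord0 l + k%:R ^+ 2) @[k --> \oo] --> (1 : R).
  apply: (@flat0_cvg _ 1) => //.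
  have /cvgryPge/(_ (1 + `|x ord0 l|)) := @cvgr_idn R; apply: filterS => k h.
  have hx := ler_norm (- x ord0 l); rewrite normrN in hx.
  have : 0 <= k%:R * (k%:R + x ord0 l - 1) by rewrite mulr_ge0//; lra.
  by rewrite mul1r mulrBr mulrDr expr2; lra.
have h2 : flat 0 (- k%:R * x ord0 l + k%:R ^+ 2) @[k --> \oo] --> (1 : R).
  apply: (@flat0_cvg _ 1) => //.
  have /cvgryPge/(_ (1 + `|x ord0 l|)) := @cvgr_idn R; apply: filterS => k h.
  have hx := ler_norm (x ord0 l).
  have : 0 <= k%:R * (k%:R - x ord0 l - 1) by rewrite mulr_ge0//; lra.
  by rewrite mul1r mulNr !mulrBr expr2; lra.
by have := cvgM (cvgM h1 h2) IH; rewrite !mulr1; exact.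
Qed.

End test_functions.

(** * Duality and translations *)

Section approximation.
Context {R : realType} {N : nat}.
Local Notation E := 'rV[R]_N.
Local Notation lam := (rV_lebesgue R N).

Lemma smooth_measurable (f : E -> R) : smooth f -> measurable_fun [set: E] f.
Proof. by move=> /smooth_continuous; exact: continuous_rV_measurable. Qed.

Variable g : E -> R.
Hypothesis g0 : forall x, 0 <= g x.
Hypothesis ig : lam.-integrable [set: E] (EFin \o g).

Let mg : measurable_fun [set: E] g.
Proof. by move/integrableP : ig => [/measurable_EFinP]. Qed.

(** Approximation in L^1 of the measure with density [g]. Its finite mass lets dominated convergence
    pass from finite to countable unions, so that the approximable sets form a sigma-algebra. *)
Definition smooth_approximable (A : set E) := measurable A /\
  forall e : R, 0 < e -> exists phi : E -> R,
    [/\ smooth phi, forall x, 0 <= phi x <= 1 &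
      (\int[lam]_x (g x * `|\1_A x - phi x|)%:E <= e%:E)%E].

Let mD (A : set E) (phi : E -> R) : measurable A -> measurable_fun [set: E] phi ->
  measurable_fun [set: E] (fun x => g x * `|\1_A x - phi x|).
Proof.
move=> mA mphi; apply: measurable_funM => //.
by apply: measurableT_comp => //; apply: measurable_funB.
Qed.

Let le_intD (f1 f2 f3 : E -> R) :
  measurable_fun [set: E] f1 -> measurable_fun [set: E] f2 ->
  measurable_fun [set: E] f3 -> (forall x, 0 <= f1 x) ->
  (forall x, 0 <= f2 x) -> (forall x, 0 <= f3 x) ->
  (forall x, f1 x <= f2 x + f3 x) ->
  (\int[lam]_x (f1 x)%:E <= \int[lam]_x (f2 x)%:E + \int[lam]_x (f3 x)%:E)%E.
Proof.
move=> m1 m2 m3 p1 p2 p3 le; rewrite -ge0_integralD//; last 4 first.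
- by move=> x _; rewrite lee_fin.
- exact/measurable_EFinP.
- by move=> x _; rewrite lee_fin.
- exact/measurable_EFinP.
apply: ge0_le_integral => //.
- by move=> x _; rewrite lee_fin.
- exact/measurable_EFinP.
- by apply: emeasurable_funD; exact/measurable_EFinP.
- by move=> x _; rewrite -EFinD lee_fin.
Qed.

Let dct_small (f : nat -> E -> R) (e : R) : 0 < e ->
  (forall n, measurable_fun [set: E] (f n)) ->
  (forall n x, 0 <= f n x <= 1) ->
  (forall x, f n x @[n --> \oo] --> (0 : R)) ->
  exists n, (\int[lam]_x (g x * f n x)%:E <= e%:E)%E.
Proof.
move=> e0 mf f01 fcvg.
have h : (\int[lam]_x (g x * f n x)%:E @[n --> \oo] --> \int[lam]_x (cst 0 x : \bar R))%E.
  apply: (@dominated_cvg _ _ _ lam _ measurableT _ _ (EFin \o g)) => //.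
  - by move=> n; apply/measurable_EFinP; exact: measurable_funM.
  - move=> x _; apply: cvg_EFin; first exact: nearW.
    by rewrite -[X in _ --> X](mulr0 (g x)); apply: cvgM; [exact: cvg_cst|exact: fcvg].
  - move=> n x _; have /andP[f1 f2] := f01 n x.
    rewrite /= lee_fin ger0_norm ?mulr_ge0//.
    by rewrite -[leRHS]mulr1 ler_wpM2l.
rewrite integral0 in h.
have /fine_cvgP[fin /cvgr0Pnorm_le/(_ e e0) h'] := h.
near \oo => n; exists n.
have : `|fine (\int[lam]_x (g x * f n x)%:E)%E| <= e by near: n.
have fn : (\int[lam]_x (g x * f n x)%:E)%E \is a fin_num by near: n.
by rewrite -[X in (X <= _)%E]fineK// lee_fin; apply: le_trans; exact: ler_norm.
Unshelve. all: by end_near. Qed.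

Let approx0 : smooth_approximable set0.
Proof.
split=> // e e0; exists (cst 0); split; [exact: smooth_cst|by move=> x; rewrite lexx ler01|].
under eq_integral do rewrite indic0 subrr normr0 mulr0.
by rewrite integral0 lee_fin ltW.
Qed.

Let approxC A : smooth_approximable A -> smooth_approximable (~` A).
Proof.
move=> [mA hA]; split; first exact: measurableC.
move=> e /hA[phi [sphi p01 h]]; exists (fun x => 1 + (- 1) * phi x); split.
- by apply: (smoothD (smooth_cst 1)); exact: (smoothM (smooth_cst (- 1))).
- by move=> x; have := p01 x; lra.
- apply: le_trans h; rewrite le_eqVlt; apply/orP; left; apply/eqP.
  apply: eq_integral => x _; congr (_ * _)%:E.
  rewrite -normrN; congr `|_|; rewrite !indicE in_setC.
  by case: (x \in A); rewrite /=; ring.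
Qed.

Let approxU A B : smooth_approximable A -> smooth_approximable B ->
  smooth_approximable (A `|` B).
Proof.
move=> [mA hA] [mB hB]; split; first exact: measurableU.
move=> e e0; have e2 : 0 < e / 2 by lra.
have [phi [sphi p01 pe]] := hA _ e2.
have [psi [spsi q01 qe]] := hB _ e2.
(* This is 1 - (1 - phi) (1 - psi): it stays between 0 and 1, and its error is at most the sum of
   the two errors. *)
exists (fun x => phi x + (psi x + (- 1) * (phi x * psi x))); split.
- apply: (smoothD sphi); apply: (smoothD spsi).
  by apply: (smoothM (smooth_cst (- 1))); exact: smoothM.
- by move=> x; have := p01 x; have := q01 x; nra.
- rewrite (splitr e) EFinD; apply: le_trans (leeD pe qe).
  apply: le_intD.
  + exact: (mD (measurableU _ _ mA mB) (smooth_measurable (smoothD sphi (smoothD spsi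
     (smoothM (smooth_cst (- 1)) (smoothM sphi spsi)))))).
  + exact: mD mA (smooth_measurable sphi).
  + exact: mD mB (smooth_measurable spsi).
  + by move=> x; rewrite mulr_ge0.
  + by move=> x; rewrite mulr_ge0.
  + by move=> x; rewrite mulr_ge0.
  + move=> x; rewrite -mulrDr; apply: ler_wpM2l => //.
    have N1 (t : R) : 0 <= t <= 1 -> `|1 - t| = 1 - t.
      by move=> /andP[_ t1]; rewrite ger0_norm// subr_ge0.
    have N0 (t : R) : 0 <= t <= 1 -> `|0 - t| = t.
      by move=> /andP[t0 _]; rewrite sub0r normrN ger0_norm.
    have r01 : 0 <= phi x + (psi x + -1 * (phi x * psi x)) <= 1.
      by have := p01 x; have := q01 x; nra.
    have := p01 x; have := q01 x; rewrite !indicE in_setU.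
    by case: (x \in A); case: (x \in B) => /= /[dup]/N1 n1 /[dup]/N0 n2 /andP[a1 a2]
      /[dup]/N1 n3 /[dup]/N0 n4 /andP[b1 b2]; rewrite ?n1 ?n2 ?n3 ?n4 ?(N1 _ r01) ?(N0 _ r01); nra.
Qed.

Let approx_bigcup (F : nat -> set E) : (forall n, smooth_approximable (F n)) ->
  smooth_approximable (\bigcup_n F n).
Proof.
move=> hF.
have mF n : measurable (F n) by have [] := hF n.
pose G n := \bigcup_(i < n) F i.
have hG n : smooth_approximable (G n).
  elim: n => [|n IH]; first by rewrite /G bigcup_mkord big_ord0.
  by rewrite /G bigcup_mkord big_ord_recr -bigcup_mkord; exact: approxU.
have mG n : measurable (G n) by have [] := hG n.
have mU : measurable (\bigcup_n F n) by exact: bigcupT_measurable.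
split=> // e e0; have e2 : 0 < e / 2 by lra.
have [n ne] : exists n,
    (\int[lam]_x (g x * `|\1_(\bigcup_n F n) x - \1_(G n) x|)%:E <= (e / 2)%:E)%E.
  apply: (dct_small e2 (f := fun n x => `|\1_(\bigcup_n F n) x - \1_(G n) x|)).
  - by move=> n; apply: measurableT_comp => //; apply: measurable_funB.
  - move=> n x; rewrite !indicE normr_ge0/=.
    by case: (_ \in _); case: (_ \in _); rewrite /= ?subrr ?subr0 ?sub0r ?normrN ?normr0 ?normr1.
  - move=> x; have [[m _ Fx]|Ux] := pselect ((\bigcup_n F n) x).
      apply: cvg_near_cst; exists m.+1 => // n /= mn.
      rewrite !indicE (mem_set (_ : (\bigcup_n F n) x)) ?(mem_set (_ : G n x)) ?subrr ?normr0//.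
        by exists m.
      by exists m.
    apply: cvg_near_cst; exists 0%N => // n _.
    rewrite !indicE !memNset ?subrr ?normr0//.
    by move=> [m _ Fx]; apply: Ux; exists m.
have [phi [sphi p01 pe]] := (hG n).2 _ e2.
exists phi; split => //; rewrite (splitr e) EFinD; apply: le_trans (leeD ne pe).
have mphi := smooth_measurable sphi.
apply: le_intD.
- exact: mD.
- by apply: mD => //; exact: measurable_indic.
- exact: mD.
- by move=> x; rewrite mulr_ge0.
- by move=> x; rewrite mulr_ge0.
- by move=> x; rewrite mulr_ge0.
- by move=> x; rewrite -mulrDr; apply: ler_wpM2l => //; exact: ler_distD.
Qed.

Let approx_half l (a : R) : smooth_approximable (rV_coord l @^-1` `]a, +oo[%classic).
Proof.
have mP : measurable (rV_coord l @^-1` `]a, +oo[%classic : set E).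
  by rewrite -[X in measurable X]setTI; exact: measurable_rV_coord.
split=> // e e0.
pose phi (k : nat) (x : E) := flat 0 (k%:R * x ord0 l + k%:R * - a).
have sphi k : smooth (phi k) by exact: smooth_flat.
have p01 k x : 0 <= phi k x <= 1 by rewrite flat_ge0 flat0_le1.
have [|||k ke] := dct_small e0
  (f := fun k x => `|\1_(rV_coord l @^-1` `]a, +oo[%classic) x - phi k x|).
- move=> n; apply: measurableT_comp => //; apply: measurable_funB.
    exact: measurable_indic.
  exact: smooth_measurable.
- move=> n x; rewrite normr_ge0/= indicE ler_norml.
  by have := p01 n x; case: (_ \in _) => /=; lra.
- move=> x; rewrite indicE; have [xa|xa] := ltP a (x ord0 l).
    rewrite mem_set/=; last by rewrite /= in_itv/= andbT.
    have /cvgrPdist_le h : phi n x @[n --> \oo] --> (1 : R).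
      apply: (@flat0_cvg _ _ (x ord0 l - a)); first by rewrite subr_gt0.
      by apply: nearW => n; rewrite mulrBl mulrN ![n%:R * _]mulrC.
    by apply/cvgr0Pnorm_le => r /h; apply: filterS => n; rewrite normr_id.
  rewrite memNset/=; last by rewrite /= in_itv/= andbT; apply/negP; rewrite -leNgt.
  apply: cvg_near_cst; apply: nearW => n.
  rewrite /phi/= /flat ifF ?subrr ?normr0//.
  by apply/negbTE; rewrite -leNgt -mulrDr mulr_ge0_le0// subr_le0.
- by exists (phi k).
Qed.

(** Open half-spaces are approximated by [flat 0] of k (x_l - a) as k grows. They generate the
    sigma-algebra in two stages: half-lines generate the Borel sets of each axis, and the preimages
    of these generate the measurable sets of R^N. *)
Lemma measurable_approx (A : set E) : measurable A -> smooth_approximable A.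
Proof.
suff : g_sigma_preimage (@rV_coord R N) `<=` smooth_approximable by exact.
apply: smallest_sub.
  split => /=; [exact: approx0| |exact: approx_bigcup].
  by move=> B hB; rewrite setTD; exact: approxC.
move=> X; rewrite -bigcup_seq => -[l /= _ [C mC <-]]; rewrite setTI.
have {}mC : (@RGenOInfty.G R).-sigma.-measurable C by rewrite -RGenOInfty.measurableE.
suff : (@RGenOInfty.G R).-sigma.-measurable `<=`
    [set C | smooth_approximable (rV_coord l @^-1` C)] by exact.
apply: smallest_sub.
  split => /=.
  - by rewrite preimage_set0; exact: approx0.
  - by move=> B hB; rewrite setTD preimage_setC; exact: approxC.
  - by move=> F hF; rewrite preimage_bigcup; exact: approx_bigcup.
by move=> _ [a ->]; exact: approx_half.
Qed.

End approximation.

Section local_integrability.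
Context {R : realType} {N : nat}.
Local Notation E := 'rV[R]_N.
Local Notation lam := (rV_lebesgue R N).

Definition norm_ball (M : R) : set E := [set x | `|x| <= M].

Definition integrable_on_balls (u : E -> R) :=
  forall M, lam.-integrable (norm_ball M) (EFin \o u).

Lemma measurable_norm_ball M : measurable (norm_ball M).
Proof.
have mn : measurable_fun [set: E] (@Num.norm R E).
  by apply: continuous_rV_measurable => x; exact: norm_continuous.
rewrite (_ : norm_ball M = (@Num.norm R E) @^-1` `]-oo, M]%classic).
  by rewrite -[X in measurable X]setTI; exact: mn.
by apply/seteqP; split => x; rewrite /norm_ball/= in_itv/=.
Qed.

Lemma integrable_mul_supported (u phi : E -> R) (B M : R) :
  measurable_fun [set: E] u -> integrable_on_balls u ->
  measurable_fun [set: E] phi -> (forall x, `|phi x| <= B) ->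
  (forall x, M < `|x| -> phi x = 0) ->
  lam.-integrable [set: E] (EFin \o (fun x => u x * phi x)).
Proof.
move=> mu lu mphi phiB phiM.
have i1 : lam.-integrable (norm_ball M) (EFin \o (fun x => u x * phi x)).
  apply: (@integrableMl _ _ _ _ _ _ (EFin \o u) phi) => //.
  - exact: measurable_norm_ball.
  - exact: measurable_funTS.
  - exists B; split; first exact: num_real.
    by move=> K BK x _; rewrite /= (le_trans (phiB x))// ltW.
have /integrable_mkcond := i1 => /(_ (measurable_norm_ball M)).
apply: eq_integrable => // x _.
rewrite patchE; case: ifPn => // /negP; rewrite inE /norm_ball/= => /negP.
by rewrite -ltNge => /phiM ->; rewrite /= mulr0.
Qed.

Lemma integrable_mul_test (u phi : E -> R) :
  measurable_fun [set: E] u -> integrable_on_balls u -> test_function phi ->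
  lam.-integrable [set: E] (EFin \o (fun x => u x * phi x)).
Proof.
move=> mu lu tphi.
have [B _ phiB] := test_function_bounded tphi.
have /test_functionP[sphi [M phiM]] := tphi.
by apply: (integrable_mul_supported mu lu (smooth_measurable sphi) phiB phiM).
Qed.

Lemma integrable_on_ballsB (u w : E -> R) : integrable_on_balls u ->
  integrable_on_balls w -> integrable_on_balls (fun x => u x - w x).
Proof.
move=> lu lw M.
by have := integrableB (measurable_norm_ball M) (lu M) (lw M).
Qed.

Lemma integrable_on_balls_shift (u : E -> R) v : measurable_fun [set: E] u ->
  integrable_on_balls u -> integrable_on_balls (fun x => u (x + v)).
Proof.
move=> mu lu M.
have mv := measurable_rV_translate v.
have muv : measurable_fun [set: E] (fun x => u (x + v)) by exact: (measurableT_comp mu mv).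
have mP : measurable ((fun x : E => x - v) @^-1` norm_ball M).
  rewrite -[X in measurable X]setTI.
  by apply: (measurable_rV_translate (- v)) => //; exact: measurable_norm_ball.
apply/integrableP; split; first exact/measurable_EFinP/measurable_funTS.
have -> : norm_ball M = (fun x : E => x + v) @^-1` ((fun x : E => x - v) @^-1` norm_ball M).
  by apply/seteqP; split => x; rewrite /= addrK.
rewrite (ge0_integral_image (m2 := lam) mv (@rV_lebesgue_translate _ _ v) mP
  (f := fun x => `|(u x)%:E|%E))//; last first.
  apply/measurable_funTS; apply: measurableT_comp => //; exact/measurable_EFinP.
have /integrableP[_] := lu (M + `|v|).
apply: le_lt_trans; apply: ge0_subset_integral => //.
- exact: measurable_norm_ball.
- by apply/measurable_funTS; apply: measurableT_comp => //; exact/measurable_EFinP.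
- move=> x /=; rewrite /norm_ball/= => h.
  by rewrite -[x](subrK v) (le_trans (ler_normD _ _))// lerD2r.
Qed.

(** The optimal multiplier is the sign of [f]. It is replaced by [2 phi - 1], where the smooth [phi]
    approximates the indicator of [0 <= f] in the weight [|f|] times a cutoff. The cutoff makes the
    support compact and is removed by Fatou's lemma. *)
Lemma L1_duality (f : E -> R) (K : R) : measurable_fun [set: E] f ->
  integrable_on_balls f ->
  (forall phi, test_function phi -> (forall x, `|phi x| <= 1) ->
    \int[lam]_x (f x * phi x) <= K) ->
  (\int[lam]_x `|f x|%:E <= K%:E)%E.
Proof.
move=> mf lf h.
have mF : measurable_fun [set: E] (fun x => `|f x|) by apply: measurableT_comp.
have lF : integrable_on_balls (fun x => `|f x|).
  move=> M; have := lf M => /integrable_abse.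
  by apply: eq_integrable => //; exact: measurable_norm_ball.
have mchi k : measurable_fun [set: E] (cutoff k).
  by apply: smooth_measurable; have [] := cutoff_test (R:=R) (N:=N) k.
have step k : (\int[lam]_x (`|f x| * cutoff k x)%:E <= K%:E)%E.
  pose g x := `|f x| * cutoff k x.
  have ig : lam.-integrable [set: E] (EFin \o g).
    by apply: integrable_mul_test => //; exact: cutoff_test.
  have g0 x : 0 <= g x by rewrite mulr_ge0// cutoff_ge0.
  have mP : measurable [set x | 0 <= f x].
    rewrite (_ : mkset _ = f @^-1` `[0, +oo[%classic).
      by rewrite -[X in measurable X]setTI; exact: mf.
    by apply/seteqP; split => x /=; rewrite in_itv/= andbT.
  apply/lee_addgt0Pr => e e0; have e2 : 0 < e / 2 by lra.
  have [phi [sphi p01 pe]] := (measurable_approx g0 ig mP).2 _ e2.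
  pose Phi x := (2 * phi x + (- 1)) * cutoff k x.
  have tPhi : test_function Phi.
    apply: (test_functionM (cutoff_test k)).
    by apply: (smoothD (smoothM (smooth_cst 2) sphi)); exact: smooth_cst.
  have Phi1 x : `|Phi x| <= 1.
    rewrite normrM (ger0_norm (cutoff_ge0 _ _)) -[leRHS]mulr1 ler_pM ?cutoff_ge0 ?cutoff_le1//.
    by rewrite ler_norml; have := p01 x; lra.
  have iPhi := integrable_mul_test mf lf tPhi.
  have mphi := smooth_measurable sphi.
  have md : measurable_fun [set: E] (fun x => `|\1_[set x | 0 <= f x] x - phi x|).
    apply: measurableT_comp => //; apply: measurable_funB => //; exact: measurable_indic.
  have id : lam.-integrable [set: E] (EFin \o (fun x => 2 * (g x * `|\1_[set x | 0 <= f x] x - phi x|))).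
    have i2 := integrableMl measurableT ig md.
    have : lam.-integrable [set: E] (EFin \o (fun x => g x * `|\1_[set x | 0 <= f x] x - phi x|)).
      apply: i2; exists 1; split; first exact: num_real.
      move=> M M1 x _; rewrite /= normr_id (le_trans _ (ltW M1))// indicE ler_norml.
      by have := p01 x; case: (_ \in _) => /=; lra.
    by move=> /(integrableZl measurableT 2); apply: eq_integrable => // x _ /=; rewrite EFinM.
  (* Pointwise equality in fact: replacing the sign by [2 phi - 1] costs exactly twice the weighted
     approximation error. *)
  apply: (@le_trans _ _ (\int[lam]_x (f x * Phi x + 2 * (g x * `|\1_[set x | 0 <= f x] x - phi x|))%:E)%E).
    apply: le_integral => //; first by have := integrableD measurableT iPhi id.
    move=> x _; rewrite lee_fin /Phi /g indicE; have /andP[a b] := p01 x.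
    have c0 := cutoff_ge0 k x.
    have [fx|fx] := leP 0 (f x).
      rewrite mem_set//= (ger0_norm fx) ger0_norm ?subr_ge0//; lra.
    rewrite memNset/=; last by apply/negP; rewrite -ltNge.
    rewrite (ltr0_norm fx) sub0r normrN ger0_norm//; lra.
  under eq_integral do rewrite EFinD.
  rewrite integralD_EFin//; apply: leeD.
    by rewrite -[leLHS]fineK ?integrable_fin_num// lee_fin; exact: h.
  under eq_integral do rewrite /= EFinM.
  rewrite ge0_integralZl//; last 2 first.
  - by apply/measurable_EFinP; apply: measurable_funM => //; apply: measurable_funM.
  - by move=> x _; rewrite lee_fin mulr_ge0.
  rewrite (_ : e = 2 * (e / 2)); last by lra.
  by rewrite EFinM lee_wpmul2l// lee_fin.
have e1 x : (`|f x|%:E = limn_einf (fun k => (`|f x| * cutoff k x)%:E))%E.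
  rewrite limn_einf_lim; apply/esym/cvg_lim => //; apply: cvg_einfs.
  apply: cvg_EFin; first exact: nearW.
  rewrite -[X in _ --> X](mulr1 `|f x|); apply: cvgM; first exact: cvg_cst.
  exact: cutoff_cvg.
under eq_integral do rewrite e1.
apply: le_trans (fatou lam measurableT _ _) _.
- by move=> n; apply/measurable_EFinP; apply: measurable_funM.
- by move=> n x _; rewrite lee_fin mulr_ge0// cutoff_ge0.
- rewrite limn_einf_lim; apply: lime_le; first exact: is_cvg_einfs.
  apply: nearW => n; apply: le_trans (step n); apply: ereal_inf_lbound.
  by exists n => //=.
Qed.

End local_integrability.

(** * From bounded variation to translations in L^1 *)

Section translation_estimate.
Context {R : realType} {N : nat}.
Local Notation E := 'rV[R]_N.
Local Notation lam := (rV_lebesgue R N).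
Variables (u : E -> R) (i : 'I_N) (V : R).
Hypothesis mu : measurable_fun [set: E] u.
Hypothesis lu : integrable_on_balls u.
Hypothesis uV : forall phi, test_function phi -> (forall x, `|phi x| <= 1) ->
  `|\int[lam]_x (u x * pderive i phi x)| <= V.
Local Notation ei := (delta_mx ord0 i : E).

Let F (phi : E -> R) (s : R) := \int[lam]_x (u x * phi (x + s *: ei)).

Let is_derive_integrand (phi : E -> R) (x : E) (s : R) : test_function phi ->
  is_derive s 1 (fun s => u x * phi (x + s *: ei)) (u x * pderive i phi (x + s *: ei)).
Proof.
move=> [sphi _].
have pd : pderivable i phi by exact: smooth_pderivable.
have d1 := @is_derive_line R N phi x ei s (pd _).
exact: (is_deriveZ (u x) d1).
Qed.

Let is_derive_F (phi : E -> R) (a : R) : test_function phi ->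
  is_derive a 1 (F phi) (\int[lam]_x (u x * pderive i phi (x + a *: ei))).
Proof.
move=> tphi.
pose f s x := u x * phi (x + s *: ei).
have [B B0 phiB] := test_function_bounded (test_function_pderive i tphi).
have /test_functionP[sdphi [M phiM]] := test_function_pderive i tphi.
(* For [s] within 1 of [a], the shift by [s *: ei] moves the support by at most [(|a| + 1) |ei|], so
   [G] dominates the derivatives for all such [s] at once. *)
pose M' := M + (`|a| + 1) * `|ei|.
pose G x := `|u x| * (B * \1_(norm_ball M') x).
have mball := @measurable_norm_ball R N M'.
have lau : integrable_on_balls (fun x => `|u x|).
  move=> K; have := lu K => /integrable_abse.
  by apply: eq_integrable => //; exact: measurable_norm_ball.
have intG : lam.-integrable [set: E] (EFin \o G).
  apply: (@integrable_mul_supported _ _ _ _ B M') => //.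
  - by apply: measurableT_comp.
  - by apply: measurable_funM => //; exact: measurable_indic.
  - move=> x; rewrite indicE; case: (_ \in _); rewrite /= ?mulr1 ?mulr0 ?normr0//.
    by rewrite ger0_norm.
  - move=> x Mx; rewrite indicE memNset ?mulr0//.
    by rewrite /norm_ball/= => xM; move: Mx; rewrite ltNge xM.
have d1E s x : partial1of2 f s x = u x * pderive i phi (x + s *: ei).
  by rewrite partial1of2E; case: (is_derive_integrand x s tphi).
have Ia : `]a - 1, a + 1[%classic a by rewrite /= in_itv/=; lra.
have intf s : `]a - 1, a + 1[%classic s -> lam.-integrable [set: E] (EFin \o f s).
  by move=> _; apply: integrable_mul_test => //; exact: (test_function_shift _ tphi).
have derf s x : `]a - 1, a + 1[%classic s -> [set: E] x -> derivable (f ^~ x) s 1.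
  by move=> _ _; case: (is_derive_integrand x s tphi).
have G0 x : 0 <= G x by rewrite !mulr_ge0// indicE.
have Gub s x : `]a - 1, a + 1[%classic s -> [set: E] x -> `|partial1of2 f s x| <= G x.
  rewrite /= in_itv/= => sa _; rewrite d1E normrM /G ler_wpM2l//.
  rewrite indicE; have [xM|xM] := leP `|x| M'.
    by rewrite mem_set//= mulr1.
  rewrite memNset; last by rewrite /norm_ball/= => h; move: xM; rewrite ltNge h.
  rewrite phiM ?normr0 ?mulr0//.
  have : `|s *: ei| <= (`|a| + 1) * `|ei|.
    rewrite normrZ ler_wpM2r// ler_norml.
    by have := ler_norm a; have := ler_norm (- a); rewrite normrN; lra.
  by have := ler_normB (x + s *: ei) (s *: ei); rewrite addrK /M' in xM *; lra.
have := derivable_under_integral measurableT Ia intf derf G0 intG Gub.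
have := differentiation_under_integral measurableT Ia intf derf G0 intG Gub.
rewrite derive1E => dF derF; apply: DeriveDef => //; rewrite dF.
by apply: eq_Rintegral => x _; exact: d1E.
Qed.

Let weak_estimate (phi : E -> R) (h : R) : 0 <= h -> test_function phi -> (forall x, `|phi x| <= 1) ->
  \int[lam]_x ((u (x + h *: ei) - u x) * phi x) <= h * V.
Proof.
rewrite le_eqVlt => /predU1P[<-|h0] tphi phi1.
  under eq_Rintegral do rewrite scale0r addr0 subrr mul0r.
  by rewrite Rintegral_cst// mul0r mul0r.
have mphi : measurable_fun [set: E] phi by apply: smooth_measurable; have [] := tphi.
have muh : measurable_fun [set: E] (fun x => u (x + h *: ei)).
  exact: (measurableT_comp mu (measurable_rV_translate _)).
have eF : \int[lam]_x (u (x + h *: ei) * phi x) = F phi (- h).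
  rewrite /F /Rintegral; congr fine.
  rewrite -[RHS](@integral_rV_translate _ _ (h *: ei)); last first.
    apply/measurable_EFinP; apply: measurable_funM => //.
    exact: (measurableT_comp mphi (measurable_rV_translate (- h *: ei))).
  by apply: eq_integral => x _; rewrite scaleNr addrK.
have eF0 : \int[lam]_x (u x * phi x) = F phi 0.
  by apply: eq_Rintegral => x _; rewrite scale0r addr0.
under eq_Rintegral do rewrite mulrBl.
rewrite RintegralB//; last 2 first.
- apply: integrable_mul_test => //; exact: integrable_on_balls_shift.
- exact: integrable_mul_test.
rewrite eF eF0.
have [|||c _ hc] := @MVT R (F phi) (fun a => \int[lam]_x (u x * pderive i phi (x + a *: ei))) (- h) 0.
- by rewrite oppr_lt0.
- by move=> a _; exact: is_derive_F.
- apply: continuous_subspaceT => a; apply: differentiable_continuous.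
  by apply/derivable1_diffP; case: (is_derive_F a tphi).
have tc := test_function_shift (c *: ei) tphi.
have := uV tc (fun x => phi1 _).
have pd : pderivable i phi by apply: smooth_pderivable; have [] := tphi.
under eq_Rintegral do rewrite (pderive_shift _ _ pd).
rewrite ler_norml => /andP[b1 b2].
rewrite -opprB hc sub0r opprK mulrC -mulrN ler_wpM2l ?(ltW h0)//; lra.
Qed.

(** Paired with a test function [phi], the difference gives [F phi (- h) - F phi 0], which is [- h]
    times a derivative of [F phi] by the mean value theorem. That derivative pairs [u] with the i-th
    derivative of a translate of [phi], so [uV] bounds it by [V]; duality concludes. *)
Lemma L1_translation_le (h : R) : 0 <= h ->
  (\int[lam]_x `|u (x + h *: ei) - u x|%:E <= (h * V)%:E)%E.
Proof.
move=> h0; apply: L1_duality.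
- apply: measurable_funB => //.
  exact: (measurableT_comp mu (measurable_rV_translate _)).
- by apply: integrable_on_ballsB => //; exact: integrable_on_balls_shift.
- by move=> phi tphi phi1; exact: weak_estimate.
Qed.

End translation_estimate.

(** * Uniform boundedness of the derivative measures *)

Section uniform_boundedness.
Context {R : realType} {N : nat}.
Local Notation E := 'rV[R]_N.
Implicit Types (f g : E -> R).

Lemma C0_bounded f : C0 f -> exists2 B : R, 0 <= B & forall x, `|f x| <= B.
Proof.
move=> [cf /(_ _ ltr01)[M fM]].
have : compact (f @` cube (const_mx (- `|M|)) (`|M| + `|M|)).
  by apply: continuous_compact; [exact: continuous_subspaceT|exact: compact_cube].
move=> /compact_bounded[M0 [_ /(_ (M0 + 1))]].
rewrite ltrDl ltr01 => /(_ isT); move: (M0 + 1) => B h.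
exists (Num.max B 1); first by rewrite le_max ler01 orbT.
move=> x; rewrite le_max; have [Mx|xM] := leP M `|x|.
  by rewrite (ltW (fM _ Mx)) orbT.
apply/orP; left; apply: h; exists x => // i; rewrite mxE.
have : `|x ord0 i| <= `|M|.
  by rewrite (le_trans (rV_norm_coord _ _))// (le_trans (ltW xM))// ler_norm.
by rewrite ler_norml addrA addNr add0r.
Qed.

Lemma C0_cst0 : C0 (fun _ : E => 0 : R).
Proof.
split; first by move=> x; exact: cst_continuous.
by move=> e e0; exists 0 => x _; rewrite normr0.
Qed.

Lemma C0_addZ c f g : C0 f -> C0 g -> C0 (fun x => f x + c * g x).
Proof.
move=> [cf f0] [cg g0]; split.
  move=> x; apply: (@continuousD _ _ _ f (fun x => c * g x)); first exact: cf.
  by apply: (@continuousM _ _ (fun=> c) g); [exact: cst_continuous|exact: cg].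
move=> e e0; have e20 : 0 < e / 2 by rewrite divr_gt0.
have c0 : 0 < `|c| + 1 by rewrite ltr_wpDl.
have [M1 fM] := f0 _ e20; have [M2 gM] := g0 _ (divr_gt0 e20 c0).
exists (Num.max M1 M2) => x; rewrite ge_max => /andP[/fM fx /gM gx].
rewrite (le_lt_trans (ler_normD _ _))// normrM [ltRHS]splitr ltr_leD//.
apply: (@le_trans _ _ (`|c| * (e / 2 / (`|c| + 1)))).
  by rewrite ler_wpM2l// ltW.
by rewrite mulrA ler_pdivrMr// mulrC ler_wpM2l ?(ltW e20)// lerDl.
Qed.

(** Plays the role of completeness of C_0 in the gliding hump argument. *)
Lemma C0_uniform_limit f :
  (forall e : R, 0 < e -> exists2 g, C0 g & forall x, `|f x - g x| <= e) -> C0 f.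
Proof.
move=> h; split.
- move=> x; apply/(@cvgrPdist_lt _ _ _ (nbhs x) (nbhs_filter x)) => e e0.
  have e30 : 0 < e / 3 by rewrite divr_gt0.
  have [g [cg _] fg] := h _ e30.
  have /(@cvgrPdist_lt _ _ _ (nbhs x) (nbhs_filter x))/(_ _ e30) := cg x; apply: filterS => y gxy.
  have := ler_normD (f x - g x + (g x - g y)) (g y - f y).
  have := ler_normD (f x - g x) (g x - g y).
  have -> : f x - g x + (g x - g y) + (g y - f y) = f x - f y by ring.
  have := fg x; have := fg y; rewrite (distrC (f y)).
  by move: gxy; set A := `|g x - g y|; set B := `|g y - f y|; lra.
- move=> e e0; have e20 : 0 < e / 2 by rewrite divr_gt0.
  have [g [_ /(_ _ e20)[M gM]] fg] := h _ e20.
  exists M => x /gM gx; have := ler_normD (f x - g x) (g x).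
  by rewrite subrK; have := fg x; lra.
Qed.

Variable T : nat -> (E -> R) -> R.
Hypothesis T_addZ : forall k c f g, C0 f -> C0 g ->
  T k (fun x => f x + c * g x) = T k f + c * T k g.
Hypothesis T_bounded : forall k, exists K : R, forall f, C0 f ->
  (forall x, `|f x| <= 1) -> `|T k f| <= K.
Hypothesis T_pointwise : forall f, C0 f -> exists M : R, forall k, `|T k f| <= M.

Let T0 k : T k (fun=> 0) = 0.
Proof.
have := @T_addZ k (-1) _ _ C0_cst0 C0_cst0.
by under eq_fun do rewrite mulr0 addr0; move=> ->; rewrite mulN1r subrr.
Qed.

Let TZ k c f : C0 f -> T k (fun x => c * f x) = c * T k f.
Proof.
move=> cf; have := @T_addZ k c _ _ C0_cst0 cf.
by under eq_fun do rewrite add0r; move=> ->; rewrite T0 add0r.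
Qed.

Let ball f := C0 f /\ forall x, `|f x| <= 1.

Let near_extremal k V f0 : 0 <= V -> ball f0 -> V < `|T k f0| ->
  exists f, [/\ ball f, V < `|T k f| & forall g, ball g -> `|T k g| <= 5 / 4 * `|T k f|].
Proof.
move=> V0 bf0 Vf0; have [K TK] := T_bounded k.
pose S := [set `|T k f| | f in ball].
have hS : has_sup S.
  split; first by exists `|T k f0|, f0.
  by exists K => _ [f [cf f1] <-]; exact: TK.
have supf g : ball g -> `|T k g| <= sup S.
  by move=> bg; apply: (sup_upper_bound hS); exists g.
(* Losing less than [sup S / 5] leaves more than 4/5 of the supremum, whence the factor 5/4; losing
   less than [sup S - V] stays above [V]. *)
have e0 : 0 < Num.min (sup S - V) (sup S / 5).
  have := supf _ bf0; rewrite lt_min; lra.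
have [_ [f bf <-]] := sup_adherent e0 hS; rewrite ltrBlDr => hf.
have mV : Num.min (sup S - V) (sup S / 5) <= sup S - V by rewrite ge_min lexx.
have m5 : Num.min (sup S - V) (sup S / 5) <= sup S / 5 by rewrite ge_min lexx orbT.
exists f; split => //; first by lra.
by move=> g /supf; lra.
Qed.

(** The candidates [b + c a] and [b - c a] differ by [2 c a], so they cannot both have modulus below
    [c |a|]. *)
Let opposite_step (a b c : R) : 0 < c ->
  ~~ (c * `|a| <= `|b + c * a|) -> c * `|a| <= `|b + - c * a|.
Proof.
have normZ (z : R) : 0 < c -> c * `|z| = `|c * z| by move=> c0; rewrite normrM gtr0_norm.
move=> c0; rewrite -ltNge normZ// mulNr => h.
have := ler_normD (b + c * a) (- (b - c * a)); rewrite normrN.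
have -> : b + c * a - (b - c * a) = 2 * (c * a) by ring.
by rewrite normrM ger0_norm//; lra.
Qed.

(* Sokal's elementary gliding hump, which avoids the Baire category theorem. *)
Lemma uniform_boundedness : exists V : R, forall k f, C0 f ->
  (forall x, `|f x| <= 1) -> `|T k f| <= V.
Proof.
apply: contrapT => nV.
have big n : exists kf : nat * (E -> R), [/\ ball kf.2, 4 ^+ n < `|T kf.1 kf.2| &
    forall g, ball g -> `|T kf.1 g| <= 5 / 4 * `|T kf.1 kf.2|].
  apply: contrapT => nkf; apply: nV; exists (4 ^+ n) => k f cf f1.
  rewrite leNgt; apply/negP => h; apply: nkf.
  have n0 : 0 <= 4 ^+ n :> R by rewrite exprn_ge0.
  by have [f' ?] := near_extremal n0 (conj cf f1) h; exists (k, f').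
have [F HF] := choice big.
(* The ratio 3 balances two demands: [r n * 4 ^+ n] must diverge, and the sum of all later steps
   must be small against the current one. *)
pose k n := (F n).1; pose h n := (F n).2; pose r n : R := 3 ^- n.
have bh n : ball (h n) by have [] := HF n.
have Tbig n : 4 ^+ n < `|T (k n) (h n)| by have [] := HF n.
have Text n g : ball g -> `|T (k n) g| <= 5 / 4 * `|T (k n) (h n)|.
  by have [_ _] := HF n; exact.
have r0 n : 0 < r n by rewrite invr_gt0 exprn_gt0.
have rS n : r n.+1 = r n / 3 by rewrite /r exprSr invfM.
pose sg n (f : E -> R) : R :=
  if r n * `|T (k n) (h n)| <= `|T (k n) (fun x => f x + r n * h n x)| then r n else - r n.
pose fix x_ n : E -> R := if n is m.+1 then
  fun x => x_ m x + sg m (x_ m) * h m x else fun=> 0.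
have sgr n f : `|sg n f| = r n by rewrite /sg; case: ifP => _; rewrite ?normrN gtr0_norm.
have cx n : C0 (x_ n).
  elim: n => [|n IH]; first exact: C0_cst0.
  by apply: C0_addZ => //; have [] := bh n.
have Tx n : r n * `|T (k n) (h n)| <= `|T (k n) (x_ n.+1)|.
  have ch : C0 (h n) by have [] := bh n.
  by rewrite /= /sg; case: ifPn => //; rewrite !T_addZ//; exact: opposite_step.
(* The sum of [r m] over [m >= n]. Since [c n - c n.+1 = r n], the intervals of radius [c n] around
   [x_ n t] are nested. *)
pose c n : R := 3 / 2 * r n.
have step n t : `|x_ n.+1 t - x_ n t| <= r n.
  rewrite /= addrC addKr normrM sgr ger_pMr//; have [_] := bh n; exact.
have mono n m t : (n <= m)%N -> x_ n t - c n <= x_ m t - c m /\ x_ m t + c m <= x_ n t + c n.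
  move=> /subnK <-; elim: (m - n)%N => [|d [IH1 IH2]]; first by rewrite add0n.
  rewrite addSn; have := step (d + n)%N t; rewrite ler_norml => /andP[].
  have := rS (d + n)%N; rewrite /c; move: IH1 IH2; rewrite /c.
  move: (x_ (d + n).+1 t) (x_ (d + n)%N t) (r (d + n).+1) (r (d + n)%N) => *.
  by split; lra.
have sandwich n m t : x_ n t - c n <= x_ m t + c m.
  have [h1 h2] := mono _ _ t (leq_maxl n m); have [h3 h4] := mono _ _ t (leq_maxr n m).
  have : 0 < c (maxn n m) by rewrite mulr_gt0.
  by move: h1 h2 h3 h4; set a := x_ (maxn n m) t; lra.
pose x t := sup (range (fun n => x_ n t - c n)).
have xx n t : `|x t - x_ n t| <= c n.
  have hs : has_sup (range (fun n => x_ n t - c n)).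
    split; first by exists (x_ 0 t - c 0), 0%N.
    by exists (x_ 0 t + c 0) => _ [m _ <-]; exact: sandwich.
  rewrite ler_distl; apply/andP; split.
    by apply: (sup_upper_bound hs); exists n.
  apply: ge_sup; first by case: hs.
  by move=> _ [m _ <-]; exact: sandwich.
have r_cvg : r @ \oo --> (0 : R).
  have := @cvg_expr R 3^-1; rewrite ger0_norm ?invr_ge0//.
  rewrite invf_lt1// ltr1n => /(_ isT); apply: cvg_trans; apply: near_eq_cvg.
  by apply: nearW => n /=; rewrite /r exprVn.
have Cx : C0 x.
  apply: C0_uniform_limit => e e0.
  have e320 : 0 < e * (2 / 3) by rewrite mulr_gt0.
  have /cvgrPdist_lt/(_ _ e320)[n _ /(_ n (leqnn n))/=] := r_cvg.
  rewrite sub0r normrN gtr0_norm// => hn; exists (x_ n) => // t.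
  by apply: le_trans (xx n t) _; rewrite /c; lra.
have [M TM] := T_pointwise Cx.
(* The step to [x_ n.+1] secures the value [r n] times [|T (k n) (h n)|]. The later steps together
   change it by at most [5/4 * c n.+1 = 5/8 * r n] times the same number, which leaves 3/8. *)
have low n : 3 / 8 * (r n * 4 ^+ n) <= M.
  apply: le_trans (TM (k n)).
  have bg : ball (fun t => (c n.+1)^-1 * (x t + (-1) * x_ n.+1 t)).
    split.
      have := C0_addZ (c n.+1)^-1 C0_cst0 (C0_addZ (-1) Cx (cx n.+1)).
      by under eq_fun do rewrite add0r.
    move=> t; have c0 : 0 < c n.+1 by rewrite mulr_gt0.
    rewrite mulN1r normrM gtr0_norm ?invr_gt0// mulrC ler_pdivrMr// mul1r.
    exact: xx.
  have := Text n _ bg; rewrite TZ; last exact: C0_addZ.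
  rewrite T_addZ// mulN1r normrM gtr0_norm; last by rewrite invr_gt0 mulr_gt0.
  rewrite mulrC ler_pdivrMr; last by rewrite mulr_gt0.
  have := Tx n; have := Tbig n; rewrite -(ltr_pM2l (r0 n)).
  have := ler_normB (T (k n) x) (T (k n) x - T (k n) (x_ n.+1)).
  rewrite subKr /c rS.
  move: (r n * 4 ^+ n) (r0 n) => z rn0.
  move: `|T (k n) (h n)| `|T _ x - T _ _| `|T (k n) x| `|T _ _| => a b d e.
  move=> h1 h2 h3 h4.
  have : 5 / 4 * a * (3 / 2 * (r n / 3)) = 5 / 8 * (r n * a) by field.
  by lra.
have rn4 n : r n * 4 ^+ n = (4 / 3) ^+ n by rewrite /r expr_div_n mulrC.
have lin n : 1 + n%:R / 3 <= (4 / 3) ^+ n :> R.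
  elim: n => [|n IH]; first by rewrite mul0r addr0 expr0.
  rewrite exprS -natr1; have : 0 <= n%:R :> R by []; lra.
have := archi_boundP (normr_ge0 (8 * M)).
have := lin (Num.bound `|8 * M|); have := low (Num.bound `|8 * M|); rewrite rn4.
by have := ler_norm (8 * M); move: ((4 / 3) ^+ _) ((Num.bound _)%:R) => a b; lra.
Qed.

End uniform_boundedness.

(** * Derivative measures as functionals on C_0 *)

Section charge_integral_lemmas.
Context {R : realType} {N : nat}.
Local Notation E := 'rV[R]_N.
Implicit Types (f g : E -> R).

Lemma integrable_C0 (m : {finite_measure set E -> \bar R}) f : C0 f ->
  m.-integrable [set: E] (EFin \o f).
Proof.
move=> cf; apply: measurable_bounded_integrable => //.
- by rewrite ltey_eq fin_num_measure.
- by apply: continuous_rV_measurable; case: cf.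
- have [B B0 fB] := C0_bounded cf; exists B; split; first exact: ger0_real.
  by move=> M BM x _ /=; rewrite (le_trans (fB x))// ltW.
Qed.

Lemma charge_integral_addZ (nu : {charge set E -> \bar R}) c f g : C0 f -> C0 g ->
  charge_integral nu (fun x => f x + c * g x) =
  charge_integral nu f + c * charge_integral nu g.
Proof.
move=> cf cg; rewrite /charge_integral.
have H (m : {finite_measure set E -> \bar R}) :
    \int[m]_x (f x + c * g x) = \int[m]_x f x + c * \int[m]_x g x.
  rewrite RintegralD//; last 2 first.
  - exact: integrable_C0.
  - have := integrable_C0 m (C0_addZ c C0_cst0 cg).
    by apply: eq_integrable => // x _ /=; rewrite add0r.
  by rewrite RintegralZl//; exact: integrable_C0.
by rewrite !H; ring.
Qed.

Lemma charge_integral_bounded (nu : {charge set E -> \bar R}) : exists K : R, forall f,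
  C0 f -> (forall x, `|f x| <= 1) -> `|charge_integral nu f| <= K.
Proof.
have H (m : {finite_measure set E -> \bar R}) : exists K : R, forall f,
  C0 f -> (forall x, `|f x| <= 1) -> `|\int[m]_x f x| <= K.
  exists (fine (m setT)) => f cf f1.
  apply: (le_trans (le_normr_Rintegral _ (integrable_C0 m cf))) => //.
  rewrite /Rintegral; apply: fine_le.
  - apply: integrable_fin_num => //.
    by have := integrable_norm (integrable_C0 m cf).
  - exact: fin_num_measure.
  rewrite -[leRHS]mul1e -integral_cst//; apply: ge0_le_integral => //.
  - apply/measurable_EFinP; apply: measurableT_comp => //.
    by apply: continuous_rV_measurable; case: cf.
  - by move=> x _; rewrite lee_fin f1.
rewrite /charge_integral.
move: (svalP (cid (svalP (cid (Hahn_decomposition nu))))) => PN.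
pose mp : {finite_measure set E -> \bar R} := jordan_pos PN.
pose mn : {finite_measure set E -> \bar R} := jordan_neg PN.
have [K1 h1] := H mp; have [K2 h2] := H mn.
exists (K1 + K2) => f cf f1; rewrite (le_trans (ler_normB _ _))// lerD//.
  exact: h1.
exact: h2.
Qed.

(** Convergent real sequences are bounded, so the derivative measures are pointwise bounded
    functionals on C_0 and [uniform_boundedness] applies in each direction. The constants of the
    finitely many directions are added to obtain a single [V]. *)
Lemma weak_cvg_bounded (u_ : nat -> E -> R) u : weak_cvg u_ u -> exists V : R,
  forall k i phi, test_function phi -> (forall x, `|phi x| <= 1) ->
    `|\int[leb R N]_x (u_ k x * pderive i phi x)| <= V.
Proof.
move=> [_ uw].
have H (i : 'I_N) : exists V : R, forall k phi, test_function phi ->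
    (forall x, `|phi x| <= 1) -> `|\int[leb R N]_x (u_ k x * pderive i phi x)| <= V.
  have [nu_ [nu [unu _ nucvg]]] := uw i.
  have [|k|f cf|V hV] := @uniform_boundedness R N (fun k => charge_integral (nu_ k)).
  - by move=> k c f g; exact: charge_integral_addZ.
  - exact: charge_integral_bounded.
  - have [M [_ /(_ (M + 1))]] := cvg_seq_bounded (cvgP _ (nucvg f cf)).
    by rewrite ltrDl ltr01 => /(_ isT) h; exists (M + 1) => k; exact: h.
  exists V => k phi tphi phi1; rewrite -normrN -unu//.
  by apply: hV => //; exact: test_function_C0.
have [V hV] := choice H; exists (\sum_i `|V i|) => k i phi tphi phi1.
rewrite (le_trans (hV i k phi tphi phi1))// (bigD1 i)//= -[leLHS]addr0 lerD ?ler_norm//.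
exact: sumr_ge0.
Qed.

End charge_integral_lemmas.

(** * Level sets and cube averages *)

Lemma measurable_superlevel d (T : measurableType d) (R : realType) (f : T -> R) (l : R) :
  measurable_fun [set: T] f -> measurable [set x | l < `|f x|].
Proof.
move=> mf; have mn : measurable_fun [set: T] (fun x => `|f x|) by exact: measurableT_comp.
have := mn measurableT `]l, +oo[%classic (measurable_itv _); rewrite setTI.
congr measurable.
by apply/seteqP; split => x /=; rewrite in_itv/= andbT.
Qed.

Lemma measurable_norm_EFin d (T : measurableType d) (R : realType) (f : T -> R) :
  measurable_fun [set: T] f -> measurable_fun [set: T] (fun x => `|f x|%:E).
Proof. by move=> mf; apply/measurable_EFinP; exact: measurableT_comp. Qed.

(** * The L^1 modulus of translation *)

Section L1diff.
Context {R : realType} {N : nat}.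
Local Notation E := 'rV[R]_N.
Local Notation lam := (rV_lebesgue R N).
Local Open Scope ereal_scope.
Implicit Types (f u : E -> R) (v w : E).

Definition L1diff f v : \bar R := \int[lam]_x `|f (x + v)%R - f x|%:E.

Lemma measurable_shift f v : measurable_fun [set: E] f ->
  measurable_fun [set: E] (fun x => f (x + v)%R).
Proof. by move=> mf; exact: (measurableT_comp mf (measurable_rV_translate v)). Qed.

Lemma measurable_L1diff f v : measurable_fun [set: E] f ->
  measurable_fun [set: E] (fun x => `|f (x + v)%R - f x|%:E).
Proof.
move=> mf; apply/measurable_EFinP; apply: measurableT_comp => //.
by apply: measurable_funB => //; exact: measurable_shift.
Qed.

Lemma L1diff_ge0 f v : 0 <= L1diff f v.
Proof. by apply: integral_ge0 => x _; rewrite lee_fin. Qed.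

Lemma L1diff0 f : L1diff f 0 = 0.
Proof.
rewrite /L1diff; under eq_integral do rewrite addr0 subrr normr0.
by rewrite integral0.
Qed.

(** Translation invariance lets the increment by [v] be taken at the points [x + w]; the rest is the
    triangle inequality. *)
Lemma L1diffD f v w : measurable_fun [set: E] f ->
  L1diff f (v + w)%R <= L1diff f v + L1diff f w.
Proof.
move=> mf.
have -> : L1diff f v = \int[lam]_x `|f (x + w + v)%R - f (x + w)%R|%:E.
  by rewrite (integral_rV_translate w (measurable_L1diff v mf)).
rewrite -ge0_integralD//; last 2 first.
- apply: (measurableT_comp (measurable_L1diff v mf)).
  exact: measurable_rV_translate.
- exact: measurable_L1diff.
apply: ge0_le_integral => //.
- exact: measurable_L1diff.
- apply: emeasurable_funD; last exact: measurable_L1diff.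
  apply: (measurableT_comp (measurable_L1diff v mf)).
  exact: measurable_rV_translate.
- move=> x _; rewrite -EFinD lee_fin addrA (addrAC x w v).
  exact: ler_distD.
Qed.

Lemma L1diffMn f v n : measurable_fun [set: E] f ->
  L1diff f (v *+ n)%R <= n%:R%:E * L1diff f v.
Proof.
move=> mf; elim: n => [|n IH]; first by rewrite mulr0n L1diff0 mul0e.
rewrite mulrSr (le_trans (L1diffD _ _ mf))// -natr1 EFinD ge0_muleDl//.
by rewrite mul1e leeD.
Qed.

Lemma L1diff_sum f (v : 'I_N -> E) : measurable_fun [set: E] f ->
  L1diff f (\sum_i v i)%R <= \sum_i L1diff f (v i).
Proof.
move=> mf; elim/big_ind2 : _ => //; first by rewrite L1diff0.
by move=> x1 x2 y1 y2 h1 h2; rewrite (le_trans (L1diffD _ _ mf))// leeD.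
Qed.

Lemma le_L1diff f u v : measurable_fun [set: E] f -> measurable_fun [set: E] u ->
  (forall x y, `|f x - f y| <= `|u x - u y|)%R -> L1diff f v <= L1diff u v.
Proof.
move=> mf mu fu; apply: ge0_le_integral => //; try exact: measurable_L1diff.
by move=> x _; rewrite lee_fin.
Qed.

End L1diff.

(** * Slices between two levels *)

Section levels.
Context {R : realType}.
Implicit Types (a b s t : R).

Definition slice a b s := Num.min `|s| b - Num.min `|s| a.

Lemma slice_ge0 a b s : a <= b -> 0 <= slice a b s.
Proof.
by move=> ab; rewrite /slice subr_ge0 le_min !ge_min lexx/=; apply/orP; right.
Qed.

Lemma slice_le a b s : a <= b -> slice a b s <= b - a.
Proof. by move=> ab; rewrite /slice; case: (leP `|s| b); case: (leP `|s| a); lra. Qed.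

Lemma slice_le_norm a b s : 0 <= a -> slice a b s <= `|s|.
Proof.
move=> a0; rewrite /slice; have := normr_ge0 s.
by case: (leP `|s| b); case: (leP `|s| a); lra.
Qed.

Lemma slice_low a b s : a <= b -> `|s| <= a -> slice a b s = 0.
Proof. by move=> ab sa; rewrite /slice !min_l ?subrr// (le_trans sa). Qed.

Lemma slice_high a b s : a <= b -> b <= `|s| -> slice a b s = b - a.
Proof. by move=> ab bs; rewrite /slice !min_r// (le_trans ab). Qed.

Lemma slice_homo a b s t : a <= b -> `|s| <= `|t| -> slice a b s <= slice a b t.
Proof.
move=> ab st; rewrite /slice.
by case: (leP `|s| b); case: (leP `|s| a); case: (leP `|t| b); case: (leP `|t| a); lra.
Qed.

(** Slices are monotone in [|s|], so all differences have the same sign; the absolute values drop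
    and the sum telescopes. This is the pointwise source of the additivity of the variation over
    slices. *)
Lemma sum_slice_le (l : nat -> R) n s t : {homo l : i j / (i <= j)%N >-> i <= j} ->
  \sum_(k < n) `|slice (l k) (l k.+1) s - slice (l k) (l k.+1) t| <= `|s - t|.
Proof.
move=> hl; wlog st : s t / `|t| <= `|s|.
  move=> wl; have [/wl//|/ltW/wl] := leP `|t| `|s|.
  by rewrite (distrC t s); under eq_bigr do rewrite distrC.
rewrite (eq_bigr (fun k : 'I_n => (Num.min `|s| (l k.+1) - Num.min `|t| (l k.+1)) -
    (Num.min `|s| (l k) - Num.min `|t| (l k)))); last first.
  move=> k _; rewrite ger0_norm; first by rewrite /slice; lra.
  by rewrite subr_ge0 slice_homo// hl.
rewrite -(big_mkord xpredT (fun k => (Num.min `|s| (l k.+1) - Num.min `|t| (l k.+1)) -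
    (Num.min `|s| (l k) - Num.min `|t| (l k)))) telescope_sumr//.
apply: (@le_trans _ _ (`|s| - `|t|)); last exact: lerB_dist.
by case: (leP `|s| (l n)); case: (leP `|t| (l n)); case: (leP `|s| (l 0%N)); case: (leP `|t| (l 0%N)); lra.
Qed.

Lemma slice_lip a b s t : a <= b -> `|slice a b s - slice a b t| <= `|s - t|.
Proof.
move=> ab.
have := @sum_slice_le (fun n => if n is 0%N then a else b) 1 s t.
by rewrite big_ord1; apply => -[|i] [|j].
Qed.

Lemma measurable_slice a b : measurable_fun [set: R] (slice a b).
Proof.
by apply: measurable_funB; apply: measurable_minr.
Qed.

End levels.

Section slices_variation.
Context {R : realType} {N : nat}.
Local Notation E := 'rV[R]_N.
Local Notation lam := (rV_lebesgue R N).
Variables (u : E -> R) (e : E) (V : R).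
Hypothesis mu : measurable_fun [set: E] u.
Hypothesis uV : forall h : R, 0 <= h -> (L1diff u (h *: e) <= (h * V)%:E)%E.
Variables (l : nat -> R) (n : nat).
Hypothesis hl : {homo l : i j / (i <= j)%N >-> i <= j}.

Let f k x := slice (l k) (l k.+1) (u x).
Let a k (s : R) := fine (L1diff (f k) (s *: e)).

Let mf k : measurable_fun [set: E] (f k).
Proof. exact: (measurableT_comp (measurable_slice _ _) mu). Qed.

Let V_ge0 : 0 <= V.
Proof.
have := le_trans (L1diff_ge0 u (1 *: e)) (uV ler01).
by rewrite lee_fin mul1r.
Qed.

Let f_le k s : 0 <= s -> (L1diff (f k) (s *: e) <= (s * V)%:E)%E.
Proof.
move=> s0; apply: le_trans (uV s0); apply: le_L1diff => // x y.
by apply: slice_lip; exact: hl.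
Qed.

Let aE k s : 0 <= s -> L1diff (f k) (s *: e) = (a k s)%:E.
Proof.
move=> s0; rewrite /a fineK// ge0_fin_numE ?L1diff_ge0//.
by rewrite (le_lt_trans (f_le k s0))// ltry.
Qed.

Let a_ge0 k s : 0 <= a k s. Proof. by rewrite fine_ge0// L1diff_ge0. Qed.

Let a_le k s : 0 <= s -> a k s <= s * V.
Proof. by move=> s0; rewrite -lee_fin -aE//; exact: f_le. Qed.

(** A translation of length [s] consists of floor(s / h) steps of length [h] and a remainder of at
    most [h], which costs at most [h * V]. Difference quotients at scale [s] are thus bounded by
    those at any smaller scale, up to an error that vanishes with [h]. *)
Let a_scale k s h : 0 <= s -> 0 < h -> a k s <= s / h * a k h + h * V.
Proof.
move=> s0 h0; pose m := Num.truncn (s / h).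
have sh0 : 0 <= s / h by rewrite divr_ge0// ltW.
have /andP[m1 m2] := truncn_itv sh0; rewrite -/m in m1 m2.
pose r := s - m%:R * h.
have r0 : 0 <= r by rewrite subr_ge0 -ler_pdivlMr.
have rh : r <= h.
  by move: m2; rewrite ltr_pdivrMr// -natr1 mulrDl mul1r /r; lra.
have sE : s *: e = r *: e + (h *: e) *+ m.
  by rewrite -scaler_nat scalerA -scalerDl /r subrK.
rewrite -lee_fin -aE// sE (le_trans (L1diffD _ _ (mf k)))// addeC EFinD.
apply: leeD; last first.
  by rewrite (le_trans (f_le k r0))// lee_fin ler_wpM2r.
rewrite (le_trans (L1diffMn _ _ (mf k)))// (aE k (ltW h0)) -EFinM lee_fin.
by rewrite ler_wpM2r.
Qed.

Let sum_same h : 0 <= h -> \sum_(k < n) a k h <= h * V.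
Proof.
move=> h0; rewrite -lee_fin; apply: le_trans (uV h0).
rewrite -sumEFin; under eq_bigr do rewrite -aE//.
rewrite /L1diff -ge0_integral_sum//; last first.
  by move=> k; exact: measurable_L1diff.
apply: ge0_le_integral => //.
- by move=> x _; apply: sume_ge0 => k _; rewrite lee_fin.
- by apply: emeasurable_sum => k; exact: measurable_L1diff.
- exact: measurable_L1diff.
- by move=> x _; rewrite sumEFin lee_fin; exact: sum_slice_le.
Qed.

Let sum_diff (s : nat -> R) : (forall k, 0 < s k) ->
  \sum_(k < n) a k (s k) / s k <= V.
Proof.
move=> s0; pose C := V * \sum_(k < n) (s k)^-1.
have C0 : 0 <= C by rewrite mulr_ge0// sumr_ge0// => k _; rewrite invr_ge0 ltW.
(* All slices are compared at one common step [h], where [sum_same] applies; the error [h * C]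
   disappears as [h] tends to 0. *)
have main h : 0 < h -> \sum_(k < n) a k (s k) / s k <= V + h * C.
  move=> h0; apply: (@le_trans _ _ (\sum_(k < n) (a k h / h + h * V * (s k)^-1))).
    apply: ler_sum => k _; rewrite ler_pdivrMr// (le_trans (a_scale k (ltW (s0 k)) h0))//.
    rewrite mulrDl (divfK (lt0r_neq0 (s0 k))) lerD2r.
    by rewrite (_ : s k / h * a k h = a k h / h * s k)//; ring.
  rewrite big_split/= lerD//.
    by rewrite -mulr_suml ler_pdivrMr// mulrC sum_same// ltW.
  by rewrite -mulr_sumr /C mulrA.
apply/ler_addgt0Pr => d d0.
have h0 : 0 < d / (C + 1) by rewrite divr_gt0//; lra.
apply: le_trans (main _ h0) _; rewrite lerD2l -mulrA ler_piMr// ?(ltW d0)//.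
by rewrite mulrC ler_pdivrMr; lra.
Qed.

(* [v k] is the supremum of the difference quotients of the k-th slice.  By
   subadditivity in [s] these are almost maximal for all small [s], so the
   suprema of the different slices are reached simultaneously. *)
Lemma slices_variation : exists v : nat -> R,
  [/\ forall k, 0 <= v k, \sum_(k < n) v k <= V &
   forall k s, 0 <= s ->
     (L1diff (fun x => slice (l k) (l k.+1) (u x)) (s *: e) <= (s * v k)%:E)%E].
Proof.
pose A k := [set a k s / s | s in [set s | 0 < s]].
have hA k : has_sup (A k).
  split; first by exists (a k 1 / 1); exists 1 => //=.
  by exists V => _ [s /= s0 <-]; rewrite ler_pdivrMr// mulrC a_le// ltW.
pose v k := sup (A k).
exists v; split.
- move=> k; have : A k (a k 1 / 1) by exists 1 => //=.
  move/(ub_le_sup (hA k).2); apply: le_trans.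
  by rewrite divr_ge0.
- apply/ler_addgt0Pr => d d0.
  have n0 : 0 < d / n.+1%:R by rewrite divr_gt0.
  have /choice[s hs] : forall k, exists s, 0 < s /\ v k - d / n.+1%:R < a k s / s.
    by move=> k; have [_ [s s0 <-]] := sup_adherent n0 (hA k); exists s.
  rewrite -lerBlDr; apply: le_trans (sum_diff (fun k => (hs k).1)).
  apply: (@le_trans _ _ (\sum_(k < n) (v k - d / n.+1%:R))); last first.
    by apply: ler_sum => k _; rewrite ltW//; case: (hs k).
  rewrite sumrB sumr_const card_ord lerD2l lerN2 -[leLHS]mulr_natr mulrAC.
  by rewrite ler_pdivrMr// ler_wpM2l ?(ltW d0)// ler_nat.
- move=> k s; rewrite le_eqVlt => /predU1P[<-|s0].
    by rewrite scale0r L1diff0 mul0r.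
  rewrite -/(f k) aE ?(ltW s0)// lee_fin mulrC -ler_pdivrMr//.
  by apply: (ub_le_sup (hA k).2); exists s.
Qed.

End slices_variation.

Section cube_averages.
Context {R : realType} {N : nat}.
Local Notation E := 'rV[R]_N.
Local Notation lam := (rV_lebesgue R N).
Local Open Scope ereal_scope.
Variables (f : E -> R) (t r : R) (v : 'I_N -> R).
Hypothesis mf : measurable_fun [set: E] f.
Hypothesis f0 : forall x, (0 <= f x)%R.
Hypothesis r0 : (0 < r)%R.
Hypothesis t0 : (0 < t)%R.
Hypothesis v0 : forall i, (0 <= v i)%R.
Hypothesis fv : forall i s, (0 <= s)%R ->
  L1diff f (s *: delta_mx ord0 i)%R <= (s * v i)%:E.
Hypothesis avg : forall x, \int[lam]_(z in cube 0 r) (f (x + z)%R)%:E <= (r ^+ N * t / 2)%:E.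

Let Q : set E := cube 0 r.
Let mQ : measurable Q. Proof. exact: measurable_cube. Qed.
Let G (p : E * E) : \bar R := (`|f (p.1 + p.2)%R - f p.1| * \1_Q p.2)%:E.

Let madd : measurable_fun [set: E * E] (fun p : E * E => (p.1 + p.2)%R).
Proof.
apply: measurable_rVP => i.
rewrite (_ : _ \o _ = (fun p : E * E => rV_coord i p.1 + rV_coord i p.2)%R).
  by apply: measurable_funD; apply: measurableT_comp => //; exact: measurable_rV_coord.
by apply/funext => p; rewrite /rV_coord/= mxE.
Qed.

Let mG : measurable_fun [set: E * E] G.
Proof.
apply/measurable_EFinP; apply: measurable_funM.
  apply: measurableT_comp => //; apply: measurable_funB.
    exact: (measurableT_comp mf madd).
  by apply: measurableT_comp.
by apply: (measurableT_comp (measurable_indic mQ)).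
Qed.

Let G0 p : 0 <= G p. Proof. by rewrite lee_fin mulr_ge0// indicE. Qed.

Let L1diff_cube z : Q z -> L1diff f z <= (r * \sum_i v i)%:E.
Proof.
move=> Qz; rewrite (row_sum_delta z) (le_trans (L1diff_sum _ mf))//.
rewrite mulr_sumr -sumEFin; apply: lee_sum => i _.
have /andP[zi0 zir] := Qz i; rewrite !mxE in zi0 zir; rewrite add0r in zir.
by rewrite (le_trans (fv i zi0))// lee_fin ler_wpM2r.
Qed.

(** Tonelli turns the inner integral into [L1diff f z] for fixed [z] in the cube, where [z] is a sum
    of translations of length at most [r] along the axes. Integration over the cube adds its volume
    [r ^+ N]. *)
Let int_G : \int[lam]_x \int[lam]_z G (x, z) <= (r ^+ N * (r * \sum_i v i))%:E.
Proof.
rewrite (fubini_tonelli (m1 := lam) (m2 := lam) G mG G0)/=.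
apply: (@le_trans _ _ (\int[lam]_z ((r * \sum_i v i)%R%:E * (\1_Q z)%:E))).
  apply: ge0_le_integral => //.
  - by move=> z _; apply: integral_ge0 => x _; exact: G0.
  - exact: (measurable_fun_fubini_tonelli_G (m1 := lam) G mG G0).
  - by apply/measurable_EFinP/measurable_funM => //; exact: measurable_indic.
  - move=> z _; rewrite indicE; have [Qz|Qz] := boolP (z \in Q).
      rewrite mule1 (le_trans _ (L1diff_cube (set_mem Qz)))//.
      rewrite le_eqVlt; apply/orP; left; apply/eqP.
      by apply: eq_integral => x _; rewrite /G/= indicE Qz mulr1.
    by rewrite mule0 /G/=; under eq_integral do rewrite indicE (negbTE Qz) mulr0; rewrite integral0.
rewrite ge0_integralZl//; last 2 first.
- by apply/measurable_EFinP; exact: measurable_indic.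
- by rewrite lee_fin mulr_ge0 ?(ltW r0)// sumr_ge0.
rewrite integral_indic// setIT [X in _ * X](rV_lebesgue_cube _ (ltW r0)).
by rewrite -EFinM mulrC.
Qed.

(* Where [t <= f] while the cube average is at most [t / 2], the mean of
   [|f (x + z) - f x|] over the cube is at least [t / 2]. *)
Lemma cube_average_le :
  (t / 2)%:E * lam [set x | (t <= f x)%R] <= (r * \sum_i v i)%:E.
Proof.
pose A := [set x | (t <= f x)%R].
have mA : measurable A.
  rewrite (_ : A = f @^-1` `[t, +oo[%classic).
    by rewrite -[X in measurable X]setTI; exact: mf.
  by apply/seteqP; split => x /=; rewrite in_itv/= andbT.
have mH : measurable_fun [set: E] (fun x => \int[lam]_z G (x, z)).
  exact: (measurable_fun_fubini_tonelli_F (m2 := lam) G mG G0).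
have H0 x : 0 <= \int[lam]_z G (x, z).
  by apply: integral_ge0 => z _; exact: G0.
have rN : (0 < r ^+ N)%R by rewrite exprn_gt0.
have key x : A x -> (r ^+ N * t / 2)%:E <= \int[lam]_z G (x, z).
  move=> Ax.
  have mfx : measurable_fun [set: E] (fun z => f (x + z)%R).
    by under eq_fun do rewrite addrC; exact: measurable_shift.
  have GE : \int[lam]_z G (x, z) = \int[lam]_(z in Q) `|f (x + z)%R - f x|%:E.
    rewrite [RHS]integral_mkcond; apply: eq_integral => z _; rewrite patchE /G/= indicE.
    by case: ifPn; rewrite ?mulr1 ?mulr0.
  have h : (r ^+ N * t)%:E <= (r ^+ N * t / 2)%:E + \int[lam]_z G (x, z).
    apply: le_trans (leeD (avg x) (lexx _)).
    rewrite GE -ge0_integralD//; last 3 first.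
    - by move=> z _; rewrite lee_fin.
    - exact/measurable_EFinP/measurable_funTS.
    - apply/measurable_EFinP/measurable_funTS; apply: measurableT_comp => //.
      exact: measurable_funB.
    rewrite [leLHS](_ : _ = \int[lam]_(z in Q) t%:E); last first.
      by rewrite integral_cst// [X in _ * X](rV_lebesgue_cube _ (ltW r0)) -EFinM mulrC.
    apply: ge0_le_integral => //.
    - by move=> z _; rewrite lee_fin ltW.
    - apply: emeasurable_funD; apply/measurable_EFinP/measurable_funTS => //.
      by apply: measurableT_comp => //; exact: measurable_funB.
    - move=> z _; rewrite -EFinD lee_fin (le_trans Ax)//.
      by rewrite -lerBlDl distrC ler_norm.
  have [Hfin|] := boolP (\int[lam]_z G (x, z) \is a fin_num).
    rewrite -(fineK Hfin) lee_fin; move: h; rewrite -(fineK Hfin) -EFinD lee_fin; lra.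
  by rewrite ge0_fin_numE// -leNgt leye_eq => /eqP ->; rewrite leey.
have h2 : (r ^+ N * t / 2)%:E * lam A <= (r ^+ N * (r * \sum_i v i))%:E.
  apply: le_trans int_G; rewrite -integral_cst//.
  apply: (@le_trans _ _ (\int[lam]_(x in A) \int[lam]_z G (x, z))).
    apply: ge0_le_integral => //.
    - by move=> x _; rewrite lee_fin !mulr_ge0// ?ltW// invr_ge0.
    - exact: measurable_funTS.
  exact: ge0_subset_integral.
(* Finiteness follows from [h2] itself, and allows [r ^+ N] to be cancelled among real numbers. *)
have fin : lam A \is a fin_num.
  rewrite ge0_fin_numE// ltey; apply/eqP => Aoo; move: h2.
  by rewrite Aoo gt0_muley// lte_fin !mulr_gt0// invr_gt0.
rewrite -/A -(fineK fin) -EFinM lee_fin.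
move: h2; rewrite -(fineK fin) -EFinM lee_fin -!mulrA ler_pM2l//.
Qed.

End cube_averages.

Section level_recursion.
Context {R : realType}.

(* Either [m k.+1 <= m k / 4], and [c 2^k m^(p+1)] is halved, or [m k < 4 m k.+1],
   and one factor [m k.+1] cancels in the hypothesis. *)
Lemma level_recursion (p n : nat) (c : R) (m w : nat -> R) : 0 < c ->
  (forall k, 0 <= m k) -> (forall k, 0 <= w k) ->
  (forall k, c * 2 ^+ k * m k.+1 ^+ p.+2 <= 4 * m k * w k) ->
  \sum_(k < n) c * 2 ^+ k.+1 * m k.+1 ^+ p.+1 <=
    c * m 0%N ^+ p.+1 + 64 * \sum_(k < n) w k.
Proof.
move=> c0 m0 w0 h.
pose b k := c * 2 ^+ k * m k ^+ p.+1.
have b0 k : 0 <= b k by rewrite !mulr_ge0 ?exprn_ge0// ltW.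
have step k : b k.+1 <= b k / 2 + 32 * w k.
  have t0 : 0 < c * 2 ^+ k by rewrite mulr_gt0// exprn_gt0.
  have bE : b k.+1 = 2 * (c * 2 ^+ k) * m k.+1 ^+ p.+1 by rewrite /b exprS; ring.
  have [mle|mlt] := leP (m k.+1) (m k / 4).
    have le1 : m k.+1 ^+ p.+1 <= m k ^+ p.+1 / 4.
      apply: (@le_trans _ _ ((m k / 4) ^+ p.+1)).
        by rewrite lerXn2r// nnegrE// divr_ge0.
      rewrite expr_div_n ler_wpM2l ?exprn_ge0//.
      rewrite lef_pV2 ?posrE ?exprn_gt0//.
      by rewrite exprS ler_peMr// exprn_ege1//; lra.
    have : 2 * (c * 2 ^+ k) * m k.+1 ^+ p.+1 <= 2 * (c * 2 ^+ k) * (m k ^+ p.+1 / 4).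
      by rewrite ler_wpM2l// mulr_ge0// ltW.
    rewrite bE; have -> : b k = c * 2 ^+ k * m k ^+ p.+1 by [].
    by have := w0 k; lra.
  have mp : 0 < m k.+1 by apply: le_lt_trans mlt; rewrite divr_ge0.
  have : c * 2 ^+ k * m k.+1 ^+ p.+1 <= 16 * w k.
    rewrite -(ler_pM2r mp) -[leLHS]mulrA -exprSr (le_trans (h k))//.
    have : m k * w k <= 4 * m k.+1 * w k by rewrite ler_wpM2r//; lra.
    lra.
  by rewrite bE; have := b0 k; lra.
(* The additional [b n] makes the induction close: doubling [step] gives [2 b n.+1 <= b n + 64 w n],
   the origin of the constant 64. *)
have main : \sum_(k < n) b k.+1 + b n <= b 0%N + 64 * \sum_(k < n) w k.
  elim: n => [|n IH]; first by rewrite !big_ord0 mulr0 add0r addr0.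
  by rewrite !big_ord_recr/=; have := step n; lra.
have -> : c * m 0%N ^+ p.+1 = b 0%N by rewrite /b expr0 mulr1.
by apply: le_trans main; rewrite lerDl.
Qed.

Lemma dyadic_scale (rho : R) : 0 < rho -> exists j : int, rho <= 2 ^ j /\ 2 ^ j < 2 * rho.
Proof.
have grow (x : R) : exists n, x <= 2 ^+ n.
  exists (Num.bound x); have [x0|x0] := leP 0 x; last first.
    by rewrite (le_trans (ltW x0))// exprn_ge0.
  apply: le_trans (ltW (archi_boundP x0)) _.
  by rewrite -natrX ler_nat ltnW// ltn_expl.
move=> r0; have [r1|r1] := leP 1 rho.
  have ex : exists n, rho <= 2 ^+ n by exact: grow.
  case: (ex_minnP ex) => -[|n] hn min.
    by exists 0; rewrite expr0z; rewrite expr0 in hn; split => //; lra.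
  exists n.+1%:Z; split=> //; have [/min|h] := leP rho (2 ^+ n); first by rewrite ltnn.
  by rewrite -exprnP exprS; lra.
have ex : exists n, rho^-1 < 2 ^+ n.
  have [n hn] := grow (rho^-1 + 1); exists n; lra.
case: (ex_minnP ex) => -[|n] hn min.
  move: hn; rewrite expr0 ltNge => /negP; case.
  by rewrite -[leLHS]invr1 lef_pV2 ?posrE// ltW.
have hn' : 2 ^+ n <= rho^-1.
  by have [//|/min] := leP (2 ^+ n) rho^-1; rewrite ltnn.
have P0 : 0 < 2 ^+ n :> R by rewrite exprn_gt0.
exists (- n%:Z); rewrite -exprnN; split.
  by rewrite -[leLHS]invrK lef_pV2 ?posrE ?invr_gt0.
rewrite -[ltLHS]mul1r ltr_pdivrMr// mulrAC -exprS mulrC -ltr_pdivrMr// mul1r.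
by rewrite -[ltRHS]invrK ltf_pV2 ?posrE ?invr_gt0 ?exprn_gt0.
Qed.

End level_recursion.

(** * Estimates for superlevel sets *)

Section weak_estimates.
Context {R : realType} {N : nat}.
Local Notation E := 'rV[R]_N.
Local Notation lam := (rV_lebesgue R N).
Variables (u : E -> R) (V : R).
Hypothesis N2 : (2 <= N)%N.
Hypothesis mu : measurable_fun [set: E] u.
Hypothesis uV : forall i h, 0 <= h -> (L1diff u (h *: delta_mx ord0 i) <= (h * V)%:E)%E.
Hypothesis u_fin : forall l, 0 < l -> (lam [set x | (l < `|u x|)%R] < +oo)%E.

Definition level_measure (l : R) : R := fine (lam [set x | (l < `|u x|)%R]).
(** Side of a cube with the volume of the superlevel set. It turns the exponent (N-1)/N into the
    integer power [N.-1], and is the natural scale for averaging. *)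
Definition level_root (l : R) : R := level_measure l `^ N%:R^-1.
Local Notation M := level_measure.
Local Notation m := level_root.

Let msup l : measurable [set x | l < `|u x|].
Proof. exact: measurable_superlevel. Qed.

Let ME l : 0 < l -> lam [set x | l < `|u x|] = (M l)%:E.
Proof. by move=> l0; rewrite /M fineK// ge0_fin_numE//; exact: u_fin. Qed.

Lemma level_measure_ge0 l : 0 <= M l. Proof. exact: fine_ge0. Qed.

Lemma level_root_ge0 l : 0 <= m l. Proof. exact: powR_ge0. Qed.

Lemma level_rootX l : m l ^+ N = M l.
Proof.
rewrite /m -powR_mulrn ?powR_ge0// -powRrM mulVf ?pnatr_eq0 -?lt0n ?(ltnW N2)//.
by rewrite powRr1// level_measure_ge0.
Qed.

Lemma le_level_measure l k : 0 < l -> l <= k -> M k <= M l.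
Proof.
move=> l0 lk; rewrite -lee_fin -(ME l0) -(ME (lt_le_trans l0 lk)).
by apply: le_measure; rewrite ?inE// => x /=; exact: le_lt_trans.
Qed.

Lemma le_level_root l k : 0 < l -> l <= k -> m k <= m l.
Proof.
move=> l0 lk; apply: ge0_ler_powR; rewrite ?nnegrE ?level_measure_ge0 ?invr_ge0//.
exact: le_level_measure.
Qed.

Section one_slice.
Variables (a b r : R) (v : 'I_N -> R).
Hypothesis a0 : 0 < a.
Hypothesis ab : a < b.
Hypothesis r0 : 0 < r.
Hypothesis v0 : forall i, 0 <= v i.
Hypothesis uv : forall i s, 0 <= s ->
  (L1diff (fun x => slice a b (u x)) (s *: delta_mx ord0 i) <= (s * v i)%:E)%E.

Let ms : measurable_fun [set: E] (fun x => slice a b (u x)).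
Proof. exact: (measurableT_comp (measurable_slice _ _) mu). Qed.

Lemma slice_average :
  (forall x, \int[lam]_(z in cube 0 r) (slice a b (u (x + z)))%:E <=
     (r ^+ N * (b - a) / 2)%:E)%E ->
  (b - a) / 2 * M b <= r * \sum_i v i.
Proof.
move=> avg; have t0 : 0 < b - a by rewrite subr_gt0.
have b0 : 0 < b by exact: lt_trans ab.
have := @cube_average_le R N (fun x => slice a b (u x)) (b - a) r v ms
  (fun x => slice_ge0 _ (ltW ab)) r0 t0 v0 uv avg.
move=> h; rewrite -lee_fin EFinM -(ME b0); apply: le_trans h.
rewrite lee_wpmul2l// ?lee_fin ?divr_ge0 ?(ltW t0)//.
apply: le_measure; rewrite ?inE//.
  rewrite (_ : mkset _ = (fun x => slice a b (u x)) @^-1` `[b - a, +oo[%classic).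
    by rewrite -[X in measurable X]setTI; exact: ms.
  by apply/seteqP; split => x /=; rewrite in_itv/= andbT.
by move=> x /= bx; rewrite slice_high// ltW.
Qed.

Lemma slice_integral x :
  (\int[lam]_z (slice a b (u (x + z)))%:E <= ((b - a) * M a)%:E)%E.
Proof.
under eq_integral do rewrite addrC.
have me : measurable_fun [set: E] (fun x => (slice a b (u x))%:E) by exact/measurable_EFinP.
rewrite (integral_rV_translate x me) EFinM -(ME a0).
have mI := measurable_indic (R:=R) (msup a).
have -> : lam [set x | a < `|u x|] = (\int[lam]_z (\1_[set x | a < `|u x|] z)%:E)%E.
  by rewrite integral_indic// setIT.
rewrite -ge0_integralZl//; last 2 first.
- exact/measurable_EFinP.
- by rewrite lee_fin subr_ge0 ltW.
apply: ge0_le_integral => //.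
- by move=> z _; rewrite lee_fin slice_ge0// ltW.
- by apply: emeasurable_funM => //; exact/measurable_EFinP.
- move=> z _; rewrite -EFinM lee_fin indicE; have [az|az] := ltP a `|u z|.
    by rewrite mem_set//= mulr1 slice_le// ltW.
  rewrite slice_low ?(ltW ab)// memNset ?mulr0//=.
  by apply/negP; rewrite -leNgt.
Qed.

End one_slice.

Let N0 : (0 < N)%N. Proof. exact: ltnW. Qed.

Let V_ge0 : 0 <= V.
Proof.
have := le_trans (L1diff_ge0 u (1 *: delta_mx ord0 (Ordinal N0))) (uV (Ordinal N0) ler01).
by rewrite lee_fin mul1r.
Qed.

(** A cube of side [2 * m a] has volume at least [2 * M a], while the slice has integral at most
    [(b - a) * M a]; its averages are therefore at most half its height and [slice_average] applies.
    If [m a = 0] there is no such cube, but both sides vanish. *)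
Let slices_step (a b : R) (v : 'I_N -> R) : 0 < a -> a < b -> (forall i, 0 <= v i) ->
  (forall i s, 0 <= s ->
    (L1diff (fun x => slice a b (u x)) (s *: delta_mx ord0 i) <= (s * v i)%:E)%E) ->
  (b - a) * m b ^+ N <= 4 * m a * \sum_i v i.
Proof.
move=> a0 ab v0 uv; have b0 := lt_trans a0 ab.
have [ma0|ma0] := leP (m a) 0.
  have ma : m a = 0 by apply/eqP; rewrite eq_le ma0 level_root_ge0.
  have -> : m b = 0.
    by apply/eqP; rewrite eq_le level_root_ge0 -ma le_level_root// ltW.
  by rewrite expr0n -leqn0 leqNgt N0 mulr0 ma !(mulr0, mul0r).
have r0 : 0 < 2 * m a by lra.
have := @slice_average a b (2 * m a) v a0 ab r0 v0 uv.
rewrite level_rootX => h.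
suff : (b - a) / 2 * M b <= 2 * m a * \sum_i v i by lra.
apply: h => x.
apply: (@le_trans _ _ (\int[lam]_z (slice a b (u (x + z)))%:E)%E).
  apply: ge0_subset_integral => //.
  - exact: measurable_cube.
  - apply/measurable_EFinP; apply: (measurableT_comp (measurable_slice _ _)).
    by under eq_fun do rewrite addrC; exact: measurable_shift.
  - by move=> z _; rewrite lee_fin slice_ge0// ltW.
apply: le_trans (slice_integral a0 ab x) _.
rewrite lee_fin exprMn level_rootX.
have : 2 * 1 <= 2 ^+ N :> R.
  by case: (N) N0 => // n _; rewrite exprS ler_wpM2l// exprn_ege1//; lra.
have := level_measure_ge0 a; have : 0 < b - a by rewrite subr_gt0.
set d := b - a; set A := M a; set P := 2 ^+ N => d0 A0 P2.
have : 0 <= A * d * (P - 2).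
  by apply: mulr_ge0; [apply: mulr_ge0 => //; exact: ltW|lra].
lra.
Qed.

(** The levels [d + c 2^k] have increments [c 2^k], so [slices_step] takes the form required by
    [level_recursion] with [p = N.-2]. The offset [d] keeps the first level away from 0, where the
    measures may blow up. *)
Let strong_estimate_shift (d c : R) n : 0 < d -> 0 < c ->
  \sum_(k < n) c * 2 ^+ k.+1 * m (d + c * 2 ^+ k.+1) ^+ N.-1 <=
    c * m (d + c) ^+ N.-1 + 64 * (N%:R * V).
Proof.
move=> d0 c0.
pose l k := d + c * 2 ^+ k.
have lS k : l k < l k.+1.
  rewrite ltrD2l ltr_pM2l// exprS ltr_pMl ?exprn_gt0//; lra.
have hl : {homo l : i j / (i <= j)%N >-> i <= j}.
  by apply/nondecreasing_seqP => k; exact: ltW.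
have l0 k : 0 < l k by rewrite addr_gt0// mulr_gt0// exprn_gt0.
have /choice[v hv] i := slices_variation mu (uV i) n hl.
pose w k := \sum_i v i k.
have w0 k : 0 <= w k by apply: sumr_ge0 => i _; case: (hv i).
have wV : \sum_(k < n) w k <= N%:R * V.
  rewrite exchange_big/= (le_trans (ler_sum _ (G := fun=> V) _))//.
    by move=> i _; case: (hv i).
  by rewrite sumr_const card_ord mulr_natl.
have NE : N = N.-2.+2 by case: (N) N2 => // -[].
have step k : c * 2 ^+ k * m (l k.+1) ^+ N.-2.+2 <= 4 * m (l k) * w k.
  rewrite -NE.
  have -> : c * 2 ^+ k = l k.+1 - l k by rewrite /l exprS; ring.
  apply: slices_step => //; first by move=> i; case: (hv i).
  by move=> i s s0; case: (hv i) => _ _; exact.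
have := @level_recursion R N.-2 n c (m \o l) w c0 (fun k => level_root_ge0 _) w0 step.
have -> : N.-2.+1 = N.-1 by rewrite {2}NE.
have -> : (m \o l) 0%N = m (d + c) by rewrite /= /l expr0 mulr1.
by move/le_trans; apply; rewrite lerD2l; lra.
Qed.

(** The shifted estimate is used with [d = a] and [c = a / 2 ^+ J.+1]. Its term of index [J + k] has
    level [a + a 2^k], which is at most [a 2^(k+1)], and its initial term is at most
    [c * m a ^+ N.-1], which tends to 0 as [J] grows. *)
Lemma strong_estimate (a : R) n : 0 < a ->
  \sum_(k < n) a * 2 ^+ k * m (a * 2 ^+ k.+1) ^+ N.-1 <= 64 * (N%:R * V).
Proof.
move=> a0.
have bound J : \sum_(k < n) a * 2 ^+ k * m (a * 2 ^+ k.+1) ^+ N.-1 <=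
    (a / 2 ^+ J.+1) * m a ^+ N.-1 + 64 * (N%:R * V).
  have P0 : 0 < 2 ^+ J.+1 :> R by rewrite exprn_gt0.
  have c0 : 0 < a / 2 ^+ J.+1 by rewrite divr_gt0.
  apply: (@le_trans _ _ ((a / 2 ^+ J.+1) * m (a + a / 2 ^+ J.+1) ^+ N.-1 + 64 * (N%:R * V))); last first.
    rewrite lerD2r ler_wpM2l ?(ltW c0)// lerXn2r ?nnegrE ?level_root_ge0//.
    by rewrite le_level_root// lerDl ltW.
  apply: le_trans (strong_estimate_shift (J + n) a0 c0).
  rewrite big_split_ord/= -[leLHS]add0r lerD//.
    by apply: sumr_ge0 => k _; rewrite !mulr_ge0 ?exprn_ge0 ?level_root_ge0// ltW.
  apply: ler_sum => k _.
  have -> : a / 2 ^+ J.+1 * 2 ^+ (J + k).+1 = a * 2 ^+ k.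
    by rewrite -addSn exprD mulrA divfK// gt_eqF.
  have k0 : 0 < a * 2 ^+ k by rewrite mulr_gt0// exprn_gt0.
  rewrite ler_wpM2l ?(ltW k0)// lerXn2r ?nnegrE ?level_root_ge0//.
  rewrite le_level_root ?addr_gt0// exprS.
  have : a <= a * 2 ^+ k by rewrite ler_peMr ?(ltW a0)// exprn_ege1//; lra.
  lra.
apply/ler_addgt0Pr => e e0.
pose X := a * m a ^+ N.-1.
have X0 : 0 <= X by rewrite mulr_ge0 ?exprn_ge0 ?level_root_ge0 ?(ltW a0).
pose J := Num.bound (X / e).
apply: le_trans (bound J) _; rewrite addrC lerD2l mulrAC -/X.
rewrite ler_pdivrMr ?exprn_gt0// mulrC -ler_pdivrMr//.
apply: le_trans (ltW (archi_boundP _)) _; first by rewrite divr_ge0// ltW.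
rewrite -natrX ler_nat (leq_trans _ (ltnW (ltn_expl _ _)))//.
Qed.

(** The hypothesis is a Morrey bound on dyadic cubes. With [rho ^+ N.-1 = 2 * e / l] and a dyadic
    side between [rho] and [2 * rho], the averages of the slice between [l] and [2 * l] are at most
    [l / 2], so [slice_average] bounds [l * M (2 * l)] by [4 N V rho]. The power [N.-1] of this
    eliminates [rho]. *)
Lemma morrey_estimate (e l : R) : 0 < e -> 0 < l ->
  (forall (j : int) x,
    (\int[lam]_(z in cube 0 (2 ^ j)) `|u (x + z)|%:E <= (e * 2 ^ j)%:E)%E) ->
  (l * m (2 * l) ^+ N.-1) ^+ N <= 2 * e * (4 * (N%:R * V)) ^+ N.-1.
Proof.
move=> e0 l0 morrey.
pose q := 2 * e / l; have q0 : 0 < q by rewrite divr_gt0// mulr_gt0.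
pose rho := q `^ N.-1%:R^-1; have rho0 : 0 < rho by exact: powR_gt0.
have N1 : (0 < N.-1)%N by case: (N) N2 => // -[].
have rhoX : rho ^+ N.-1 = q.
  rewrite /rho -powR_mulrn ?powR_ge0// -powRrM mulVf ?pnatr_eq0 -?lt0n//.
  by rewrite powRr1// ltW.
have [j [j1 /ltW j2]] := dyadic_scale rho0.
have r0 : 0 < 2 ^ j :> R by exact: exprz_gt0.
have l2 : l < 2 * l by lra.
have lM : l * M (2 * l) <= rho * (4 * (N%:R * V)).
  have := @slice_average l (2 * l) (2 ^ j) (fun=> V) l0 l2 r0 (fun=> V_ge0).
  have -> : \sum_(i < N) V = N%:R * V by rewrite sumr_const card_ord mulr_natl.
  move=> h.
  have : (2 * l - l) / 2 * M (2 * l) <= 2 ^ j * (N%:R * V).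
    apply: h.
      move=> i s s0; apply: le_trans (uV i s0); apply: le_L1diff => //.
        exact: (measurableT_comp (measurable_slice _ _) mu).
      by move=> x y; apply: slice_lip; exact: ltW.
    move=> x.
    have mux : measurable_fun [set: E] (fun z => u (x + z)).
      by under eq_fun do rewrite addrC; exact: measurable_shift.
    have mcube := @measurable_cube R N 0 (2 ^ j).
    apply: (@le_trans _ _ (\int[lam]_(z in cube 0 (2 ^ j)) `|u (x + z)|%:E)%E).
      apply: ge0_le_integral => //.
      - by move=> z _; rewrite lee_fin slice_ge0// ltW.
      - apply/measurable_EFinP/measurable_funTS.
        exact: (measurableT_comp (measurable_slice _ _) mux).
      - by apply/measurable_EFinP/measurable_funTS; exact: measurableT_comp.
      - by move=> z _; rewrite lee_fin slice_le_norm// ltW.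
    apply: (le_trans (morrey j x)); rewrite lee_fin.
    have rX : q <= (2 ^ j) ^+ N.-1.
      by rewrite -rhoX lerXn2r// nnegrE ltW.
    have -> : (2 ^ j : R) ^+ N = 2 ^ j * (2 ^ j) ^+ N.-1.
      by rewrite -exprS prednK.
    have -> : 2 * l - l = l by lra.
    have -> : e = q * l / 2 by rewrite /q; field; exact: lt0r_neq0.
    move: rX r0; set P := 2 ^ j; set X := P ^+ N.-1 => rX r0.
    have : q * (l / 2 * P) <= X * (l / 2 * P).
      by rewrite ler_wpM2r// mulr_ge0 ?(ltW r0)// divr_ge0// ltW.
    lra.
  have -> : (2 * l - l) / 2 * M (2 * l) = l * M (2 * l) / 2 by lra.
  rewrite ler_pdivrMr// => /le_trans; apply.
  have : 2 ^ j * (N%:R * V) <= 2 * rho * (N%:R * V).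
    by rewrite ler_wpM2r// mulr_ge0.
  lra.
have -> : (l * m (2 * l) ^+ N.-1) ^+ N = l * (l * M (2 * l)) ^+ N.-1.
  rewrite exprMn -exprM mulnC exprM level_rootX.
  rewrite -{1}(prednK N0) exprS -mulrA -exprMn//.
apply: (@le_trans _ _ (l * (rho * (4 * (N%:R * V))) ^+ N.-1)).
  rewrite ler_wpM2l ?(ltW l0)// lerXn2r// nnegrE.
    by rewrite mulr_ge0 ?(ltW l0)// level_measure_ge0.
  by rewrite !mulr_ge0// ltW.
rewrite exprMn rhoX [leLHS]mulrA (_ : l * q = 2 * e)//.
by rewrite /q mulrC divfK// gt_eqF.
Qed.

End weak_estimates.

(** * Lorentz norms *)

Section lorentz_bound.
Context {R : realType}.
Local Notation leb1 := (@lebesgue_measure R).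

(** The integral of a nonnegative function is a supremum over the simple functions below it, hence
    monotone without measurability. Integrals of rearrangements and of dilated functions are
    compared in this way. *)
Lemma ge0_le_integral_nonmeasurable d (T : measurableType d) (m : {measure set T -> \bar R})
    (D : set T) (f g : T -> \bar R) :
  (forall x, D x -> (0 <= f x)%E) -> (forall x, D x -> (f x <= g x)%E) ->
  (\int[m]_(x in D) f x <= \int[m]_(x in D) g x)%E.
Proof.
move=> f0 fg; rewrite !ge0_integralE//; last first.
  by move=> x Dx; rewrite (le_trans (f0 x Dx)) ?fg.
apply: le_ereal_sup => _ [h hf <-]; exists h => // x.
apply: (le_trans (hf x)); rewrite !patchE; case: ifPn => // /set_mem; exact: fg.
Qed.

(** For [s < 1] the integrand is unbounded at 0, so the primitive [t^s / s] is used on intervals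
    from [c / n.+2] to [c], which exhaust the domain; [n.+2] keeps them nondegenerate. *)
Lemma integral_powR_le (s c : R) : 0 < s -> 0 <= c ->
  (\int[leb1]_(t in `]0%R, c[) (t `^ (s - 1))%:E <= (c `^ s / s)%:E)%E.
Proof.
move=> s0; rewrite le_eqVlt => /predU1P[<-|c0].
  by rewrite set_itvoo0 integral_set0 lee_fin divr_ge0 ?powR_ge0// ltW.
pose F n : set R := `[c / n.+2%:R, c]%classic.
have f0 t : (0 <= (t `^ (s - 1))%:E)%E by rewrite lee_fin powR_ge0.
have mf : measurable_fun [set: R] (fun t : R => (t `^ (s - 1))%:E).
  by apply/measurable_EFinP; exact: measurable_powR.
have mF n : measurable (F n) by exact: measurable_itv.
have mUF : measurable (\bigcup_n F n) by exact: bigcupT_measurable.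
apply: (@le_trans _ _ (\int[leb1]_(t in \bigcup_n F n) (t `^ (s - 1))%:E)%E).
  apply: ge0_subset_integral => //; first exact: measurable_funTS.
  move=> t; rewrite /= in_itv/= => /andP[t0 tc].
  exists (Num.bound (c / t)) => //; rewrite /F/= in_itv/= (ltW tc) andbT.
  rewrite ler_pdivrMr// mulrC -ler_pdivrMr// (le_trans (ltW (archi_boundP _)))//.
    by rewrite divr_ge0// ltW.
  by rewrite ler_nat -addn2 leq_addr.
have ndF : nondecreasing_seq F.
  move=> i j ij; apply/subsetPset => t; rewrite /F/= !in_itv/= => /andP[h ->].
  rewrite andbT; apply: le_trans h.
  by rewrite ler_pM2l// lef_pV2 ?posrE// ler_nat !ltnS.
have cvgF : (\int[leb1]_(t in F n) (t `^ (s - 1))%:E @[n --> \oo] -->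
    \int[leb1]_(t in \bigcup_n F n) (t `^ (s - 1))%:E)%E.
  by apply: ge0_nondecreasing_set_cvg_integral => // n; exact: measurable_funTS.
rewrite -(cvg_lim _ cvgF)//; apply: lime_le; first by apply/cvg_ex; eexists; exact: cvgF.
apply: nearW => n.
have a0 : 0 < c / n.+2%:R by rewrite divr_gt0.
have ac : c / n.+2%:R < c by rewrite ltr_pdivrMr// ltr_pMr// ltr1n.
pose G (t : R) := s^-1 * t `^ s.
have dG (t : R) : 0 < t -> is_derive t 1 G (t `^ (s - 1)).
  move=> t0; have := is_deriveZ s^-1 (is_derive1_powR s t0).
  by rewrite /GRing.scale/= mulrA mulVf ?gt_eqF// mul1r.
have cG (t : R) : 0 < t -> {for t, continuous G}.
  move=> t0; apply: differentiable_continuous; apply/derivable1_diffP.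
  by case: (dG t t0).
have cf (t : R) : 0 < t -> {for t, continuous (fun t : R => t `^ (s - 1))}.
  move=> t0; apply: differentiable_continuous; apply/derivable1_diffP.
  by case: (is_derive1_powR (s - 1) t0).
rewrite (@continuous_FTC2 _ _ G)//.
- rewrite -EFinB lee_fin (_ : c `^ s / s = G c); last by rewrite /G mulrC.
  by rewrite gerBl mulr_ge0 ?powR_ge0// invr_ge0 ltW.
- apply: continuous_in_subspaceT => t; rewrite inE/= in_itv/= => /andP[t1 _].
  by apply: cf; exact: lt_le_trans t1.
- split.
  + by move=> t; rewrite in_itv/= => /andP[t1 _]; case: (dG t (lt_trans a0 t1)).
  + by apply: cvg_at_right_filter; exact: cG.
  + by apply: cvg_at_left_filter; exact: cG.
- move=> t; rewrite in_itv/= => /andP[t1 _].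
  by rewrite derive1E; case: (dG t (lt_trans a0 t1)).
Qed.

Variables (p q A B : R) (mu : R -> R) (rho : R -> \bar R).
Hypothesis p0 : 0 < p.
Hypothesis q1 : 1 < q.
Hypothesis mu_ge0 : forall l, 0 <= mu l.
Let kappa l := mu l `^ p^-1.
Hypothesis sumA : forall a n, 0 < a -> \sum_(k < n) a * 2 ^+ k * kappa (a * 2 ^+ k.+1) <= A.
Hypothesis supB : forall l, 0 < l -> l * kappa (2 * l) <= B.
Hypothesis rho_ge0 : forall t, (0 <= rho t)%E.
Hypothesis rho_gt : forall t l, 0 < l -> (l%:E < rho t)%E -> t < mu l.

Let B_ge0 : 0 <= B.
Proof. by apply: le_trans (supB ltr01); rewrite mul1r powR_ge0. Qed.

Let rho_fin t : 0 < t -> exists r : R, 0 <= r /\ rho t = r%:E.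
Proof.
move=> t0; have P0 : 0 < t `^ p^-1 by exact: powR_gt0.
(* If [rho t] exceeded [2 * l], then [t < mu (2 * l)], and [supB] would give [B + 1 <= B]. *)
pose l := (B + 1) / t `^ p^-1.
have l0 : 0 < l by rewrite divr_gt0//; have := B_ge0; lra.
have l20 : 0 < 2 * l by lra.
have : (rho t <= (2 * l)%:E)%E.
  rewrite leNgt; apply/negP => /(rho_gt l20) tm.
  have := supB l0; apply/negP; rewrite -ltNge.
  apply: (@lt_le_trans _ _ (l * t `^ p^-1)); first by rewrite /l divfK ?gt_eqF//; lra.
  rewrite ler_pM2l//; apply: ge0_ler_powR; rewrite ?nnegrE ?invr_ge0 ?mu_ge0 ?ltW//.
move: (rho_ge0 t); case: (rho t) => [r||] //=.
by rewrite lee_fin => r0 _; exists r.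
Qed.

Let q0 : 0 < q. Proof. exact: lt_trans q1. Qed.

Let s := q / p.
Let s0 : 0 < s. Proof. exact: divr_gt0. Qed.

(* Cuts the range of [rho] into the dyadic layers between [2 ^- L] and [2 ^ L]. *)
Let layers (L : nat) (t : R) : R :=
  \sum_(k < L.*2) (2 ^- L * 2 ^+ k.+2) `^ q * (t `^ (s - 1) * \1_(`]0, mu (2 ^- L * 2 ^+ k.+1)[%classic) t).

Let dyadic_layer (r : R) : 0 < r -> \forall L \near \oo, exists2 k : nat, (k < L.*2)%N &
  2 ^- L * 2 ^+ k.+1 < r <= 2 ^- L * 2 ^+ k.+2.
Proof.
move=> r0; have [j [rj jr]] := dyadic_scale r0.
exists (`|j| + 2)%N => // L /= hL.
(* Since [2 ^ (j - 1) < r <= 2 ^ j], the index solves [k + 2 = j + L]; the condition [L >= |j| + 2]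
   places it between 0 and [L.*2]. *)
pose k := (absz (j + L%:Z)).-2.
have kE : k.+2%:Z = j + L%:Z by rewrite /k; lia.
have e : 2 ^- L * 2 ^+ k.+2 = 2 ^ j :> R.
  rewrite (exprnP 2 k.+2) kE expfzDr ?pnatr_eq0// -(exprnP 2 L) mulrC -mulrA.
  by rewrite mulfV ?mulr1// expf_neq0 ?pnatr_eq0.
exists k; first by lia.
by rewrite e rj andbT -(ltr_pM2l (ltr0n R 2)) mulrCA -exprS e.
Qed.

Let layers_ge t : 0 < t -> \forall L \near \oo,
  ((rho t * (t `^ p^-1)%:E) `^ q * (t^-1)%:E <= (layers L t)%:E)%E.
Proof.
move=> t0; have [r [r0 rE]] := rho_fin t0.
have lay0 L k : 0 <= (2 ^- L * 2 ^+ k.+2) `^ q * (t `^ (s - 1) * \1_(`]0, mu (2 ^- L * 2 ^+ k.+1)[%classic) t).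
  by rewrite mulr_ge0 ?powR_ge0// mulr_ge0 ?powR_ge0// indicE.
have -> : ((rho t * (t `^ p^-1)%:E) `^ q * (t^-1)%:E = ((r * t `^ p^-1) `^ q * t^-1)%:E)%E.
  by rewrite rE EFinM -poweR_EFin.
have qn0 : q != 0 by rewrite gt_eqF.
move: r0; rewrite le_eqVlt => /predU1P[r0|r0].
  apply: nearW => L; rewrite -r0 mul0r powR0// mul0r lee_fin sumr_ge0//.
have -> : (r * t `^ p^-1) `^ q * t^-1 = r `^ q * t `^ (s - 1).
  rewrite powRM ?powR_ge0 ?(ltW r0)// -mulrA; congr (_ * _).
  have -> : s - 1 = p^-1 * q + - 1 by rewrite /s mulrC.
  rewrite powRD; last by rewrite (gt_eqF t0) implybT.
  by rewrite powRrM powR_inv1 ?(ltW t0).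
near=> L; rewrite lee_fin.
have [k kL /andP[lr rl]] : exists2 k : nat, (k < L.*2)%N &
  2 ^- L * 2 ^+ k.+1 < r <= 2 ^- L * 2 ^+ k.+2 by near: L; exact: dyadic_layer.
rewrite /layers (bigD1 (Ordinal kL))//= -[leLHS]addr0 lerD ?sumr_ge0//.
have l0 : 0 < 2 ^- L * 2 ^+ k.+1 :> R by rewrite mulr_gt0 ?invr_gt0 ?exprn_gt0.
have tm : t < mu (2 ^- L * 2 ^+ k.+1) by apply: rho_gt => //; rewrite rE lte_fin.
rewrite indicE mem_set ?mulr1/=; last by rewrite in_itv/= t0.
rewrite ler_wpM2r ?powR_ge0//.
by apply: ge0_ler_powR; rewrite ?nnegrE ?(ltW r0) ?(ltW q0).
Unshelve. all: by end_near. Qed.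

(** As [s = q / p], a layer contributes the q-th power of [4 * b k], divided by [s]. Then
    [b^q <= B^(q-1) b] trades all but one power for the supremum bound, and what remains sums to at
    most [A]. Here [q > 1] lets a small [B] produce a small norm. *)
Let int_layers L : (\int[leb1]_(t in `]0%R, +oo[) (layers L t)%:E <=
  (4 `^ q / s * (B `^ (q - 1) * A))%:E)%E.
Proof.
have mt : measurable_fun [set: R] (fun t : R => t `^ (s - 1)) by exact: measurable_powR.
have mI (c : R) : measurable_fun [set: R] (\1_(`]0, c[%classic) : R -> R).
  by apply: measurable_indic; exact: measurable_itv.
under eq_integral do rewrite /layers -sumEFin.
rewrite ge0_integral_sum//; last first.
- by move=> k t _; rewrite lee_fin mulr_ge0 ?powR_ge0// mulr_ge0 ?powR_ge0// indicE.
- move=> k; apply/measurable_EFinP/measurable_funTS.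
  by apply: measurable_funM => //; apply: measurable_funM.
pose a : R := 2 ^- L; have a0 : 0 < a by rewrite invr_gt0 exprn_gt0.
pose b k := a * 2 ^+ k * kappa (a * 2 ^+ k.+1).
have b0 k : 0 <= b k by rewrite !mulr_ge0 ?powR_ge0 ?exprn_ge0 ?(ltW a0).
have bB k : b k <= B.
  have -> : b k = a * 2 ^+ k * kappa (2 * (a * 2 ^+ k)) by rewrite /b exprS mulrCA.
  by apply: supB; rewrite mulr_gt0 ?exprn_gt0.
apply: (@le_trans _ _ (\sum_(k < L.*2) (4 `^ q / s * (B `^ (q - 1) * b k))%:E)%E); last first.
  rewrite sumEFin lee_fin -!mulr_sumr; apply: ler_wpM2l.
    by rewrite divr_ge0 ?powR_ge0 ?(ltW s0).
  by apply: ler_wpM2l; [exact: powR_ge0|exact: sumA].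
apply: lee_sum => k _.
under eq_integral do rewrite EFinM.
rewrite ge0_integralZl//; last 2 first.
- by apply/measurable_EFinP/measurable_funTS; exact: measurable_funM.
- by move=> t _; rewrite lee_fin mulr_ge0 ?powR_ge0// indicE.
rewrite -/a; set l := a * 2 ^+ k.+1.
have -> : a * 2 ^+ k.+2 = 2 * l by rewrite /l exprS mulrCA.
have -> : (\int[leb1]_(t in `]0%R, +oo[) (t `^ (s - 1) * \1_(`]0, mu l[%classic) t)%:E =
   \int[leb1]_(t in `]0%R, mu l[) (t `^ (s - 1))%:E)%E.
  rewrite [RHS]integral_mkcond [LHS]integral_mkcond; apply: eq_integral => t _.
  rewrite !patchE indicE; case: ifPn => [/set_mem|/negP].
    by move=> _; case: ifPn => _; rewrite ?mulr1 ?mulr0.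
  rewrite inE/= in_itv/= andbT => /negP t0; rewrite ifF//.
  by apply/negbTE/negP; rewrite inE/= in_itv/= (negbTE t0).
apply: (@le_trans _ _ (((2 * l) `^ q)%:E * (mu l `^ s / s)%:E)%E).
  by rewrite lee_wpmul2l ?lee_fin ?powR_ge0// integral_powR_le.
rewrite -EFinM lee_fin [leLHS]mulrA [leRHS]mulrAC; apply: ler_wpM2r.
  by rewrite invr_ge0 ltW.
have l0 : 0 <= 2 * l by rewrite !mulr_ge0 ?exprn_ge0 ?(ltW a0).
have -> : mu l `^ s = kappa l `^ q by rewrite /kappa -powRrM mulrC.
rewrite -powRM ?powR_ge0//.
have -> : 2 * l * kappa l = 4 * b k by rewrite /b -/l {1}/l exprS; ring.
rewrite powRM//; apply: ler_wpM2l; first exact: powR_ge0.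
have [->|bk0] := eqVneq (b k) 0.
  by rewrite powR0 ?mulr0// gt_eqF.
have -> : b k `^ q = b k `^ (q - 1) * b k.
  rewrite -{3}[b k]powRr1// -powRD; last by rewrite bk0 implybT.
  by rewrite subrK.
apply: ler_wpM2r; first exact: b0.
by apply: ge0_ler_powR; rewrite ?nnegrE ?subr_ge0 ?(ltW q1) ?b0 ?B_ge0 ?bB.
Qed.

(** For fixed [L] the layers capture a bounded range of values of [rho] only, but every [t] is
    covered once [L] is large; as the bound on the layers does not depend on [L], Fatou's lemma
    concludes. *)
Lemma lorentz_bound :
  (\int[leb1]_(t in `]0%R, +oo[) ((rho t * (t `^ p^-1)%:E) `^ q * (t^-1)%:E) <=
   (4 `^ q / s * (B `^ (q - 1) * A))%:E)%E.
Proof.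
apply: (@le_trans _ _ (\int[leb1]_(t in `]0%R, +oo[)
    limn_einf (fun L => (layers L t)%:E))%E).
  apply: ge0_le_integral_nonmeasurable => t; rewrite /= in_itv/= andbT => t0.
    by rewrite mule_ge0 ?poweR_ge0// lee_fin invr_ge0 ltW.
  rewrite limn_einf_lim; apply: lime_ge; first exact: is_cvg_einfs.
  have [L0 _ hL] := layers_ge t0.
  near=> n; apply: le_ereal_inf_tmp => _ [k /= nk <-].
  apply: hL => /=; apply: leq_trans nk; near: n; exact: nbhs_infty_ge.
have mD : measurable (`]0%R, +oo[%classic : set R) by exact: measurable_itv.
apply: le_trans (fatou leb1 mD _ _) _.
- move=> L; apply/measurable_EFinP/measurable_funTS; apply: measurable_sum => k.
  apply: measurable_funM => //; apply: measurable_funM; first exact: measurable_powR.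
  by apply: measurable_indic; exact: measurable_itv.
- move=> L t _; rewrite lee_fin sumr_ge0// => k _.
  by rewrite mulr_ge0 ?powR_ge0// mulr_ge0 ?powR_ge0// indicE.
rewrite limn_einf_lim; apply: lime_le; first exact: is_cvg_einfs.
apply: nearW => n; apply: le_trans (int_layers n); apply: ereal_inf_lbound.
by exists n => //=.
Unshelve. all: by end_near. Qed.

End lorentz_bound.

(** * Convergence *)

Section borel_transfer.
Context {R : realType} {N : nat}.
Local Notation E := 'rV[R]_N.
Local Notation lam := (rV_lebesgue R N).
Local Notation leb := (leb R N).

Lemma integral_leb_borel (D Z : set E) (f g : E -> \bar R) :
  measurable D -> measurable_fun (D : set (lebRN R N)) (f : lebRN R N -> \bar R) ->
  measurable_fun D g -> measurable Z -> lam Z = 0%E ->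
  (forall x, ~ Z x -> f x = g x) ->
  (\int[leb]_(x in (D : set (lebRN R N))) f x = \int[lam]_(x in D) g x)%E.
Proof.
move=> mD mf mg mZ Z0 fg; rewrite -integral_lebE//.
apply: ae_eq_integral => //.
- exact: measurable_lebRN.
- move=> _ Y mY; apply: measurable_lebRN; exact: mg.
exists Z; split; first exact: measurable_lebRN.
  by rewrite lebE.
by move=> x; apply: contra_notP => Zx Dx; exact: fg.
Qed.

Variables (u v : E -> R) (Z : set E).
Hypothesis mu : measurable_fun [set: lebRN R N] (u : lebRN R N -> R).
Hypothesis mv : measurable_fun [set: E] v.
Hypothesis mZ : measurable Z.
Hypothesis Z0 : lam Z = 0%E.
Hypothesis uv : forall x, ~ Z x -> u x = v x.

Lemma distr_borel l : distr u l = lam [set x | l < `|v x|].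
Proof.
have mB := measurable_superlevel l mv.
have mA : measurable ([set x | l < `|u x|] : set (lebRN R N)) := measurable_superlevel l mu.
have mZ' : measurable (Z : set (lebRN R N)) by exact: measurable_lebRN.
have lZ : leb Z = 0%E by rewrite lebE.
rewrite /distr -(measureU0 mA mZ' lZ) -(measureU0 mB mZ Z0).
rewrite -[RHS](lebE (measurableU _ _ mB mZ)).
congr (leb _); apply/seteqP.
by split=> x /=; have [Zx|/uv->] := pselect (Z x); tauto.
Qed.

Lemma integrable_on_balls_borel : loc_integrable u -> integrable_on_balls v.
Proof.
move=> li M; apply/integrableP; split; first exact/measurable_EFinP/measurable_funTS.
pose c : E := const_mx (- M); have /integrableP[_] := li _ (compact_cube (c := c) (r := M + M)).
apply: le_lt_trans.
have mav : measurable_fun [set: E] (fun x => `|v x|%:E).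
  exact: measurable_norm_EFin.
have mau : measurable_fun [set: lebRN R N] (fun x : lebRN R N => `|u x|%:E).
  exact: measurable_norm_EFin.
have mC := measurable_cube c (M + M).
have -> := @integral_leb_borel _ Z (fun x => `|u x|%:E) (fun x => `|v x|%:E) mC (measurable_funTS mau)
  (measurable_funTS mav) mZ Z0.
  apply: ge0_subset_integral.
  + exact: measurable_norm_ball.
  + exact: mC.
  + exact: measurable_funTS.
  + by move=> x _; rewrite lee_fin.
  + move=> x xM i; rewrite mxE.
    have := le_trans (rV_norm_coord x i) xM.
    by rewrite ler_norml addrA addNr add0r.
by move=> x /uv /= ->.
Qed.

Lemma integral_mul_borel (h : E -> R) : measurable_fun [set: E] h ->
  \int[leb]_x (u x * h x) = \int[lam]_x (v x * h x).
Proof.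
move=> mh; rewrite /Rintegral; congr fine.
have mh' : measurable_fun [set: lebRN R N] (h : lebRN R N -> R).
  exact: measurable_funT_lebRN.
have muh : measurable_fun [set: lebRN R N] (EFin \o (fun x : lebRN R N => u x * h x)).
  by apply/measurable_EFinP; exact: (measurable_funM mu mh').
have mvh : measurable_fun [set: E] (EFin \o (fun x => v x * h x)).
  by apply/measurable_EFinP; exact: (measurable_funM mv mh).
apply: (integral_leb_borel measurableT muh mvh mZ Z0).
by move=> x /uv /= ->.
Qed.

(** Substituting [a *: z + x] with [a = 2 ^ j] has Jacobian [a ^+ N], of which the dilation absorbs
    [a ^+ N.-1]; the centre is chosen so that the dilation evaluates [u] at exactly this point. The
    inequality is proved off a null set, which avoids measurability of the dilated [u]. *)
Lemma cube_integral_dilation (N0 : (0 < N)%N) (j : int) (x : E) :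
  (\int[lam]_(z in cube (0 : E) (2 ^ j)) `|v (x + z)|%:E <=
   (2 ^ j)%:E * \int[leb]_(z in (cube (0 : E) 1 : set (lebRN R N)))
     `|dilation j (- (2 ^ (- j) *: x)) u z|%:E)%E.
Proof.
pose a : R := 2 ^ j; have a0 : 0 < a by exact: exprz_gt0.
have an0 : a != 0 by rewrite gt_eqF.
pose T := fun z : E => a *: z + x.
have mT : measurable_fun [set: E] T by exact: measurable_rV_affine.
have dE (w : E -> R) z : dilation j (- (2 ^ (- j) *: x)) w z = a ^+ N.-1 * w (T z).
  rewrite /dilation opprK scalerDr scalerA -expfzDr ?pnatr_eq0// subrr expr0z scale1r.
  by rewrite (mulrC N.-1%:Z) -exprz_exp.
have mvT : measurable_fun [set: E] (fun z => `|v (T z)|%:E).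
  by apply: measurable_norm_EFin; exact: measurableT_comp.
have mvx : measurable_fun [set: E] (fun z => `|v (x + z)|%:E).
  apply/measurable_EFinP; apply: measurableT_comp => //; apply: measurableT_comp => //.
  rewrite (_ : +%R x = (fun z => z + x)); first exact: measurable_rV_translate.
  by apply/funext => z; rewrite addrC.
pose Z' := T @^-1` Z.
have mZ' : measurable Z' by rewrite /Z' -[X in measurable X]setTI; exact: mT.
have Z'0 : lam Z' = 0%E.
  have := rV_lebesgue_affine x a0 mZ; rewrite Z0 => /esym/eqP.
  by rewrite mule_eq0 eqe expf_eq0 (negbTE an0) andbF => /eqP.
have mC := measurable_cube (0 : E) 1.
have mCa := measurable_cube (0 : E) a.
have -> : (\int[lam]_(z in cube (0 : E) (2 ^ j)) `|v (x + z)|%:E =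
   (a ^+ N)%:E * \int[lam]_(z in cube (0 : E) 1) `|v (T z)|%:E)%E.
  rewrite [LHS]integral_mkcond (@ge0_integral_rV_affine _ _ a 0)//.
  - congr (_ * _)%E; rewrite [RHS]integral_mkcond; apply: eq_integral => z _.
    rewrite addr0 !patchE /T addrC (_ : (a *: z \in cube (0 : E) (2 ^ j)) = (z \in cube (0 : E) 1))//.
    apply/idP/idP => /set_mem h; apply/mem_set => i; have := h i; rewrite !mxE !add0r.
    + by rewrite pmulr_rge0// ger_pMr.
    + by rewrite pmulr_rge0// ger_pMr.
  - exact: (measurable_restrictT _ mCa).1 (measurable_funTS mvx).
  - by move=> z; rewrite patchE; case: ifP.
have aN : a ^+ N = a * a ^+ N.-1 by rewrite -exprS prednK.
rewrite aN EFinM -muleA; apply: lee_wpmul2l.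
  by rewrite lee_fin ltW.
rewrite -ge0_integralZl//; last 2 first.
- exact: measurable_funTS.
- by rewrite lee_fin exprn_ge0// ltW.
have mF : measurable_fun (cube (0 : E) 1) (fun z => ((a ^+ N.-1)%:E * `|v (T z)|%:E)%E).
  by apply: measurable_funTS; apply: measurable_funeM.
have F0 z : (0 <= (a ^+ N.-1)%:E * `|v (T z)|%:E)%E.
  by rewrite -EFinM lee_fin mulr_ge0// exprn_ge0// ltW.
rewrite (ge0_negligible_integral mZ')// -ge0_integral_lebE//; last 2 first.
- exact: measurableD.
- by apply: measurable_funS mF => //; exact: subDsetl.
rewrite integral_mkcond [leRHS]integral_mkcond.
apply: ge0_le_integral_nonmeasurable => z _; rewrite !patchE.
  by case: ifP.
case: ifPn => [/set_mem[Cz Zz]|_]; last first.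
  by rewrite [leLHS](_ : _ = 0%E)//; case: ifP => // _; rewrite lee_fin.
rewrite ifT; last exact: mem_set.
by rewrite dE uv// normrM ger0_norm// exprn_ge0// ltW.
Qed.

End borel_transfer.

Section lorentz_norm_estimates.
Context {R : realType} {N : nat}.
Local Notation E := 'rV[R]_N.
Local Notation lam := (rV_lebesgue R N).
Implicit Types u v : E -> R.

Lemma lorentz_norm_le (p q A B : R) (M : R -> R) u :
  0 < p -> 1 < q -> (forall l, 0 <= M l) ->
  (forall l k, 0 < l -> l <= k -> M k <= M l) ->
  (forall l, 0 < l -> distr u l = (M l)%:E) ->
  (forall a n, 0 < a -> \sum_(k < n) a * 2 ^+ k * M (a * 2 ^+ k.+1) `^ p^-1 <= A) ->
  (forall l, 0 < l -> l * M (2 * l) `^ p^-1 <= B) ->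
  (lorentz_norm p q u <= ((4 `^ q / (q / p) * (B `^ (q - 1) * A)) `^ q^-1)%:E)%E.
Proof.
move=> p0 q1 M0 leM uM sumA supB; rewrite /lorentz_norm -poweR_EFin.
have q0 : 0 < q by exact: lt_trans q1.
have rho_ge0 t : (0 <= rearrangement u t)%E by rewrite /rearrangement le_max lexx.
have h : (\int[lebesgue_measure]_(t in `]0%R, +oo[)
    ((rearrangement u t * (t `^ p^-1)%:E) `^ q * (t^-1)%:E) <=
    (4 `^ q / (q / p) * (B `^ (q - 1) * A))%:E)%E.
  apply: (lorentz_bound p0 q1 M0 sumA supB rho_ge0) => t l l0.
  rewrite /rearrangement lt_max => /orP[|/ereal_sup_gt[_ [k [k0 tk] <-]]].
    by rewrite lte_fin ltNge (ltW l0).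
  rewrite lte_fin => lk; rewrite uM// lte_fin in tk.
  by apply: lt_le_trans tk _; apply: leM => //; exact: ltW.
have I0 : (0 <= \int[lebesgue_measure]_(t in `]0%R, +oo[)
    ((rearrangement u t * (t `^ p^-1)%:E) `^ q * (t^-1)%:E))%E.
  apply: integral_ge0 => t /=; rewrite in_itv/= andbT => t0.
  by rewrite mule_ge0 ?poweR_ge0// lee_fin invr_ge0 ltW.
apply: gt0_ler_poweR => //; rewrite ?invr_ge0 ?(ltW q0)// in_itv/= leey andbT//.
exact: le_trans h.
Qed.

Lemma lorentz_norm0 (p q : R) : 0 < p -> 1 < q -> lorentz_norm p q (fun _ : E => 0) = 0%E.
Proof.
move=> p0 q1; apply/eqP; rewrite eq_le poweR_ge0 andbT.
have ip : p^-1 != 0 by rewrite invr_eq0 gt_eqF.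
have iq : q^-1 != 0 by rewrite invr_eq0 gt_eqF// (lt_trans _ q1).
rewrite (_ : 0%E = ((4 `^ q / (q / p) * (0 `^ (q - 1) * 0)) `^ q^-1)%:E); last first.
  by rewrite !mulr0 powR0.
apply: (@lorentz_norm_le p q 0 0 (fun=> 0)) => //.
- move=> l l0; rewrite /distr (_ : mkset _ = set0) ?measure0//.
  by apply/seteqP; split => x //=; rewrite normr0 ltNge (ltW l0).
- by move=> a n a0; rewrite big1// => k _; rewrite powR0 ?mulr0.
- by move=> l l0; rewrite powR0 ?mulr0.
Qed.

Lemma borel_representative u (V : R) : (0 < N)%N -> BVdot u ->
  (forall i phi, test_function phi -> (forall x, `|phi x| <= 1) ->
    `|\int[leb R N]_x (u x * pderive i phi x)| <= V) ->
  exists v, [/\ measurable_fun [set: E] v,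
    forall i h, 0 <= h -> (L1diff v (h *: delta_mx ord0 i) <= (h * V)%:E)%E,
    forall l, 0 < l -> (lam [set x | (l < `|v x|)%R] < +oo)%E,
    forall l, distr u l = lam [set x | (l < `|v x|)%R] &
    forall (j : int) (x : E), (\int[lam]_(z in cube (0 : E) (2 ^ j)) `|v (x + z)|%:E <=
      (2 ^ j)%:E * \int[leb R N]_(z in (cube (0 : E) 1 : set (lebRN R N)))
        `|dilation j (- (2 ^ (- j) *: x)) u z|%:E)%E].
Proof.
move=> N0 [mu lu u0 _] uV.
have [v [Z [mv mZ Z0 uv]]] := borel_version mu.
have duv := distr_borel mu mv mZ Z0 uv.
exists v; split => //.
- move=> i; apply: (L1_translation_le mv).
    exact: (integrable_on_balls_borel mu mv mZ Z0 uv).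
  move=> phi tphi phi1.
  rewrite -(integral_mul_borel mu mv mZ Z0 uv); first exact: uV.
  by apply: continuous_rV_measurable; apply: test_function_continuous; exact: test_function_pderive.
- by move=> l l0; rewrite -duv; exact: u0.
- exact: (cube_integral_dilation mv mZ Z0 uv).
Qed.

End lorentz_norm_estimates.

(* Otherwise some choice of dilations would violate the L^1_loc convergence on the unit cube. *)
Lemma uniform_dilation_bound (R : realType) (N : nat) (u : nat -> 'rV[R]_N -> R) :
  (forall (j : nat -> int) (y : nat -> 'rV[R]_N),
     cvg_L1loc (fun k => dilation (j k) (y k) (u k)) (fun=> 0)) ->
  forall e : R, 0 < e -> \forall k \near \oo, forall j y,
    (\int[leb R N]_(z in (cube (0 : 'rV[R]_N) 1 : set (lebRN R N)))
      `|dilation j y (u k) z|%:E <= e%:E)%E.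
Proof.
move=> ucvg e e0.
pose bad k (jy : int * 'rV[R]_N) := ~ (\int[leb R N]_(z in (cube (0 : 'rV[R]_N) 1 : set (lebRN R N)))
      `|dilation jy.1 jy.2 (u k) z|%:E <= e%:E)%E.
(* A bad pair is selected whenever there is one, so smallness at [k] along the selected sequence
   excludes every bad pair at [k]. *)
have h k : exists jy, (exists jy', bad k jy') -> bad k jy.
  by have [[jy hjy]|n] := pselect (exists jy', bad k jy'); [exists jy|exists (0, 0)].
have [jy hjy] := choice h.
have := ucvg (fun k => (jy k).1) (fun k => (jy k).2) _ (compact_cube (c := 0) (r := 1)).
move=> /fine_cvgP[fin /cvgrPdist_lt/(_ _ e0)]; apply: filter_app.
apply: filterS fin => k fk ek j y; apply: contrapT => hb.
have := hjy k (ex_intro _ (j, y) hb); apply.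
under eq_integral do rewrite -[dilation _ _ _ _]subr0.
rewrite -(fineK fk) lee_fin; apply/ltW; move: ek; rewrite sub0r normrN.
exact: le_lt_trans (ler_norm _).
Qed.

Theorem theorem2p1 (R : realType) (N : nat) (q : R)
    (u : nat -> 'rV[R]_N -> R) :
  (2 <= N)%N ->
  1 < q -> q <= N%:R / (N%:R - 1) ->
  (forall k, BVdot (u k)) ->
  (forall (j : nat -> int) (y : nat -> 'rV[R]_N),
     weak_cvg (fun k => dilation (j k) (y k) (u k)) (fun=> 0)) ->
  cvg_lorentz (N%:R / (N%:R - 1)) q u (fun=> 0).
Proof.
move=> N2 q1 _ uBV uw; set p := N%:R / (N%:R - 1).
have N0 : (0 < N)%N by exact: leq_trans N2.
have N1E : N%:R - 1 = N.-1%:R :> R by rewrite -{1}(prednK N0) -natr1 addrK.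
have N10 : 0 < N.-1%:R :> R by rewrite ltr0n -ltnS prednK.
have p0 : 0 < p by rewrite /p N1E divr_gt0// ltr0n.
(* [p^-1] is (N-1)/N, so the quantity summed in the Lorentz bound is the power [N.-1] of
   [level_root]. *)
have pE (m : R) : m `^ p^-1 = (m `^ N%:R^-1) ^+ N.-1.
  by rewrite /p N1E invf_div mulrC powRrM powR_mulrn// powR_ge0.
have [V0 hV0] := weak_cvg_bounded (uw (fun=> 0) (fun=> 0)).
pose V := `|V0|; have V_ge0 : 0 <= V by rewrite normr_ge0.
have hV k i phi : test_function phi -> (forall x, `|phi x| <= 1) ->
    `|\int[leb R N]_x (u k x * pderive i phi x)| <= V.
  move=> tphi phi1; apply: le_trans (ler_norm V0).
  apply: le_trans (hV0 k i phi tphi phi1); rewrite le_eqVlt; apply/orP; left; apply/eqP.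
  congr (`| _ |).
  rewrite /Rintegral; congr fine; apply: eq_integral => x _.
  by rewrite /dilation mulr0 !expr0z mul1r scale1r subr0.
have [v hv] := choice (fun k => borel_representative N0 (uBV k) (hV k)).
pose A := 64 * (N%:R * V); have A0 : 0 <= A by rewrite !mulr_ge0.
have bound k B : (forall l, 0 < l -> l * level_root (v k) (2 * l) ^+ N.-1 <= B) ->
    (lorentz_norm p q (u k) <= ((4 `^ q / (q / p) * (B `^ (q - 1) * A)) `^ q^-1)%:E)%E.
  have [mv vV vfin uv _] := hv k; move=> hB.
  apply: (lorentz_norm_le p0 q1 (level_measure_ge0 (v k)) (le_level_measure mv vfin)).
  - by move=> l l0; rewrite uv fineK// ge0_fin_numE// vfin.
  - move=> a n a0; under eq_bigr do rewrite pE.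
    exact: strong_estimate.
  - by move=> l l0; rewrite pE; exact: hB.
(* A single term of [strong_estimate] already gives the supremum bound with [B = A], hence
   finiteness. *)
have fin k : (lorentz_norm p q (u k) < +oo)%E.
  have [mv vV vfin _ _] := hv k; apply: le_lt_trans (bound k A _) (ltry _).
  move=> l l0; have := strong_estimate N2 mv vV vfin 1 l0.
  by rewrite big_ord1 expr0 mulr1 expr1 (mulrC l 2).
have ge0 k : (0 <= lorentz_norm p q (u k))%E by exact: poweR_ge0.
split.
- by move=> k; split; [have [] := uBV k|exact: fin].
- by split; [exact: measurable_cst|rewrite lorentz_norm0].
rewrite (_ : (fun k => _) = (fun k => lorentz_norm p q (u k))); last first.
  by apply/funext => k; congr lorentz_norm; apply/funext => x; rewrite subr0.
apply/fine_cvgP; split; first by apply: nearW => k; rewrite ge0_fin_numE.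
apply/cvgrPdist_le => d d0.
pose C := 4 `^ q / (q / p) * A.
have q0 : 0 < q by exact: lt_trans q1.
have C_ge0 : 0 <= C.
  apply: mulr_ge0 => //; apply: divr_ge0; first exact: powR_ge0.
  by apply: divr_ge0; exact: ltW.
(* Chosen so that C B^(q-1) is at most d^q; below, [e] makes the bound [2 * e * W] of
   [morrey_estimate] at most [B ^+ N]. Adding 1 to [C] and [W] guards against zero denominators. *)
pose B := (d `^ q / (C + 1)) `^ (q - 1)^-1.
have C10 : 0 < C + 1 by rewrite ltr_wpDl.
have dq0 : 0 < d `^ q / (C + 1) by rewrite divr_gt0// powR_gt0.
have B0 : 0 < B by exact: powR_gt0.
pose W := (4 * (N%:R * V)) ^+ N.-1.
have W0 : 0 <= W by rewrite exprn_ge0// !mulr_ge0.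
pose e := B ^+ N / (2 * (W + 1)).
have W10 : 0 < W + 1 by rewrite ltr_wpDl.
have e0 : 0 < e by rewrite divr_gt0 ?exprn_gt0 ?mulr_gt0.
have ucvg j y : cvg_L1loc (fun k => dilation (j k) (y k) (u k)) (fun=> 0).
  by have [] := uw j y.
apply: filterS (uniform_dilation_bound ucvg e0) => k hk.
have [mv vV vfin _ vd] := hv k.
rewrite sub0r normrN ger0_norm ?fine_ge0// -lee_fin fineK ?ge0_fin_numE//.
apply: le_trans (bound k B _) _.
  move=> l l0; rewrite -(@ler_pXn2r _ N)// ?nnegrE ?(ltW B0)//; last first.
    by rewrite mulr_ge0 ?exprn_ge0 ?level_root_ge0// ltW.
  apply: le_trans (morrey_estimate N2 mv vV vfin e0 l0 _) _.
    move=> j x; apply: le_trans (vd j x) _.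
    rewrite mulrC EFinM; apply: lee_wpmul2l; first by rewrite lee_fin exprz_ge0.
    exact: hk.
  have -> : 2 * e * (4 * (N%:R * V)) ^+ N.-1 = B ^+ N * (W / (W + 1)).
    by rewrite -/W /e; field; rewrite gt_eqF.
  by rewrite ler_piMr ?exprn_ge0 ?(ltW B0)// ler_pdivrMr// mul1r lerDl.
rewrite lee_fin.
have -> : 4 `^ q / (q / p) * (B `^ (q - 1) * A) = C * B `^ (q - 1) by rewrite /C; ring.
have -> : B `^ (q - 1) = d `^ q / (C + 1).
  by rewrite /B -powRrM mulVf ?powRr1 ?(ltW dq0)// subr_eq0 gt_eqF.
rewrite [leRHS](_ : d = (d `^ q) `^ q^-1); last first.
  by rewrite -powRrM mulfV ?powRr1 ?(ltW d0) ?gt_eqF.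
apply: ge0_ler_powR; rewrite ?nnegrE ?powR_ge0 ?invr_ge0 ?(ltW q0)//.
  by apply: mulr_ge0 => //; exact: ltW.
by rewrite mulrCA ler_piMr ?powR_ge0// ler_pdivrMr// mul1r lerDl.
Qed.
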